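(* Assume that $q$ and $f$ satisfy the standing assumptions listed in the context and that $k(0)>0$. Let $e\in\mathbb{R}^N$ be a unit vector, let $c_0$ be the linear speed and $c^*$ the minimal speed in the direction $e$, and let $c_1>c_0$. Suppose that there exists a continuous function $V(s,x)$ on $\mathbb{R}\times\mathbb{R}^N$, $L$-periodic in $x$, satisfying $$0<V(s,x)<1,\qquad \limsup_{s\to+\infty}V(s,x)<1 \text{ (uniformly in } x),\qquad V(s,x)\sim\Psi_{\mu_2(c_1)}(x)\,e^{\mu_2(c_1)s}\ \text{ as } s\to-\infty,$$ and $$L_{c_1}V+f(x,V)\ge0\quad\text{in }\mathbb{R}\times\mathbb{R}^N.$$ Then $c^*\ge c_1$ and no traveling waves (pulsating traveling fronts) exist for $c\in[c_0,c_1)$. In other words, nonlinear selection ($c^*>c_0$) is realized.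
   Context: Let $N\ge 1$ and $L_1,\dots,L_N>0$. A function on $\mathbb{R}^N$ is $L$-periodic if it is invariant under translations by all $k\in L_1\mathbb{Z}\times\cdots\times L_N\mathbb{Z}$. Standing assumptions. The vector field $q:\mathbb{R}^N\to\mathbb{R}^N$ is of class $C^{1,\alpha}$ for some $\alpha>0$, is $L$-periodic, and satisfies $\nabla\cdot q\equiv0$. The function $f:\mathbb{R}^N\times[0,1]\to\mathbb{R}$ is of class $C^{1,\alpha}$, $f\ge0$, $f$ is $L$-periodic in $x$, $f(x,0)=f(x,1)=0$ for all $x$; there is $\rho\in(0,1)$ such that $f(x,s)\ge f(x,s')$ for all $x\in\mathbb{R}^N$ and $1-\rho\le s\le s'\le1$; and for every $s\in(0,1)$ there is $x\in\mathbb{R}^N$ with $f(x,s)>0$. Put $\eta(x)=\partial_u f(x,0)$. Wavefronts. For a unit vector $e$ and $c\in\mathbb{R}$, on $\mathbb{R}\times\mathbb{R}^N\ni(s,x)$ define $$L_c\phi=\Delta_x\phi+\phi_{ss}+2e\cdot\nabla_x\phi_s+q\cdot\nabla_x\phi+(q\cdot e-c)\phi_s .$$ For merely continuous functions, inequalities involving $L_c$ are understood in the sense of distributions. A pulsating traveling front with speed $c$ in the direction $e$ is a function $\phi(s,x)$ with $0\le\phi\le1$, $L$-periodic in $x$, such that $L_c\phi+f(x,\phi)=0$ on $\mathbb{R}\times\mathbb{R}^N$, $\lim_{s\to-\infty}\phi(s,x)=0$ and $\lim_{s\to+\infty}\phi(s,x)=1$ uniformly in $x$; equivalently $u(t,x)=\phi(x\cdot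 e+ct,x)$ is a classical solution of $u_t=\Delta u+q\cdot\nabla u+f(x,u)$. Minimal speed. $c^*=c^*(e)$ is the threshold given by a theorem of Berestycki and Hamel: the number $c^*>0$ such that there is no pulsating traveling front with speed $c$ if $c<c^*$, while for each $c\ge c^*$ there is one that is increasing in $s$. Linear speed. For $\lambda\in\mathbb{R}$, $k(\lambda)$ is the principal eigenvalue of $$\Psi\mapsto\Delta\Psi+2\lambda e\cdot\nabla\Psi+q\cdot\nabla\Psi+[\lambda^2+\lambda q\cdot e+\eta(x)]\Psi$$ acting on $L$-periodic $C^2$ functions, and $\Psi_\lambda>0$ is the corresponding principal eigenfunction (unique up to a positive multiplicative constant). $c_0=c_0(e)=\min_{\lambda>0}k(\lambda)/\lambda$. When $k(0)>0$, the minimum is attained; for $c>c_0$ the equation $c\lambda=k(\lambda)$ has exactly two solutions $\mu_1(c)<\mu_2(c)$ in $\lambda>0$. The notation $g(s,x)\sim h(s,x)$ as $s\to-\infty$ means $g/h\to1$ as $s\to-\infty$, uniformly in $x$. The case $c^*>c_0$ is called nonlinear selection. *)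

(* Defs.v *)
From HB Require Import structures.
From mathcomp Require Import all_boot all_order all_algebra.
From mathcomp Require Import all_classical all_reals all_analysis.

Set Implicit Arguments.
Unset Strict Implicit.
Unset Printing Implicit Defensive.

Import Order.TTheory GRing.Theory Num.Theory.
Import numFieldNormedType.Exports.

Local Open Scope classical_set_scope.
Local Open Scope ring_scope.

Section regularity.
Context {R : realType}.

(* All directional derivatives up to order n exist everywhere and are
   continuous; on a finite-dimensional V this is the usual class C^n. *)
Fixpoint Ck {V : normedModType R} (n : nat) (g : V -> R) : Prop :=
  continuous g /\
  match n with
  | 0 => True
  | m.+1 => forall v : V, (forall p, derivable g p v) /\ Ck m ('D_v g)
  end.

(* Class C^{1,alpha} on A.  The derivative at p is taken relative to A, so it
   makes sense up to the boundary of A. *)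
Definition C1_holder {V W : normedModType R} (A : set V) (alpha : R)
    (g : V -> W) : Prop :=
  exists dg : V -> {linear V -> W},
    (forall p, A p -> forall eps : R, 0 < eps ->
       \forall y \near within A (nbhs p),
         `|g y - g p - dg p (y - p)| <= eps * `|y - p|) /\
    (exists K : R, forall p p', A p -> A p' -> forall v,
       `|dg p v - dg p' v| <= K * `|p - p'| `^ alpha * `|v|).

End regularity.

Section periodic_media.
Context {R : realType} {N : nat}.
Local Notation space := 'rV[R]_N.

Definition basis_vec (i : 'I_N) : space := delta_mx 0 i.
Definition dot (v w : space) : R := \sum_i v 0 i * w 0 i.

Definition grad (g : space -> R) (x : space) : space :=
  \row_i 'D_(basis_vec i) g x.
Definition laplacian (g : space -> R) (x : space) : R :=
  \sum_i 'D_(basis_vec i) ('D_(basis_vec i) g) x.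
Definition divergence (w : space -> space) (x : space) : R :=
  \sum_i 'D_(basis_vec i) (fun y => w y 0 i) x.

Definition periodic {T : Type} (L : 'I_N -> R) (g : space -> T) : Prop :=
  forall (k : 'I_N -> int) (x : space),
    g (x + \row_i ((k i)%:~R * L i)) = g x.

(* Only the values f x s with 0 <= s <= 1 are constrained. *)
Record standing_assumptions (L : 'I_N -> R) (alpha : R) (q : space -> space)
    (f : space -> R -> R) : Prop := StandingAssumptions {
  period_gt0 : forall i, 0 < L i;
  alpha_gt0 : 0 < alpha;
  q_C1a : C1_holder setT alpha q;
  q_periodic : periodic L q;
  q_div0 : forall x, divergence q x = 0;
  f_C1a : C1_holder [set p : space * R | 0 <= p.2 <= 1] alpha
            (fun p : space * R => f p.1 p.2);
  f_ge0 : forall x s, 0 <= s <= 1 -> 0 <= f x s;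
  f_periodic : forall s, 0 <= s <= 1 -> periodic L (f ^~ s);
  f_at0 : forall x, f x 0 = 0;
  f_at1 : forall x, f x 1 = 0;
  f_nonincr_near1 : exists2 rho : R, 0 < rho < 1 &
    forall x s s', 1 - rho <= s -> s <= s' -> s' <= 1 -> f x s' <= f x s;
  f_pos_somewhere : forall s, 0 < s < 1 -> exists x, 0 < f x s
}.

(* One-sided, f being given on [0, 1] only. *)
Definition eta (f : space -> R -> R) (x : space) : R :=
  lim ((fun u : R => (f x u - f x 0) / u) @ 0^'+).

Section linear_speed.
Variables (L : 'I_N -> R) (q : space -> space) (f : space -> R -> R)
  (e : space).

Definition eigen_op (lambda : R) (Psi : space -> R) (x : space) : R :=
  laplacian Psi x + 2 * lambda * dot e (grad Psi x) + dot (q x) (grad Psi x)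
  + (lambda ^+ 2 + lambda * dot (q x) e + eta f x) * Psi x.

Definition principal_eigenfunction (lambda k : R) (Psi : space -> R) : Prop :=
  [/\ Ck 2 Psi, periodic L Psi, forall x, 0 < Psi x
    & forall x, eigen_op lambda Psi x = k * Psi x].

Definition principal_eigenvalue (lambda k : R) : Prop :=
  exists Psi, principal_eigenfunction lambda k Psi.

End linear_speed.

Definition is_linear_speed (k : R -> R) (c0 : R) : Prop :=
  let speeds := [set k lambda / lambda | lambda in [set l : R | 0 < l]] in
  speeds c0 /\ lbound speeds c0.

(* mu1 < mu2 are exactly the solutions in lambda > 0 of c lambda = k(lambda). *)
Definition speed_roots (k : R -> R) (c mu1 mu2 : R) : Prop :=
  0 < mu1 < mu2 /\
  forall lambda, 0 < lambda ->
    (c * lambda = k lambda <-> lambda = mu1 \/ lambda = mu2).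

(* Points of the phase space are pairs (s, x). *)
Local Notation phase := (R * space)%type.

Definition s_dir : phase := (1, 0).
Definition x_dir (i : 'I_N) : phase := (0, basis_vec i).

Definition grad_x (phi : phase -> R) (p : phase) : space :=
  \row_i 'D_(x_dir i) phi p.
Definition laplacian_x (phi : phase -> R) (p : phase) : R :=
  \sum_i 'D_(x_dir i) ('D_(x_dir i) phi) p.
Definition divergence_x (w : phase -> space) (p : phase) : R :=
  \sum_i 'D_(x_dir i) (fun r => w r 0 i) p.

Definition periodic_x (L : 'I_N -> R) (phi : phase -> R) : Prop :=
  forall s : R, periodic L (fun x => phi (s, x)).

Definition unif_cvg_s (F : set_system R) (phi : phase -> R) (l : R) : Prop :=
  forall eps : R, 0 < eps ->
    \forall s \near F, forall x : space, `|phi (s, x) - l| < eps.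

Definition equivalent_at_ninfty (g h : phase -> R) : Prop :=
  unif_cvg_s (-oo : set_system R) (fun p => g p / h p) 1.

Section fronts.
Variables (L : 'I_N -> R) (q : space -> space) (f : space -> R -> R)
  (e : space).

Definition Lop (c : R) (phi : phase -> R) (p : phase) : R :=
  laplacian_x phi p + 'D_s_dir ('D_s_dir phi) p
  + 2 * dot e (grad_x ('D_s_dir phi) p)
  + dot (q p.2) (grad_x phi p) + (dot (q p.2) e - c) * 'D_s_dir phi p.

(* Classical solutions: for c != 0, (t, x) |-> (x.e + ct, x) is a linear change
   of variables under which they correspond to u_t = Delta u + q.grad u + f. *)
Record pulsating_front (c : R) (phi : phase -> R) : Prop := PulsatingFront {
  front_C2 : Ck 2 phi;
  front_bounds : forall p, 0 <= phi p <= 1;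
  front_periodic : periodic_x L phi;
  front_eq : forall p, Lop c phi p + f p.2 (phi p) = 0;
  front_ninfty : unif_cvg_s (-oo : set_system R) phi 0;
  front_pinfty : unif_cvg_s (+oo : set_system R) phi 1
}.

Definition increasing_s (phi : phase -> R) : Prop :=
  forall (x : space) (s s' : R), s < s' -> phi (s, x) < phi (s', x).

Definition is_minimal_speed (cstar : R) : Prop :=
  [/\ 0 < cstar,
      forall c, c < cstar -> ~ exists phi, pulsating_front c phi
    & forall c, cstar <= c ->
        exists2 phi, pulsating_front c phi & increasing_s phi].

End fronts.

(* Iterated Lebesgue integral over R^n; used only for continuous, compactly
   supported integrands, for which it is the n-dimensional integral. *)
Fixpoint integral_rV (n : nat) : ('rV[R]_n -> R) -> R :=
  match n with
  | 0 => fun g => g 0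
  | m.+1 => fun g =>
      \int[@lebesgue_measure R]_t
        integral_rV (fun y : 'rV[R]_m =>
          g (row_mx (\row_(_ < 1) t) y : 'rV[R]_(1 + m)))
  end.

Definition integral_phase (g : phase -> R) : R :=
  \int[@lebesgue_measure R]_s integral_rV (fun x : space => g (s, x)).

Definition test_function (zeta : phase -> R) : Prop :=
  (forall n, Ck n zeta) /\ compact (closure [set p | zeta p != 0]).

(* Formal adjoint of Lop: each derivative in Lop is moved onto the test
   function together with its coefficient. *)
Definition Lop_adj (q : space -> space) (e : space) (c : R)
    (zeta : phase -> R) (p : phase) : R :=
  laplacian_x zeta p + 'D_s_dir ('D_s_dir zeta) p
  + 2 * dot e (grad_x ('D_s_dir zeta) p)
  - divergence_x (fun r => zeta r *: q r.2) p
  - (dot (q p.2) e - c) * 'D_s_dir zeta p.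

(* L_c V + f(x, V) >= 0 in the sense of distributions. *)
Definition distr_subsolution (q : space -> space) (f : space -> R -> R)
    (e : space) (c : R) (V : phase -> R) : Prop :=
  forall zeta, test_function zeta -> (forall p, 0 <= zeta p) ->
    0 <= integral_phase
           (fun p => V p * Lop_adj q e c zeta p + f p.2 (V p) * zeta p).

End periodic_media.

(* Main.v *)
Require Import Defs.
From HB Require Import structures.
From mathcomp Require Import all_boot all_order all_algebra.
From mathcomp Require Import all_classical all_reals all_analysis.
From mathcomp Require Import ring lra.

Set Implicit Arguments.
Unset Strict Implicit.
Unset Printing Implicit Defensive.

Import Order.TTheory GRing.Theory Num.Theory.
Import numFieldNormedType.Exports.

Local Open Scope classical_set_scope.
Local Open Scope ring_scope.

(** Suppose the minimal speed were smaller than [c1].  Then some speed [c] with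
    [c0 < c < c1] carries a front [phi] that increases in [s], and [V] is used
    as an obstacle that this front would have to cross.

    In the frame of speed [c1], the function [phi(s - (c1 - c) t, x)] is an exact
    solution of the evolution equation [u_t = Lop c1 u + f(x, u)]: it drifts to
    the right and tends to [0] pointwise as [t] grows.  The function [V] is a
    stationary subsolution of the same equation.  If [V] lies below a translate
    of [phi] at time [0], comparison keeps [V] below the drifting front for all
    times, so [V <= 0], which contradicts [V > 0].

    The initial ordering is a matter of decay as [s] tends to [-oo].  Since
    [c < c1], the exponent [mu2] of [V] satisfies [c mu2 < k(mu2)], so
    [Psi(x) exp(mu2 s)] is a strict subsolution of the problem for [phi] linearized
    at [0].  It can be compared with [phi] because a positive strict supersolution
    [Theta(x) exp(nu s)] with slower decay is available to divide by: [nu] is a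
    minimizer of [k(lambda) / lambda], and convexity of [k] places it to the left
    of [mu2].  Hence [phi >= delta Psi(x) exp(mu2 s)] near [-oo]
    ([minimizer_lt_second_root], [front_lower_bound]), and a large translate of
    [phi] dominates [V] everywhere ([initial_order]).

    The comparison is run as a sliding argument: the translation [r] plays the
    role of time, and [exp(kap r) (V - phi(s + r, x))] is maximized over [r], [s]
    and a period cell in [x].  At a positive maximum the derivative in [r] bounds
    [phi_s] from below, and this beats the Lipschitz constant of [f] as soon as
    [kap] is large ([sliding_contradiction]).

    At such a maximum a differential inequality for [V] is needed, but [V] is only
    continuous and a subsolution in the sense of distributions.  It is replaced
    by a mollification [M], uniformly close to [V], and the distributional
    inequality tested with the mollifier becomes an inequality for any smooth
    function that touches [M] from above ([viscosity_approximation]).  The drift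
    [q] varies in space, so mollifying it leaves a commutator; as [q] is
    divergence free, the commutator is controlled by the oscillation of [V] at
    the scale of the mollifier, and it vanishes in the limit. *)

(** * Calculus along lines *)

Section directional.
Context {R : realType} {V : normedModType R}.
Implicit Types (g : V -> R) (p v w : V).

Lemma continuous_epsdelta g : continuous g <->
  forall p (eps : R), 0 < eps ->
    exists2 d : R, 0 < d & forall z, `|z| < d -> `|g (p + z) - g p| < eps.
Proof.
split=> [cg p eps e0|H p].
  have /cvgrPdist_lt /(_ _ e0) /nbhs_normP[d /= d0 H] := cg p.
  exists d => // z zd; rewrite distrC; apply: H => /=.
  by rewrite opprD addNKr normrN.
apply/cvgrPdist_lt => eps e0; have [d d0 Hd] := H p _ e0.
apply/nbhs_normP; exists d => //= y; rewrite /= => yd.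
rewrite distrC; have := Hd (y - p); rewrite (addrC p) subrK; apply.
by rewrite distrC.
Qed.

Lemma is_derive_epsdelta g p v (d : R) : is_derive p v g d <->
  forall eps : R, 0 < eps -> exists2 del : R, 0 < del &
    forall h : R, h != 0 -> `|h| < del ->
      `|h^-1 * (g (p + h *: v) - g p) - d| < eps.
Proof.
have E : (forall eps : R, 0 < eps -> exists2 del : R, 0 < del &
    forall h : R, h != 0 -> `|h| < del ->
      `|h^-1 * (g (p + h *: v) - g p) - d| < eps) <->
  (fun h => h^-1 *: ((g \o shift p) (h *: v) - g p)) @ (0 : R)^' --> d.
  split=> [H|/cvgrPdist_lt H eps e0].
    apply/cvgrPdist_lt => eps e0; have [del d0 Hd] := H _ e0.
    exists del => //= h; rewrite /= sub0r normrN => hd h0.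
    by rewrite distrC /= (addrC (h *: v)); apply: Hd.
  have [del /= d0 Hd] := H _ e0; exists del => // h h0 hd.
  have := Hd h; rewrite /= sub0r normrN => /(_ hd h0).
  by rewrite distrC /= (addrC (h *: v)).
rewrite E; split=> [[Hd Hv]|H].
  by rewrite -Hv; exact: Hd.
by apply: DeriveDef; [apply/cvg_ex; exists d|exact: cvg_lim].
Qed.

End directional.

Section lines.
Context {R : realType} {V : normedModType R}.
Implicit Types (g : V -> R) (p v w : V).

Lemma is_derive_line g p v (t : R) : derivable g (p + t *: v) v ->
  is_derive t (1 : R) (fun u : R => g (p + u *: v)) ('D_v g (p + t *: v)).
Proof.
move=> /derivableP /is_derive_epsdelta H; apply/is_derive_epsdelta => eps e0.
have [del d0 Hd] := H _ e0; exists del => // h h0 hd.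
by have := Hd _ h0 hd; rewrite -addrA -scalerDl /GRing.scale /= mulr1.
Qed.

Lemma line_mvt g p v (h : R) : (forall p, derivable g p v) ->
  exists2 t : R, 0 < t < 1 &
    g (p + h *: v) - g p = h * 'D_v g (p + (t * h) *: v).
Proof.
move=> dg.
pose k (u : R) := g (p + u *: (h *: v)).
have dk (t : R) : is_derive t 1 k (h * 'D_v g (p + (t * h) *: v)).
  apply/is_derive_epsdelta => eps e0.
  have := is_derive_line (dg (p + (t * h) *: v)).
  have [h0|h0] := eqVneq h 0.
    move=> _; exists 1 => // u u0 _; rewrite /k h0 !scale0r !scaler0 subrr.
    by rewrite !mul0r mulr0 subrr normr0.
  move=> /is_derive_epsdelta /(_ (eps / `|h|)).
  rewrite divr_gt0 ?normr_gt0// => /(_ isT)[del d0 Hd].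
  exists (del / `|h|); first by rewrite divr_gt0 ?normr_gt0.
  move=> u u0 ud; have := Hd (u * h); rewrite mulf_neq0// normrM.
  rewrite -ltr_pdivlMr ?normr_gt0// => /(_ isT ud).
  rewrite ltr_pdivlMr ?normr_gt0//.
  rewrite mulrC -normrM mulrBr /k.
  have -> : p + (t + u *: (1 : R)) *: (h *: v) = p + (t * h) *: v + (u * h) *: v.
    by rewrite -addrA -scalerDl scalerA [u *: 1]mulr1 mulrDl.
  have -> A : h * ((u * h)^-1 * A) = u^-1 * A by field; rewrite u0 h0.
  by rewrite scalerA [(u * h) *: (1 : R)]mulr1 scalerDl addrA.

have ck : {within `[0 : R, 1], continuous k}.
  apply: derivable_within_continuous => x _.
  exact: (@ex_derive _ _ _ _ _ _ _ (dk x)).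
have [c c01 E] := MVT ltr01 (fun x _ => dk x) ck.
exists c; first by move: c01; rewrite in_itv.
by move: E; rewrite /k scale1r scale0r addr0 subr0 mulr1.
Qed.

End lines.

Section second_order.
Context {R : realType} {V : normedModType R}.
Implicit Types (g : V -> R) (p v w : V).

Lemma derive_opp_dir g p v : derivable g p v -> is_derive p (- v) g (- 'D_v g p).
Proof.
move=> /derivableP /is_derive_epsdelta H; apply/is_derive_epsdelta => eps e0.
have [d d0 Hd] := H _ e0; exists d => // h h0 hd.
have := Hd (- h); rewrite oppr_eq0 normrN => /(_ h0 hd).
rewrite scalerN scaleNr invrN; move: (g _ - g p) => A.
by rewrite -(normrN (_ - _)) opprB mulNr opprK addrC => H'; rewrite opprK.
Qed.

Lemma derive_scale_dir g p v (a : R) : derivable g p v ->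
  is_derive p (a *: v) g (a * 'D_v g p).
Proof.
move=> dg; have [->|a0] := eqVneq a 0.
  by rewrite scale0r mul0r; exact: is_derive0.
move/derivableP/is_derive_epsdelta : dg => H.
apply/is_derive_epsdelta => eps e0.
have /H[d d0 Hd] : 0 < eps / `|a| by rewrite divr_gt0 ?normr_gt0.
exists (d / `|a|); first by rewrite divr_gt0 ?normr_gt0.
move=> h h0 hd; have := Hd (h * a).
rewrite mulf_neq0// normrM -ltr_pdivlMr ?normr_gt0// => /(_ isT hd).
rewrite ltr_pdivlMr ?normr_gt0// mulrC -normrM mulrBr scalerA.
by have -> A : a * ((h * a)^-1 * A) = h^-1 * A by field; rewrite a0 h0.
Qed.

Lemma small_combination (a b d : R) v w : 0 < d ->
  exists2 e : R, 0 < e & forall s t : R, `|s| < e -> `|t| < e ->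
    `|s *: v + t *: w| < d.
Proof.
move=> d0; exists (d / (`|v| + `|w| + 1)).
  by rewrite divr_gt0// ltr_wpDl// addr_ge0.
move=> s t hs ht; apply: le_lt_trans (ler_normD _ _) _; rewrite !normrZ.
have D0 : 0 < `|v| + `|w| + 1 by rewrite ltr_wpDl// addr_ge0.
set e := d / _ in hs ht; have -> : d = e * (`|v| + `|w| + 1).
  by rewrite /e divfK// gt_eqF.
have e0 : 0 < e by rewrite divr_gt0.
have := ler_wpM2r (normr_ge0 v) (ltW hs); have := ler_wpM2r (normr_ge0 w) (ltW ht).
lra.
Qed.

(** The increment along [v + w] splits into one along [v] and one along [w] from a
    moved base point; the mean value theorem and continuity of ['D_w g] absorb the
    move.  Linearity in the direction thus needs no Frechet derivative. *)
Lemma derive_add_dir g v w : (forall p, derivable g p v) ->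
  (forall p, derivable g p w) -> continuous ('D_w g) ->
  forall p, is_derive p (v + w) g ('D_v g p + 'D_w g p).
Proof.
move=> dv dw cw p; apply/is_derive_epsdelta => eps e0.
have e2 : 0 < eps / 2 by rewrite divr_gt0.
have /derivableP/is_derive_epsdelta /(_ _ e2)[d1 d10 H1] := dv p.
have [d2 d20 H2] := (continuous_epsdelta _).1 cw p _ e2.
have [d3 d30 H3] := small_combination 0 0 v w d20.
exists (Num.min d1 d3); first by rewrite lt_min d10.
move=> h h0; rewrite lt_min => /andP[h1 h3].
have [t /andP[/ltW t0 /ltW t1] E] := line_mvt (p + h *: v) h dw.
have := H1 h h0 h1.
have := H2 (h *: v + (t * h) *: w).
have th : `|t * h| < d3.
  by rewrite normrM (ger0_norm t0) (le_lt_trans _ h3)// ler_piMl.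
rewrite H3// => /(_ isT).
rewrite scalerDr !addrA.
have -> : g (p + h *: v + h *: w) - g p =
  h * 'D_w g (p + h *: v + (t * h) *: w) + (g (p + h *: v) - g p).
  by rewrite -E; ring.
move: (g (p + h *: v) - g p) => X.
set A := 'D_w g (_ + _); set B := 'D_w g p; set D := 'D_v g p => a b.
have -> : h^-1 * (h * A + X) - (D + B) = (A - B) + (h^-1 * X - D).
  by field.
by apply: le_lt_trans (ler_normD _ _) _; rewrite (splitr eps) ltrD.
Qed.

(** The mean value theorem applied twice, first to [g(. + h w) - g] along [v] and then
    to ['D_v g] along [w]. *)
Lemma mixed_difference g p v w (h : R) : (forall p, derivable g p v) ->
  (forall p, derivable ('D_v g) p w) ->
  exists s t : R, [/\ 0 < s < 1, 0 < t < 1 &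
    g (p + h *: v + h *: w) - g (p + h *: v) - (g (p + h *: w) - g p) =
    h * (h * 'D_w ('D_v g) (p + ((s * h) *: v + (t * h) *: w)))].
Proof.
move=> dv dvw.
pose k q := g (q + h *: w) - g q.
have ek q : is_derive q v k ('D_v g (q + h *: w) - 'D_v g q).
  apply/is_derive_epsdelta => eps e0.
  have e2 : 0 < eps / 2 by rewrite divr_gt0.
  have /derivableP/is_derive_epsdelta /(_ _ e2)[d1 d10 H1] := dv (q + h *: w).
  have /derivableP/is_derive_epsdelta /(_ _ e2)[d2 d20 H2] := dv q.
  exists (Num.min d1 d2); first by rewrite lt_min d10.
  move=> u u0; rewrite lt_min => /andP[/(H1 u u0) a /(H2 u u0) b].
  rewrite /k (addrAC q); move: a b.
  set A := g _; set B := g _; set C := 'D_v g _; set D := g _; set E := g q.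
  set F := 'D_v g q => a b.
  have -> : u^-1 * (A - D - (B - E)) - (C - F) =
    (u^-1 * (A - B) - C) - (u^-1 * (D - E) - F) by ring.
  by apply: le_lt_trans (ler_normB _ _) _; rewrite (splitr eps) ltrD.
have [s hs E] := line_mvt p h (fun q => @ex_derive _ _ _ _ _ _ _ (ek q)).
have [t ht E'] := line_mvt (p + (s * h) *: v) h dvw.
exists s, t; split=> //.
have := ek (p + (s * h) *: v) => /(@derive_val _ _ _ _ _ _ _) E2.
by move: E; rewrite E2 E' /k addrA => ->.
Qed.

(** Both mixed derivatives are limits of the same symmetric second difference. *)
Lemma schwarz g v w : (forall p, derivable g p v) -> (forall p, derivable g p w) ->
  (forall p, derivable ('D_v g) p w) -> (forall p, derivable ('D_w g) p v) ->
  continuous ('D_w ('D_v g)) -> continuous ('D_v ('D_w g)) ->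
  'D_w ('D_v g) = 'D_v ('D_w g).
Proof.
move=> dv dw dvw dwv c1 c2; apply/funext => p.
apply/eqP; rewrite -subr_eq0 -normr_le0; apply/ler_addgt0Pr => eps e0.
rewrite add0r.
have e2 : 0 < eps / 2 by rewrite divr_gt0.
have [d1 d10 H1] := (continuous_epsdelta _).1 c1 p _ e2.
have [d2 d20 H2] := (continuous_epsdelta _).1 c2 p _ e2.
have [d3 d30 H3] := small_combination 0 0 v w d10.
have [d4 d40 H4] := small_combination 0 0 w v d20.
pose h := Num.min d3 d4 / 2.
have m0 : 0 < Num.min d3 d4 by rewrite lt_min d30.
have h0 : 0 < h by rewrite divr_gt0.
have hm : h < Num.min d3 d4 by rewrite ltr_pdivrMr// ltr_pMr// ltr1n.
have [s [t [/andP[/ltW s0 /ltW s1] /andP[/ltW t0 /ltW t1] E]]] := mixed_difference p h dv dvw.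
have [s' [t' [/andP[/ltW s0' /ltW s1'] /andP[/ltW t0' /ltW t1'] E']]] := mixed_difference p h dw dwv.
have sm a : 0 <= a -> a <= 1 -> `|a * h| < d3 /\ `|a * h| < d4.
  move=> a0 a1; have : `|a * h| < Num.min d3 d4.
    rewrite ger0_norm; last by rewrite mulr_ge0// ltW.
    by apply: le_lt_trans hm; rewrite ler_piMl// ltW.
  by rewrite lt_min => /andP.
have [S1 S2] := sm _ s0 s1; have [T1 T2] := sm _ t0 t1.
have [S1' S2'] := sm _ s0' s1'; have [T1' T2'] := sm _ t0' t1'.
have := H1 _ (H3 _ _ S1 T1); have := H2 _ (H4 _ _ S2' T2').
have swap (A B C D : R) : A - B - (C - D) = A - C - (B - D) by ring.
have := swap (g (p + h *: v + h *: w)) (g (p + h *: v)) (g (p + h *: w)) (g p).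
rewrite E (addrAC p) E'.
move: ('D_w ('D_v g) p) ('D_v ('D_w g) p) ('D_w ('D_v g) _) ('D_v ('D_w g) _).
move=> A B C D /(mulfI (lt0r_neq0 h0)) /(mulfI (lt0r_neq0 h0)) ->.
rewrite ltr_norml => /andP[a1 a2]; rewrite ltr_norml => /andP[b1 b2].
clear -a1 a2 b1 b2; rewrite ler_norml; apply/andP; split; lra.
Qed.

Definition local_max g p := exists2 d : R, 0 < d & forall z, `|z| < d -> g (p + z) <= g p.

Lemma small_scale (d : R) v : 0 < d -> exists2 e : R, 0 < e &
  forall h : R, `|h| < e -> `|h *: v| < d.
Proof.
move=> d0; have [e e0 H] := small_combination 0 0 v 0 d0.
by exists e => // h he; have := H h 0 he; rewrite normr0 scaler0 addr0; apply.
Qed.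

Lemma local_max_derive_eq0 g p v : local_max g p -> derivable g p v -> 'D_v g p = 0.
Proof.
move=> [d d0 Hm].
have aux w : derivable g p w -> 'D_w g p <= 0.
  move=> /derivableP/is_derive_epsdelta H.
  apply/ler_addgt0Pr => eps e0; rewrite add0r.
  have [d1 d10 H1] := H _ e0; have [d2 d20 H2] := small_scale w d0.
  pose h := Num.min d1 d2 / 2.
  have m0 : 0 < Num.min d1 d2 by rewrite lt_min d10.
  have h0 : 0 < h by rewrite divr_gt0.
  have : h < Num.min d1 d2 by rewrite ltr_pdivrMr// ltr_pMr// ltr1n.
  rewrite lt_min => /andP[h1 h2].
  have := H1 h (lt0r_neq0 h0); rewrite gtr0_norm// => /(_ h1).
  have : h^-1 * (g (p + h *: w) - g p) <= 0.
    by rewrite pmulr_rle0 ?invr_gt0// subr_le0 Hm// H2// gtr0_norm.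
  rewrite ltr_norml => ? /andP[? _]; lra.
move=> dv; apply/eqP; rewrite eq_le aux//=.
have D := derive_opp_dir dv.
have := aux (- v) (@ex_derive _ _ _ _ _ _ _ D).
by rewrite (@derive_val _ _ _ _ _ _ _ D) oppr_le0.
Qed.

(** With a vanishing first derivative, a positive second derivative would make [g]
    strictly larger at a nearby point of the line. *)
Lemma local_max_derive2_le0 g p v : local_max g p -> (forall q, derivable g q v) ->
  continuous ('D_v ('D_v g)) ->
  (forall q, derivable ('D_v g) q v) -> 'D_v ('D_v g) p <= 0.
Proof.
move=> mg dg cg ddg; rewrite leNgt; apply/negP => D0.
have g0 := local_max_derive_eq0 mg (dg p).
have [d d0 Hm] := mg.
have [d1 d10 H1] := (continuous_epsdelta _).1 cg p _ D0.
have [e1 e10 E1] := small_scale v d0; have [e2 e20 E2] := small_scale v d10.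
pose h := Num.min e1 e2 / 2.
have m0 : 0 < Num.min e1 e2 by rewrite lt_min e10.
have h0 : 0 < h by rewrite divr_gt0.
have : h < Num.min e1 e2 by rewrite ltr_pdivrMr// ltr_pMr// ltr1n.
rewrite lt_min => /andP[h1 h2].
have [t /andP[t0 t1] E] := line_mvt p h dg.
have [t' /andP[/ltW t0' /ltW t1'] E'] := line_mvt p (t * h) ddg.
have pos : 0 < 'D_v ('D_v g) (p + (t' * (t * h)) *: v).
  have th : `|t' * (t * h)| < e2.
    rewrite ger0_norm; last by do 2 (rewrite mulr_ge0//; try exact: ltW).
    apply: le_lt_trans h2; rewrite mulrA ler_piMl//; first exact: ltW.
    by rewrite mulr_ile1 ?(ltW t0) ?(ltW t1).
  by have := H1 _ (E2 _ th); rewrite ltr_norml => /andP[+ _]; rewrite ltrBrDl subrr.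
have : g (p + h *: v) - g p <= 0 by rewrite subr_le0 Hm// E1// gtr0_norm.
rewrite E pmulr_rle0//; move: E'; rewrite g0 subr0 => ->.
by rewrite leNgt !mulr_gt0.
Qed.
End second_order.

(** * Functions of class C^n *)

Section Ck_theory.
Context {R : realType}.

Section one_space.
Context {V : normedModType R}.
Implicit Types (g f : V -> R).

Lemma Ck_continuous n g : Ck n g -> continuous g.
Proof. by case: n => [|n] []. Qed.

Lemma Ck_derivable n g v p : Ck n.+1 g -> derivable g p v.
Proof. by move=> [_ /(_ v)[]]. Qed.

Lemma Ck_derive n g v : Ck n.+1 g -> Ck n ('D_v g).
Proof. by move=> [_ /(_ v)[]]. Qed.

Lemma CkW n g : Ck n.+1 g -> Ck n g.
Proof.
elim: n g => [|n IH] g Hg; first by split=> //; exact: (Ck_continuous Hg).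
split; first exact: (Ck_continuous Hg).
move=> v; split; first by move=> p; exact: (Ck_derivable Hg).
by apply: IH; exact: Ck_derive.
Qed.

Lemma Ck_eq n g f : g =1 f -> Ck n g -> Ck n f.
Proof. by move=> /funext ->. Qed.

Lemma Ck_cst n (a : R) : Ck n (fun _ : V => a).
Proof.
elim: n a => [|n IH] a; first by split=> // p; exact: cvg_cst.
split; first by move=> p; exact: cvg_cst.
move=> v; split; first by move=> p; exact: derivable_cst.
by apply: Ck_eq (IH 0) => p; rewrite derive_cst.
Qed.

Lemma CkD n f g : Ck n f -> Ck n g -> Ck n (fun p => f p + g p).
Proof.
elim: n f g => [|n IH] f g Hf Hg;
  have c : continuous (fun p => f p + g p) by
    move=> p; apply: (continuousD (f := f) (g := g));
    [exact: (Ck_continuous Hf)|exact: (Ck_continuous Hg)].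
  by split.
split=> // v; split=> [p|].
  by apply: (derivableD (f := f) (g := g)); apply: Ck_derivable; eassumption.
apply: Ck_eq (IH _ _ (Ck_derive v Hf) (Ck_derive v Hg)) => p.
by rewrite -deriveD//; apply: Ck_derivable; eassumption.
Qed.

Lemma CkM n f g : Ck n f -> Ck n g -> Ck n (fun p => f p * g p).
Proof.
elim: n f g => [|n IH] f g Hf Hg;
  have c : continuous (fun p => f p * g p) by
    move=> p; apply: (continuousM (s := f) (t := g));
    [exact: (Ck_continuous Hf)|exact: (Ck_continuous Hg)].
  by split.
split=> // v; split=> [p|].
  by apply: (derivableM (f := f) (g := g)); apply: Ck_derivable; eassumption.
have H1 := IH _ _ (CkW Hf) (Ck_derive v Hg).
have H2 := IH _ _ (CkW Hg) (Ck_derive v Hf).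
apply: Ck_eq (CkD H1 H2) => p /=.
by symmetry; apply: (@deriveM _ _ f g); apply: Ck_derivable; eassumption.
Qed.

Lemma CkZ n (a : R) g : Ck n g -> Ck n (fun p => a * g p).
Proof. by move=> Hg; apply: CkM Hg; exact: Ck_cst. Qed.

Lemma Ck_prod n m (F : 'I_m -> V -> R) : (forall i, Ck n (F i)) ->
  Ck n (fun p => \prod_i F i p).
Proof.
move=> HF; elim: m F HF => [|m IH] F HF.
  by apply: Ck_eq (Ck_cst n 1) => p; rewrite big_ord0.
have H := CkM (HF ord0) (IH (fun i => F (lift ord0 i)) (fun i => HF _)).
by apply: Ck_eq H => p; rewrite big_ord_recl.
Qed.

End one_space.

(** Difference quotients of [g \o l] are difference quotients of [g] in the direction
    given by the linear part [l0] of [l], so the chain rule for affine maps is an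
    identity that holds even where the derivative does not exist. *)
Section affine_composition.
Context {V W : normedModType R} (l l0 : V -> W).
Hypothesis affine_l : forall p v (t : R), l (p + t *: v) = l p + t *: l0 v.

Lemma derivable_comp_affine (g : W -> R) p v :
  derivable g (l p) (l0 v) -> derivable (g \o l) p v.
Proof.
move=> /derivableP /is_derive_epsdelta H.
apply: (@ex_derive _ _ _ _ _ _ ('D_(l0 v) g (l p))); apply/is_derive_epsdelta.
move=> eps /H[d d0 Hd]; exists d => // h h0 hd /=.
by rewrite affine_l; exact: Hd.
Qed.

Lemma derive_comp_affine (g : W -> R) p v :
  'D_v (g \o l) p = 'D_(l0 v) g (l p).
Proof.
suff H : (fun h : R => h^-1 *: (((g \o l) \o shift p) (h *: v) - (g \o l) p)) =
    (fun h => h^-1 *: ((g \o shift (l p)) (h *: l0 v) - g (l p))).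
  by rewrite /derive H.
apply/funext => h /=.
by rewrite (addrC (h *: v)) affine_l (addrC (l p)).
Qed.

Lemma Ck_comp_affine n (g : W -> R) : continuous l -> Ck n g -> Ck n (g \o l).
Proof.
move=> cl; elim: n g => [|n IH] g Hg;
  have c : continuous (g \o l) by
    move=> p; apply: continuous_comp; [exact: cl|exact: (Ck_continuous Hg)].
  by split.
split=> // v; split=> [p|].
  by apply: derivable_comp_affine; exact: (Ck_derivable Hg).
apply: Ck_eq (IH _ (Ck_derive (l0 v) Hg)) => p /=.
by rewrite derive_comp_affine.
Qed.

End affine_composition.

Section second_order.
Context {V : normedModType R} (g : V -> R).
Hypothesis g2 : Ck 2 g.

Lemma Ck2_schwarz v w : 'D_w ('D_v g) = 'D_v ('D_w g).
Proof.
have d1 u p : derivable g p u by exact: (Ck_derivable g2).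
have d2 u u' p : derivable ('D_u g) p u' by exact: (Ck_derivable (Ck_derive u g2)).
have c2 u u' : continuous ('D_u' ('D_u g)).
  exact: (Ck_continuous (Ck_derive u' (Ck_derive u g2))).
by apply: schwarz; [exact: d1|exact: d1|exact: d2|exact: d2|exact: c2|exact: c2].
Qed.

Lemma Ck1_derive_add (f : V -> R) v w (a : R) p : Ck 1 f ->
  'D_(v + a *: w) f p = 'D_v f p + a * 'D_w f p.
Proof.
move=> f1; have dw q : is_derive q (a *: w) f (a * 'D_w f q).
  by apply: derive_scale_dir; exact: (Ck_derivable f1).
rewrite (@derive_val _ _ _ _ _ _ _ (@derive_add_dir _ _ f v (a *: w) _ _ _ p)).
- by rewrite (@derive_val _ _ _ _ _ _ _ (dw p)).
- by move=> q; exact: (Ck_derivable f1).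
- by move=> q; exact: (Ck_derivable f1).
- exact: (Ck_continuous (Ck_derive _ f1)).
Qed.

Lemma Ck2_derive2_add v w (a : R) p : 'D_(v + a *: w) ('D_(v + a *: w) g) p =
  'D_v ('D_v g) p + 2 * (a * 'D_v ('D_w g) p) + a ^+ 2 * 'D_w ('D_w g) p.
Proof.
have H u : Ck 1 ('D_u g) by exact: Ck_derive.
have -> : 'D_(v + a *: w) g = ('D_v g + a \*: 'D_w g)%R.
  by apply/funext => q; rewrite Ck1_derive_add//; exact: CkW.
rewrite deriveD; [|exact: (Ck_derivable (H _))|]; last first.
  by apply: derivableZ; exact: (Ck_derivable (H _)).
rewrite deriveZ; last exact: (Ck_derivable (H _)).
rewrite !Ck1_derive_add; [|exact: H|exact: H].
have -> : 'D_w ('D_v g) p = 'D_v ('D_w g) p by exact: (congr1 (@^~ p) (Ck2_schwarz v w)).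
rewrite /GRing.scale /=.
 move: ('D_v ('D_v g) p) ('D_v ('D_w g) p) ('D_w ('D_w g) p) => A B C.
ring.
Qed.

Lemma Ck2_local_max p : local_max g p ->
  (forall v, 'D_v g p = 0) /\ (forall v, 'D_v ('D_v g) p <= 0).
Proof.
move=> mp; split=> v.
  by apply: local_max_derive_eq0 => //; exact: (Ck_derivable g2).
apply: local_max_derive2_le0 => //.
- by move=> q; exact: (Ck_derivable g2).
- exact: (Ck_continuous (Ck_derive _ (Ck_derive _ g2))).
- by move=> q; exact: (Ck_derivable (Ck_derive _ g2)).
Qed.
End second_order.
End Ck_theory.

(** * The front operator *)

Opaque derive Ck.

Section phase_space.
Context {R : realType} {N : nat}.
Local Notation space := 'rV[R]_N.
Local Notation phase := (R * 'rV[R]_N)%type.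
Implicit Types (q : space -> space) (e : space) (phi psi U : phase -> R) (p : phase).

(** The vector fields [d/dx_i + e_i d/ds].  The second order part of [Lop] is the sum
    of their squares, which is degenerate: the direction [s] alone is not reached. *)
Definition front_dir (e : space) (i : 'I_N) : phase := x_dir i + e 0 i *: s_dir.

Lemma grad_xE phi p (j : 'I_1) i : grad_x phi p j i = 'D_(x_dir i) phi p.
Proof. by rewrite mxE. Qed.

Lemma laplacian_xE phi p : laplacian_x phi p = \sum_i ('D_(x_dir i) ('D_(x_dir i) phi) p : R).
Proof. by []. Qed.

Lemma x_dirE (i : 'I_N) : x_dir i = (0, basis_vec i) :> phase. Proof. by []. Qed.
Lemma s_dirE : s_dir = (1, 0) :> phase. Proof. by []. Qed.

Lemma front_dir2 e i : (front_dir e i).2 = basis_vec i.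
Proof. by rewrite /= scaler0 addr0. Qed.

Opaque x_dir s_dir basis_vec front_dir grad_x laplacian_x.

(** As [e] is a unit vector, the cross terms and the [s]-derivatives of the operator
    are exactly those produced by squaring the directions [front_dir e i]. *)
Lemma LopE q e c phi p : dot e e = 1 -> Ck 2 phi ->
  Lop q e c phi p =
    \sum_i ('D_(front_dir e i) ('D_(front_dir e i) phi) p : R)
    + \sum_i q p.2 0 i * 'D_(front_dir e i) phi p - c * 'D_s_dir phi p.
Proof.
move=> he H.
have E1 : \sum_i ('D_(front_dir e i) ('D_(front_dir e i) phi) p : R) =
    laplacian_x phi p + 2 * dot e (grad_x ('D_s_dir phi) p)
    + 'D_s_dir ('D_s_dir phi) p.
  transitivity (\sum_i (('D_(x_dir i) ('D_(x_dir i) phi) p : R)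
      + 2 * (e 0 i * grad_x ('D_s_dir phi) p 0 i)
      + e 0 i ^+ 2 * 'D_s_dir ('D_s_dir phi) p)).
    by apply: eq_bigr => i _; rewrite grad_xE; exact: Ck2_derive2_add.
  rewrite laplacian_xE big_split big_split -mulr_sumr -mulr_suml; congr (_ + _).
  by rewrite -[RHS]mul1r -he; congr (_ * _).
have E2 : \sum_i q p.2 0 i * 'D_(front_dir e i) phi p =
    dot (q p.2) (grad_x phi p) + dot (q p.2) e * 'D_s_dir phi p.
  transitivity (\sum_i (q p.2 0 i * grad_x phi p 0 i + q p.2 0 i * e 0 i * 'D_s_dir phi p)).
    apply: eq_bigr => i _; rewrite grad_xE -mulrA -mulrDr; congr (_ * _).
    exact: (Ck1_derive_add _ _ _ _ (CkW H)).
  by rewrite big_split -mulr_suml.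
rewrite E1 E2 /Lop.
move: (laplacian_x phi p) ('D_s_dir ('D_s_dir phi) p) (dot e _) => A B C.
move: ('D_s_dir phi p) (dot _ _) (dot _ _) => D E F; ring.
Qed.

Lemma Lop_local_max q e c U p : dot e e = 1 -> Ck 2 U -> local_max U p ->
  Lop q e c U p <= 0.
Proof.
move=> he H mU; have [D1 D2] := Ck2_local_max H mU.
rewrite LopE// D1 mulr0 subr0 [X in _ + X]big1 ?addr0; last first.
  by move=> i _; rewrite D1 mulr0.
by apply: sumr_le0 => i _.
Qed.

Lemma derive_lin_comb (phi psi : phase -> R) (a : R) v p : Ck 1 phi -> Ck 1 psi ->
  'D_v (fun p => phi p + a * psi p) p = 'D_v phi p + a * 'D_v psi p.
Proof.
move=> H1 H2.
rewrite (_ : (fun p => _) = phi + a \*: psi)//.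
rewrite deriveD; [|exact: (Ck_derivable H1)|]; last first.
  by apply: derivableZ; exact: (Ck_derivable H2).
by rewrite deriveZ//; exact: (Ck_derivable H2).
Qed.

Lemma Lop_lin_comb q e c phi psi (a : R) p : dot e e = 1 -> Ck 2 phi -> Ck 2 psi ->
  Lop q e c (fun p => phi p + a * psi p) p = Lop q e c phi p + a * Lop q e c psi p.
Proof.
move=> he H1 H2.
have H3 : Ck 2 (fun p => phi p + a * psi p) by exact: CkD H1 (CkZ a H2).
have D v : 'D_v (fun p => phi p + a * psi p) = (fun p => 'D_v phi p + a * 'D_v psi p).
  by apply/funext => z; rewrite derive_lin_comb//; exact: CkW.
have D2 v z : 'D_v ('D_v (fun p => phi p + a * psi p)) z
    = 'D_v ('D_v phi) z + a * 'D_v ('D_v psi) z.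
  rewrite (D v); apply: derive_lin_comb; exact: Ck_derive.
have E1 : \sum_i ('D_(front_dir e i) ('D_(front_dir e i) (fun p => phi p + a * psi p)) p : R) =
  \sum_i ('D_(front_dir e i) ('D_(front_dir e i) phi) p : R)
  + a * \sum_i ('D_(front_dir e i) ('D_(front_dir e i) psi) p : R).
  rewrite mulr_sumr -big_split; apply: eq_bigr => i _; exact: D2.
have D1 v z : 'D_v (fun p => phi p + a * psi p) z = 'D_v phi z + a * 'D_v psi z.
  exact: (congr1 (@^~ z) (D v)).
have E2 : \sum_i q p.2 0 i * 'D_(front_dir e i) (fun p => phi p + a * psi p) p =
  \sum_i q p.2 0 i * 'D_(front_dir e i) phi p
  + a * \sum_i q p.2 0 i * 'D_(front_dir e i) psi p.
  rewrite mulr_sumr -big_split; apply: eq_bigr => i _.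
  by rewrite D1 mulrDr [a * (_ * _)]mulrCA.
have E3 : 'D_s_dir (fun p => phi p + a * psi p) p = 'D_s_dir phi p + a * 'D_s_dir psi p by exact: D1.
have comb (A B C A' B' C' X Y Z : R) : X = A + a * A' -> Y = B + a * B' ->
  Z = C + a * C' -> X + Y - c * Z = A + B - c * C + a * (A' + B' - c * C').
  by move=> -> -> ->; ring.
apply: etrans (LopE q c p he H3) _.
apply: etrans (comb _ _ _ _ _ _ _ _ _ E1 E2 E3) _.
by congr (_ + a * _); apply/esym; exact: LopE.
Qed.

Definition translate_s (r : R) (phi : phase -> R) : phase -> R :=
  fun p => phi (p + r *: s_dir).

Lemma derive_translate_s phi (r : R) v p :
  'D_v (translate_s r phi) p = 'D_v phi (p + r *: s_dir).
Proof.
apply: (@derive_comp_affine _ _ _ (fun p : phase => p + r *: s_dir) id).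
by move=> z w t; rewrite addrAC.
Qed.

Lemma Ck_translate_s n phi (r : R) : Ck n phi -> Ck n (translate_s r phi).
Proof.
apply: (@Ck_comp_affine _ _ _ (fun p : phase => p + r *: s_dir) id).
  by move=> z w t; rewrite addrAC.
by move=> p; apply: cvgD; [exact: cvg_id|exact: cvg_cst].
Qed.

Lemma shift_sE p (r : R) : p + r *: s_dir = (p.1 + r, p.2).
Proof.
transitivity (p.1 + r * 1, p.2 + r *: 0); last by rewrite mulr1 scaler0 addr0.
by rewrite s_dirE; case: p.
Qed.

Lemma shift_s2 p (r : R) : (p + r *: s_dir).2 = p.2.
Proof. by rewrite shift_sE. Qed.

Lemma shift_s1 p (r : R) : (p + r *: s_dir).1 = p.1 + r.
Proof. by rewrite shift_sE. Qed.

Lemma Lop_translate_s q e c phi (r : R) p :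
  Lop q e c (translate_s r phi) p = Lop q e c phi (p + r *: s_dir).
Proof.
have D g v : 'D_v (translate_s r g) = translate_s r ('D_v g).
  by apply/funext => z; exact: derive_translate_s.
have D2 v w z : 'D_w ('D_v (translate_s r phi)) z = 'D_w ('D_v phi) (z + r *: s_dir).
  by rewrite (D phi v); exact: derive_translate_s.
have E1 : laplacian_x (translate_s r phi) p = laplacian_x phi (p + r *: s_dir).
  by rewrite !laplacian_xE; apply: eq_bigr => i _; exact: D2.
have E2 : grad_x ('D_s_dir (translate_s r phi)) p = grad_x ('D_s_dir phi) (p + r *: s_dir).
  apply/rowP => i; apply: etrans (grad_xE _ _ _ _) _.
  by apply: etrans (D2 _ _ _) _; apply/esym; exact: grad_xE.
have E3 : grad_x (translate_s r phi) p = grad_x phi (p + r *: s_dir).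
  apply/rowP => i; apply: etrans (grad_xE _ _ _ _) _.
  by apply: etrans (derive_translate_s _ _ _ _) _; apply/esym; exact: grad_xE.
by rewrite /Lop E1 E2 E3 D2 derive_translate_s shift_s2.
Qed.

Lemma Lop_speed q e c c' phi p :
  Lop q e c phi p = Lop q e c' phi p + (c' - c) * 'D_s_dir phi p.
Proof. by rewrite /Lop; ring. Qed.

Lemma Ck_separated n (G : space -> R) (h : R -> R) : Ck n G -> Ck n h ->
  Ck n (fun p : phase => G p.2 * h p.1).
Proof.
move=> HG Hh; apply: CkM.
  by apply: (@Ck_comp_affine _ _ _ snd snd) HG => // p; exact: cvg_snd.
by apply: (@Ck_comp_affine _ _ _ fst fst) Hh => // p; exact: cvg_fst.
Qed.

Lemma derive_separated (G : space -> R) (h : R -> R) (a : R) v p :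
  Ck 1 G -> Ck 1 h ->
  'D_((a, v) : phase) (fun p : phase => G p.2 * h p.1) p =
  'D_v G p.2 * h p.1 + G p.2 * 'D_a h p.1.
Proof.
move=> HG Hh.
have E1 := @derive_comp_affine R phase space snd snd (fun _ _ _ => erefl) G p (a, v).
have E2 := @derive_comp_affine R phase R fst fst (fun _ _ _ => erefl) h p (a, v).
have d1 : derivable (G \o snd : phase -> R) p (a, v).
  by apply: (@derivable_comp_affine R phase space snd snd) => //; exact: (Ck_derivable HG).
have d2 : derivable (h \o fst : phase -> R) p (a, v).
  by apply: (@derivable_comp_affine R phase R fst fst) => //; exact: (Ck_derivable Hh).
have H := deriveM d1 d2; rewrite E1 E2 in H.
apply: etrans H _; rewrite addrC; congr (_ + _); exact: mulrC.
Qed.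

Lemma is_derive_expM (lam a t : R) :
  is_derive t a (fun s => expR (lam * s)) (a * (lam * expR (lam * t))).
Proof.
have E : is_derive t (1 : R) (fun s => expR (lam * s)) (lam * expR (lam * t)).
  have H1 : is_derive t (1 : R) ( *%R lam) lam.
    apply/is_derive_epsdelta => eps e0; exists 1 => // h h0 _.
    rewrite [h *: 1]mulr1.
    by have -> : h^-1 * (lam * (t + h) - lam * t) - lam = 0; [field|rewrite normr0].
  have H2 : is_derive (lam * t) (1 : R) (@expR R) (expR (lam * t)) by exact: is_derive_expR.
  by rewrite mulrC; exact: (is_derive1_comp (f := @expR R) H2 H1).
have := derive_scale_dir a (@ex_derive _ _ _ _ _ _ _ E).
by rewrite (@derive_val _ _ _ _ _ _ _ E) [a *: 1]mulr1.
Qed.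

Lemma Ck_expM n (lam : R) : Ck n (fun s : R => expR (lam * s)).
Proof.
have c : continuous (fun s : R => expR (lam * s)).
  move=> t; apply: continuous_comp; last exact: continuous_expR.
  exact: mulrl_continuous.
elim: n => [|n IH]; first by split.
split=> // v; split=> [t|]; first exact: (@ex_derive _ _ _ _ _ _ _ (is_derive_expM lam v t)).
apply: (Ck_eq _ (CkZ (v * lam) IH)) => t.
by rewrite (@derive_val _ _ _ _ _ _ _ (is_derive_expM lam v t)) mulrA.
Qed.

Lemma Lop_separated q e c (lam : R) (G : space -> R) p : Ck 2 G ->
  Lop q e c (fun p => G p.2 * expR (lam * p.1)) p =
  (laplacian G p.2 + 2 * lam * dot e (grad G p.2) + dot (q p.2) (grad G p.2)
   + (lam ^+ 2 + lam * dot (q p.2) e - c * lam) * G p.2) * expR (lam * p.1).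
Proof.
move=> HG.
have Dx (F : space -> R) i : Ck 1 F ->
    'D_(x_dir i) (fun p : phase => F p.2 * expR (lam * p.1)) =
    (fun p => 'D_(basis_vec i) F p.2 * expR (lam * p.1)).
  move=> HF; apply/funext => z.
  rewrite x_dirE; apply: etrans (derive_separated 0 (basis_vec i) z HF (Ck_expM 1 lam)) _.
  by rewrite (@derive_val _ _ _ _ _ _ _ (is_derive_expM lam 0 z.1)) mul0r mulr0 addr0.
have Ds (F : space -> R) : Ck 1 F ->
    'D_s_dir (fun p : phase => F p.2 * expR (lam * p.1)) =
    (fun p => (lam * F p.2) * expR (lam * p.1)).
  move=> HF; apply/funext => z.
  rewrite s_dirE; apply: etrans (derive_separated 1 0 z HF (Ck_expM 1 lam)) _.
  rewrite (@derive_val _ _ _ _ _ _ _ (is_derive_expM lam 1 z.1)) mul1r derive0 mul0r add0r.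
  by rewrite mulrCA mulrA.
have H1 : Ck 1 G by exact: CkW.
have HZ : Ck 1 (fun x => lam * G x) by exact: CkZ.
have DZ i x : 'D_(basis_vec i) (fun x => lam * G x) x = lam * 'D_(basis_vec i) G x.
  rewrite (_ : (fun x => _) = lam \*: G)// deriveZ//; exact: (Ck_derivable H1).
pose P := fun p : phase => G p.2 * expR (lam * p.1).
have DsP : 'D_s_dir P = (fun p => (lam * G p.2) * expR (lam * p.1)) by exact: Ds.
have E0 : 'D_s_dir ('D_s_dir P) p = lam * (lam * G p.2) * expR (lam * p.1).
  by rewrite DsP; exact: (congr1 (@^~ p) (Ds (fun x => lam * G x) HZ)).
have E1 : laplacian_x P p = laplacian G p.2 * expR (lam * p.1).
  rewrite laplacian_xE /laplacian mulr_suml; apply: eq_bigr => i _.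
  rewrite (Dx G i H1).
  exact: (congr1 (@^~ p) (Dx ('D_(basis_vec i) G) i (Ck_derive _ HG))).
have E2 : dot e (grad_x ('D_s_dir P) p) = lam * dot e (grad G p.2) * expR (lam * p.1).
  rewrite /dot mulr_sumr mulr_suml; apply: eq_bigr => i _.
  have -> : grad_x ('D_s_dir P) p 0 i = lam * grad G p.2 0 i * expR (lam * p.1).
    apply: etrans (grad_xE _ _ _ _) _; rewrite DsP mxE -DZ.
    exact: (congr1 (@^~ p) (Dx (fun x => lam * G x) i HZ)).
  by rewrite mulrA mulrCA.
have E3 : dot (q p.2) (grad_x P p) = dot (q p.2) (grad G p.2) * expR (lam * p.1).
  rewrite /dot mulr_suml; apply: eq_bigr => i _.
  rewrite -mulrA; congr (_ * _); apply: etrans (grad_xE _ _ _ _) _; rewrite mxE.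
  exact: (congr1 (@^~ p) (Dx G i H1)).
have E4 : 'D_s_dir P p = lam * G p.2 * expR (lam * p.1).
  exact: (congr1 (@^~ p) DsP).
rewrite -/P /Lop E0 E1 E2 E3 E4.
move: (laplacian G p.2) (dot e (grad G p.2)) (dot (q p.2) (grad G p.2)) (dot (q p.2) e).
move: (expR (lam * p.1)) (G p.2).
by move=> A B C D E F; ring.
Qed.
End phase_space.

(** * Compactness modulo periods *)

Section compactness.
Context {R : realType}.

(** Uniform continuity is needed with base points in [K] but arbitrary small
    increments, which may leave [K]. *)
Lemma unif_cont_compact {V : normedModType R} (K : set V) (g : V -> R) (eps : R) :
  compact K -> continuous g -> 0 < eps ->
  exists2 d : R, 0 < d & forall p z, K p -> `|z| < d -> `|g (p + z) - g p| < eps.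
Proof.
move=> /compact_near_coveringP cK cg e0.
have HK : \forall z \near (0 : V), K `<=` [set p | `|g (p + z) - g p| < eps].
  apply: (cK V (nbhs (0 : V)) (fun z p => `|g (p + z) - g p| < eps)) => p Kp.
  have cG : continuous (fun w : V * V => g (w.1 + w.2) - g w.1).
    move=> w; apply: cvgB.
      apply: (@cvg_comp _ _ _ (fun w : V * V => w.1 + w.2) g _ (nbhs (w.1 + w.2))).
        by apply: cvgD; [exact: cvg_fst|exact: cvg_snd].
      exact: cg.
    apply: (@cvg_comp _ _ _ fst g _ (nbhs w.1)); [exact: cvg_fst|exact: cg].
  have /cvgrPdist_lt /(_ _ e0) := cG (p, 0).
  rewrite /= addr0 subrr => -[[A B] /= [HA HB] H].
  exists (A, B) => //= w wAB; have := H w wAB; by rewrite /= sub0r normrN.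
have /nbhs_normP[d /= d0 Hd] := HK.
exists d => // p z Kp zd; apply: (Hd z) => //=.
by rewrite sub0r normrN.
Qed.

End compactness.

Section periodic.
Context {R : realType} {N : nat} (L : 'I_N -> R).
Hypothesis L0 : forall i, 0 < L i.
Local Notation space := 'rV[R]_N.
Local Notation phase := (R * 'rV[R]_N)%type.

Definition cell : set space := [set x | forall i, `[0, L i]%classic (x 0 i)].

Lemma cell_compact : compact cell.
Proof.
have := @rV_compact R N (fun i => `[0, L i]%classic) (fun i => @segment_compact _ _ _).
by [].
Qed.

Lemma cell0 : cell 0.
Proof. by move=> i; rewrite /= in_itv /= mxE lexx ltW. Qed.

Definition lattice_vec (k : 'I_N -> int) : space := \row_i ((k i)%:~R * L i).

Lemma to_cell x : exists k, cell (x + lattice_vec k).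
Proof.
exists (fun i => - Num.floor (x 0 i / L i)) => i.
rewrite /= in_itv /= !mxE rmorphN /= mulNr.
have h1 : (Num.floor (x 0 i / L i))%:~R * L i <= x 0 i.
  by rewrite -ler_pdivlMr// Num.Theory.floor_le.
have h2 : x 0 i <= ((Num.floor (x 0 i / L i))%:~R + 1) * L i.
  by rewrite -ler_pdivrMr// ltW// -intrD1 Num.Theory.floorD1_gt.
by rewrite subr_ge0 h1 /= lerBlDl; apply: le_trans h2 _; rewrite mulrDl mul1r.
Qed.

(** Periodicity replaces the unbounded variable [x] by a point of a compact cell. *)
Lemma periodic_max (T : topologicalType) (A : set T) (G : T * space -> R) :
  A !=set0 -> compact A -> continuous G ->
  (forall t, Defs.periodic L (fun x => G (t, x))) ->
  exists t x, A t /\ forall t' x', A t' -> G (t', x') <= G (t, x).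
Proof.
move=> [a Aa] cA cG pG.
have [||[t x] /set_mem[/= At cx] H] := @compact_EVT_max _ R G (A `*` cell) _ (compact_setX cA cell_compact).
- by exists (a, 0); split => //; exact: cell0.
- exact: continuous_subspaceT.
exists t, x; split=> // t' x' At'.
have [k ck] := to_cell x'.
by rewrite -(pG t' k x'); apply: H; exact/mem_set.
Qed.

Lemma periodic_fun_max (g : space -> R) : continuous g -> Defs.periodic L g ->
  exists x, forall x', g x' <= g x.
Proof.
move=> cg pg.
have [||||t [x [_ H]]] := @periodic_max R [set 0] (fun p => g p.2).
- by exists 0.
- exact: compact_set1.
- move=> p; apply: (@cvg_comp _ _ _ snd g _ (nbhs p.2)); [exact: cvg_snd|exact: cg].
- by move=> ?; exact: pg.
by exists x => x'; exact: (H 0).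
Qed.

Lemma periodic_fun_min (g : space -> R) : continuous g -> Defs.periodic L g ->
  exists x, forall x', g x <= g x'.
Proof.
move=> cg pg; have [||x H] := @periodic_fun_max (fun x => - g x).
- by move=> p; apply: (@cvgN _ _ _ (nbhs p) _ g (g p)); exact: (cg p).
- by move=> k x; rewrite pg.
by exists x => x'; rewrite -lerN2.
Qed.

Lemma periodic_unif_cont (G : phase -> R) (S eps : R) : continuous G ->
  periodic_x L G -> 0 < eps ->
  exists2 d : R, 0 < d & forall p z, `|p.1| <= S -> `|z| < d -> `|G (p + z) - G p| < eps.
Proof.
move=> cG pG e0.
have cK : compact ((`[- S, S]%classic : set R) `*` cell).
  by apply: compact_setX; [exact: segment_compact|exact: cell_compact].
have [d d0 H] := unif_cont_compact cK cG e0.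
exists d => // -[s x] z /= sS zd.
have [k ck] := to_cell x.
have := H (s, x + lattice_vec k) z.
rewrite /setX /= in_itv /= -ler_norml => /(_ (conj sS ck) zd).
have -> : G (s, x + lattice_vec k) = G (s, x) by rewrite -(pG s k x).
rewrite /= (_ : (s, x + lattice_vec k) + z = (s + z.1, x + z.2 + lattice_vec k)).
  rewrite (pG (s + z.1) k (x + z.2)).
  by rewrite (_ : (s, x) + z = (s + z.1, x + z.2))//; case: (z).
transitivity (s + z.1, x + lattice_vec k + z.2); first by case: (z).
by rewrite addrAC.
Qed.
End periodic.

(** * Regularity of the drift and of the reaction *)

Section norms.
Context {R : realType} {n : nat}.

Lemma coord_le_norm (x : 'rV[R]_n) i : `|x 0 i| <= `|x|.
Proof.
rewrite [leRHS](mx_normrE x).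
exact: (le_bigmax _ (fun ij : 'I_1 * 'I_n => `|x ij.1 ij.2|) (0, i)).
Qed.

Lemma norm_le_coord (x : 'rV[R]_n) (B : R) : 0 <= B -> (forall i, `|x 0 i| <= B) -> `|x| <= B.
Proof.
move=> B0 H; rewrite [leLHS](mx_normrE x); apply: bigmax_le => // -[i j] _ /=.
by rewrite (ord1 i).
Qed.
End norms.

Section holder.
Context {R : realType}.

Lemma powR_small (alpha eps : R) : 0 < alpha -> 0 < eps ->
  exists2 d : R, 0 < d & forall t : R, 0 <= t <= d -> t `^ alpha <= eps.
Proof.
move=> a0 e0; exists (eps `^ alpha^-1); first exact: powR_gt0.
move=> t /andP[t0 td].
have -> : eps = (eps `^ alpha^-1) `^ alpha.
  by rewrite -powRrM mulVf ?gt_eqF// powRr1// ltW.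
by apply: (ge0_ler_powR (ltW a0)); rewrite ?nnegrE// powR_ge0.
Qed.

(** The set [A] may be a strip with boundary, where the derivative is only taken
    relative to [A]: differentiability is used at interior times of the segment, and
    mere continuity at its two ends. *)
Lemma segment_mvt {V : normedModType R} (A : set V) (g : V -> R) (dg : V -> V -> R) p v :
  (forall p t w, dg p (t *: w) = t * dg p w) ->
  (forall p, A p -> forall eps : R, 0 < eps ->
     \forall y \near within A (nbhs p),
       `|g y - g p - dg p (y - p)| <= eps * `|y - p|) ->
  (forall t : R, 0 <= t <= 1 -> A (p + t *: v)) ->
  exists2 t : R, 0 < t < 1 & g (p + v) - g p = dg (p + t *: v) v.
Proof.
move=> hdg Hd HA.
pose k (t : R) := g (p + t *: v).
have est (t : R) : 0 <= t <= 1 -> forall eps : R, 0 < eps ->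
    exists2 d : R, 0 < d & forall h, `|h| < d -> 0 <= t + h <= 1 ->
      `|k (t + h) - k t - h * dg (p + t *: v) v| <= eps * `|h|.
  move=> t01 eps e0.
  have v1 : 0 < `|v| + 1 by rewrite ltr_wpDl.
  have /(Hd _ (HA _ t01)) : 0 < eps / (`|v| + 1) by rewrite divr_gt0.
  rewrite near_withinE => /nbhs_normP[d /= d0 H].
  exists (d / (`|v| + 1)); first by rewrite divr_gt0.
  move=> h hd th01.
  have E : p + (t + h) *: v = p + t *: v + h *: v by rewrite scalerDl addrA.
  have S : p + (t + h) *: v - (p + t *: v) = h *: v by rewrite E addrC addKr.
  have := H (p + (t + h) *: v); rewrite /= distrC S normrZ => Hh.
  have hv : `|h| * `|v| < d.
    move: hd; rewrite ltr_pdivlMr// => hd; apply: le_lt_trans hd.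
    by rewrite ler_wpM2l// lerDl.
  have {Hh} := Hh hv (HA _ th01); rewrite hdg => Hh.
  apply: le_trans Hh _; rewrite mulrCA mulrC ler_wpM2r// -mulrA.
  by rewrite ler_piMr ?(ltW e0)// ler_pdivrMl// mulr1 lerDl.
have d1 (t : R) : 0 < t < 1 -> is_derive t (1 : R) k (dg (p + t *: v) v).
  move=> /andP[t0 t1]; apply/is_derive_epsdelta => eps e0.
  have e2 : 0 < eps / 2 by rewrite divr_gt0.
  have [|d d0 H] := est t _ _ e2; first by rewrite !ltW.
  exists (Num.min d (Num.min t (1 - t))).
    by rewrite !lt_min d0 t0 subr_gt0.
  move=> h h0; rewrite !lt_min => /and3P[hd ht h1].
  rewrite [h *: 1]mulr1.
  have := H h hd; rewrite !ltr_norml in ht h1; move/andP: ht => [ht1 ht2].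
  move/andP: h1 => [h11 h12].
  have -> : 0 <= t + h <= 1 by apply/andP; split; lra.
  move=> /(_ isT) Hh.
  have -> X : h^-1 * (k (t + h) - k t) - X = h^-1 * (k (t + h) - k t - h * X) by field.
  rewrite normrM normfV ltr_pdivrMl ?normr_gt0//; apply: le_lt_trans Hh _.
  by rewrite [ltRHS]mulrC ltr_pM2r ?normr_gt0// ltr_pdivrMr// ltr_pMr// ltr1n.
have c1 (t : R) : 0 <= t <= 1 -> forall eps : R, 0 < eps ->
    exists2 d : R, 0 < d & forall h, `|h| < d -> 0 <= t + h <= 1 -> `|k t - k (t + h)| < eps.
  move=> t01 eps e0; have [d d0 H] := est t t01 _ ltr01.
  set D := dg _ v in H.
  have D1 : 0 < 1 + `|D| by rewrite ltr_pwDl.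
  exists (Num.min d (eps / (1 + `|D|))); first by rewrite lt_min d0 divr_gt0.
  move=> h; rewrite lt_min => /andP[hd he] th.
  rewrite distrC; have -> : k (t + h) - k t = (k (t + h) - k t - h * D) + h * D by ring.
  apply: le_lt_trans (ler_normD _ _) _.
  move: he; rewrite ltr_pdivlMr// mulrDr mulr1; apply: le_lt_trans.
  by rewrite lerD// ?normrM//; have := H h hd th; rewrite mul1r.
have dk : forall x, x \in `]0 : R, 1[%R -> is_derive x (1 : R) k (dg (p + x *: v) v).
  by move=> x; rewrite in_itv => /d1.
have ck : {within `[0 : R, 1], continuous k}.
  apply/continuous_within_itvP => //; split.
  - move=> x; rewrite in_itv => /d1 dx.
    by apply: differentiable_continuous; apply/derivable1_diffP; exact: (@ex_derive _ _ _ _ _ _ _ dx).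
  - apply/cvgrPdist_lt => eps e0; have [|d d0 H] := c1 0 _ _ e0; first by rewrite lexx ler01.
    exists (Num.min d 1); first by rewrite /= lt_min d0 ltr01.
    move=> y /=; rewrite sub0r normrN lt_min => /andP[yd y1] y0.
    rewrite -[y]add0r; apply: H => //; rewrite add0r ltW//=.
    by rewrite (le_trans (ler_norm _))// ltW.
  - apply/cvgrPdist_lt => eps e0; have [|d d0 H] := c1 1 _ _ e0; first by rewrite lexx ler01.
    exists (Num.min d 1); first by rewrite /= lt_min d0 ltr01.
    move=> y /=; rewrite lt_min => /andP[yd y1] y0.
    rewrite (_ : y = 1 + (y - 1)); last by ring.
    apply: H; first by rewrite distrC.
    rewrite (_ : 1 + (y - 1) = y); last by ring.
    rewrite (ltW y0) andbT; move: y1; rewrite ltr_norml => /andP[_]; lra.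
have [c c01 E] := MVT ltr01 dk ck.
exists c; first by move: c01; rewrite in_itv.
by move: E; rewrite /k scale1r scale0r addr0 subr0 mulr1.
Qed.
End holder.

Lemma segment01 {R : realType} (s s' t : R) : 0 <= s <= 1 -> 0 <= s' <= 1 ->
  0 <= t <= 1 -> 0 <= s + t * (s' - s) <= 1.
Proof.
move=> /andP[s0 s1] /andP[s0' s1'] /andP[t0 t1].
have h1 : 0 <= t * s' by exact: mulr_ge0.
have h2 : 0 <= (1 - t) * s by rewrite mulr_ge0// subr_ge0.
have h3 : 0 <= t * (1 - s') by rewrite mulr_ge0// subr_ge0.
have h4 : 0 <= (1 - t) * (1 - s) by rewrite mulr_ge0// subr_ge0.
apply/andP; split; nra.
Qed.

Lemma linear_rV_bound {R : realType} {n : nat} (l : 'rV[R]_n -> R) :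
  (forall v w, l (v + w) = l v + l w) -> (forall t v, l (t *: v) = t * l v) ->
  exists2 C : R, 0 <= C & forall v, `|l v| <= C * `|v|.
Proof.
move=> lD lZ; exists (\sum_i `|l (delta_mx 0 i)|); first by rewrite sumr_ge0.
move=> v; have l0 : l 0 = 0 by rewrite -(scale0r 0) lZ mul0r.
rewrite {1}(row_sum_delta v) (big_morph l lD l0) mulr_suml.
apply: le_trans (ler_norm_sum _ _ _) _; apply: ler_sum => i _.
by rewrite lZ normrM mulrC ler_wpM2l// coord_le_norm.
Qed.

Section coefficients.
Context {R : realType} {N : nat}.
Variables (L : 'I_N -> R) (alpha : R).
Local Notation space := 'rV[R]_N.
Hypothesis L0 : forall i, 0 < L i.
Hypothesis a0 : 0 < alpha.

Lemma cell_bounded : exists2 B : R, 0 < B & forall x : space, cell L x -> `|x| <= B.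
Proof.
have Lge0 i : 0 <= L i by exact: ltW.
exists (1 + \sum_i L i); first by rewrite ltr_pwDl// sumr_ge0.
move=> x cx; apply: norm_le_coord => [|i]; first by rewrite addr_ge0// sumr_ge0.
have := cx i; rewrite /= in_itv /= => /andP[x0 xL]; rewrite ger0_norm//.
by apply: le_trans xL _; rewrite (bigD1 i)//= addrCA lerDl addr_ge0// sumr_ge0.
Qed.

Section reaction.
Variable f : space -> R -> R.
Hypothesis f_C1 : C1_holder [set p : space * R | 0 <= p.2 <= 1] alpha
  (fun p : space * R => f p.1 p.2).
Hypothesis f_per : forall s, 0 <= s <= 1 -> Defs.periodic L (f ^~ s).
Hypothesis f0 : forall x, f x 0 = 0.

Let dir : space * R := (0, 1).

(** [fu] is the partial derivative of [f] in its last variable, one-sided on the boundary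
    of the strip; this is why its value at [0] is [eta]. *)
Lemma reaction_mvt : exists (fu : space -> R -> R) (K : R),
  [/\ forall x s s', 0 <= s <= 1 -> 0 <= s' <= 1 ->
        exists2 t : R, 0 < t < 1 & f x s' - f x s = (s' - s) * fu x (s + t * (s' - s)),
      forall x s x' s', 0 <= s <= 1 -> 0 <= s' <= 1 ->
        `|fu x s - fu x' s'| <= K * `|(x, s) - (x', s')| `^ alpha, 0 < K
    & forall x, Defs.eta f x = fu x 0].
Proof.
have [dg [Hd [K HK]]] := f_C1.
have hdg p t w : dg p (t *: w) = t * dg p w by exact: linearZ.
have nd : `|dir| = 1 by rewrite prod_normE /= normr0 normr1 max_r.
exists (fun x s => dg (x, s) dir), (`|K| + 1); split.
- move=> x s s' hs hs'.
  have sm (t : R) : (x, s) + t *: ((s' - s) *: dir) = (x, s + t * (s' - s)).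
    rewrite (_ : _ + _ = (x + t *: ((s' - s) *: 0), s + t * ((s' - s) * 1)))//.
    by rewrite !scaler0 addr0 mulr1.
  have [|t t01 E] := @segment_mvt R (space * R)%type _ _ dg (x, s) ((s' - s) *: dir) hdg Hd.
    by move=> t t01; rewrite sm /=; exact: segment01.
  exists t => //; have := sm 1; rewrite scale1r mul1r (addrC s) subrK => sm1.
  by move: E; rewrite sm1 sm hdg.
- move=> x s x' s' hs hs'; apply: le_trans (HK (x, s) (x', s') hs hs' dir) _.
  by rewrite nd mulr1 ler_wpM2r ?powR_ge0// (le_trans (ler_norm _))// lerDl.
- by rewrite ltr_wpDl.
move=> x; apply/cvg_lim => //; apply/cvgrPdist_le => eps e0.
have x0 : 0 <= (0 : R) <= 1 by rewrite lexx ler01.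
have := Hd (x, 0) x0 _ e0; rewrite near_withinE => /nbhs_normP[d /= d0 H].
exists (Num.min d 1); first by rewrite /= lt_min d0 ltr01.
move=> u /=; rewrite sub0r normrN lt_min => /andP[ud u1] u0.
have E : (x, u) - (x, 0) = u *: dir.
  rewrite (_ : _ - _ = (x - x, u - 0))// (_ : _ *: _ = (u *: 0, u * 1))//.
  by rewrite subrr subr0 scaler0 mulr1.
have := H (x, u); rewrite /= distrC E normrZ nd mulr1 (ltW u0) /= => /(_ ud).
have u1' : u <= 1 by rewrite (le_trans (ler_norm _))// ltW.
move=> /(_ u1'); rewrite hdg (gtr0_norm u0) => Hu.
rewrite distrC.
have -> : (f x u - f x 0) / u - dg (x, 0) dir = (f x u - f x 0 - u * dg (x, 0) dir) / u.
  by field; rewrite gt_eqF.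
by rewrite normrM normfV (gtr0_norm u0) ler_pdivrMr.
Qed.

(** The Holder bound grows with the distance to the origin; periodicity moves [x] into
    the cell, where the derivative is bounded. *)
Lemma reaction_lipschitz : exists2 C : R, 0 < C & forall x s s', 0 <= s <= 1 ->
  0 <= s' <= 1 -> `|f x s - f x s'| <= C * `|s - s'|.
Proof.
have [fu [K [Hmvt Hh K0 _]]] := reaction_mvt.
have [B B0 HB] := cell_bounded.
exists (`|fu 0 0| + 1 + K * (B + 1) `^ alpha).
  by rewrite ltr_pwDl// ?ltr_wpDl// mulr_ge0 ?powR_ge0// ltW.
move=> x s s' hs hs'; have [k ck] := to_cell L0 x.
have per u : 0 <= u <= 1 -> f x u = f (x + lattice_vec L k) u.
  by move=> hu; rewrite (f_per hu k x).
rewrite !per//; move: (x + _) ck => y cy.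
have [t /andP[t0 t1] ->] := Hmvt y s' s hs' hs.
have hm : 0 <= s' + t * (s - s') <= 1 by apply: (segment01 hs' hs); rewrite (ltW t0) (ltW t1).
rewrite normrM mulrC ler_wpM2r//.
set m := s' + _ in hm *.
have h0 : 0 <= (0 : R) <= 1 by rewrite lexx ler01.
have := Hh y m 0 0 hm h0.
have -> : (y, m) - (0, 0) = (y, m).
  by rewrite (_ : _ - _ = (y - 0, m - 0))// !subr0.
move=> H1.
have n1 : `|(y, m)| <= B + 1.
  rewrite prod_normE /= ge_max; apply/andP; split.
    by rewrite (le_trans (HB _ cy))// lerDl.
  by move/andP: hm => [m0 m1]; rewrite ger0_norm// (le_trans m1)// lerDr ltW.
have n2 : K * `|(y, m)| `^ alpha <= K * (B + 1) `^ alpha.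
  rewrite ler_wpM2l ?(ltW K0)//; apply: ge0_ler_powR => //; rewrite ?nnegrE//.
    exact: ltW.
  by rewrite addr_ge0// ltW.
have -> : fu y m = fu 0 0 + (fu y m - fu 0 0) by ring.
apply: le_trans (ler_normD _ _) _; rewrite lerD ?(le_trans H1)//.
by rewrite lerDl.
Qed.

(** By the mean value theorem [f(x, u) = u fu(x, t u)], and the Holder bound compares
    [fu(x, t u)] with [fu(x, 0)] uniformly in [x]. *)
Lemma reaction_linearization : forall eps : R, 0 < eps -> exists2 u0 : R, 0 < u0 <= 1 &
  forall x u, 0 <= u <= u0 -> (Defs.eta f x - eps) * u <= f x u.
Proof.
move=> eps e0; have [fu [K [Hmvt Hh K0 Heta]]] := reaction_mvt.
have [d d0 Hd] := powR_small a0 (divr_gt0 e0 K0).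
exists (Num.min d 1); first by rewrite lt_min d0 ltr01 /= ge_min lexx orbT.
move=> x u; rewrite le_min => /and3P[u0 ud u1].
have h0 : 0 <= (0 : R) <= 1 by rewrite lexx ler01.
have hu : 0 <= u <= 1 by rewrite u0.
have [t /andP[t0 t1]] := Hmvt x 0 u h0 hu.
rewrite f0 !subr0 add0r => ->; rewrite mulrC ler_wpM2l// Heta.
have tu : 0 <= t * u <= 1.
  by rewrite mulr_ge0 ?(ltW t0)// mulr_ile1 ?(ltW t0) ?(ltW t1).
have := Hh x (t * u) x 0 tu h0.
have -> : (x, t * u) - (x, 0) = (0, t * u).
  by rewrite (_ : _ - _ = (x - x, t * u - 0))// subrr subr0.
rewrite prod_normE /= normr0 max_r// => H1.
have H2 : K * `|t * u| `^ alpha <= eps.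
  rewrite mulrC -ler_pdivlMr//; apply: Hd.
  rewrite normr_ge0 ger0_norm; last by case/andP: tu.
  by rewrite (le_trans _ ud)// ler_piMl// ltW.
have := le_trans H1 H2; rewrite ler_norml => /andP[? _]; lra.
Qed.

Lemma reaction_continuous (V : R * space -> R) : continuous V ->
  (forall p, 0 < V p < 1) -> continuous (fun p => f p.2 (V p)).
Proof.
move=> cV V01; have [dg [Hd _]] := f_C1.
apply/continuous_epsdelta => p eps e0.
have hV z : 0 <= V z <= 1 by have /andP[/ltW-> /ltW->] := V01 z.
set p0 : space * R := (p.2, V p).
have [||C1 C10 HC1] := @linear_rV_bound _ _ (fun z : space => dg p0 (z, 0)).
- move=> v w; rewrite -linearD; congr (dg p0 _).
  by rewrite (_ : _ + _ = (v + w, 0 + 0))// addr0.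
- move=> t v; rewrite -[RHS]linearZ; congr (dg p0 _).
  by rewrite (_ : _ *: _ = (t *: v, t * 0))// mulr0.
pose C := 1 + C1 + `|dg p0 dir|.
have C0 : 0 < C by rewrite ltr_pwDl// ltr_pwDl.
have HC y : `|dg p0 y| <= (C1 + `|dg p0 dir|) * `|y|.
  have -> : y = (y.1, 0) + y.2 *: dir.
    rewrite (_ : _ + _ = (y.1 + y.2 *: 0, 0 + y.2 * 1)); last by [].
    by rewrite scaler0 addr0 add0r mulr1; case: (y).
  rewrite linearD linearZ; apply: le_trans (ler_normD _ _) _.
  have -> : (y.1, 0) + y.2 *: dir = y.
    rewrite (_ : _ + _ = (y.1 + y.2 *: 0, 0 + y.2 * 1)); last by [].
    by rewrite scaler0 addr0 add0r mulr1; case: (y).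
  rewrite mulrDl; apply: lerD.
    by apply: le_trans (HC1 _) _; rewrite ler_wpM2l// prod_normE le_max lexx.
  by rewrite normrM mulrC ler_wpM2l// prod_normE le_max lexx orbT.
have := Hd p0 (hV p) _ ltr01; rewrite near_withinE => /nbhs_normP[d /= d0 H].
have m0 : 0 < Num.min d (eps / C) by rewrite lt_min d0 divr_gt0.
have [d2 d20 H2] := (continuous_epsdelta _).1 cV p _ m0.
exists (Num.min d2 (Num.min d (eps / C))); first by rewrite lt_min d20.
move=> z; rewrite lt_min => /andP[/H2 z1 z2].
have small : `|((p + z).2, V (p + z)) - p0| < Num.min d (eps / C).
  rewrite (_ : _ - _ = ((p + z).2 - p.2, V (p + z) - V p)); last by [].
  rewrite prod_normE gt_max /= z1 andbT; apply: le_lt_trans z2.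
  by rewrite addrC addKr prod_normE le_max lexx orbT.
move: small; rewrite lt_min => /andP[s1 s2].
have := H ((p + z).2, V (p + z)); rewrite /= distrC s1 => /(_ isT (hV _)).
rewrite mul1r; set y := (_, _) in s1 s2 *; move=> H3.
have -> : f (p + z).2 (V (p + z)) - f p.2 (V p) =
  (f y.1 y.2 - f p0.1 p0.2 - dg p0 (y - p0)) + dg p0 (y - p0) by rewrite /=; ring.
apply: le_lt_trans (ler_normD _ _) _.
apply: (@le_lt_trans _ _ (C * `|y - p0|)).
  have -> : C * `|y - p0| = `|y - p0| + (C1 + `|dg p0 dir|) * `|y - p0|.
    by rewrite /C; ring.
  by rewrite lerD.
by rewrite mulrC -ltr_pdivlMr.
Qed.
End reaction.

Section drift.
Variable q : space -> space.
Hypothesis q_C1 : C1_holder setT alpha q.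
Hypothesis q_per : Defs.periodic L q.

Lemma drift_C1 i : Ck 1 (fun x => q x 0 i).
Proof.
have [dq [Hd [K HK]]] := q_C1.
have D x v : is_derive x v (fun x => q x 0 i) ((dq x v) 0 i).
  apply/is_derive_epsdelta => eps e0.
  have v1 : 0 < `|v| + 1 by rewrite ltr_wpDl.
  have e1 : 0 < eps / (`|v| + 1) by rewrite divr_gt0.
  have := Hd x I _ e1; rewrite near_withinE => /nbhs_normP[d /= d0 H].
  exists (d / (`|v| + 1)); first by rewrite divr_gt0.
  move=> h h0 hd; have := H (x + h *: v).
  have -> : x + h *: v - x = h *: v by rewrite addrC addKr.
  rewrite /= distrC; have -> : x + h *: v - x = h *: v by rewrite addrC addKr.
  rewrite !normrZ linearZ.
  have hv : `|h| * `|v| < d.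
    move: hd; rewrite ltr_pdivlMr// => hd; apply: le_lt_trans hd.
    by rewrite ler_wpM2l// lerDl.
  move=> /(_ hv I) Hh.
  have := le_trans (coord_le_norm _ i) Hh; rewrite !mxE => H1.
  set X := q (x + _) 0 i in H1 *; set Y := q x 0 i in H1 *; set Z := dq x v 0 i in H1 *.
  have -> : h^-1 * (X - Y) - Z = h^-1 * (X - Y - h * Z) by field.
  rewrite normrM normfV ltr_pdivrMl ?normr_gt0//; apply: le_lt_trans H1 _.
  rewrite mulrCA ltr_pM2l ?normr_gt0// -mulrA gtr_pMr//.
  by rewrite ltr_pdivrMl// mulr1 ltrDl.
have cont : continuous (fun x => q x 0 i).
  apply/continuous_epsdelta => x eps e0.
  have [||C C0 HC] := @linear_rV_bound _ _ (fun z => (dq x z) 0 i).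
  - by move=> v w; rewrite linearD mxE.
  - by move=> t v; rewrite linearZ mxE.
  have := Hd x I _ ltr01; rewrite near_withinE => /nbhs_normP[d /= d0 H].
  have C1 : 0 < C + 1 by rewrite ltr_wpDl.
  exists (Num.min d (eps / (C + 1))); first by rewrite lt_min d0 divr_gt0.
  move=> z; rewrite lt_min => /andP[zd ze].
  have E : x + z - x = z by rewrite addrC addKr.
  have := H (x + z); rewrite /= distrC E => /(_ zd I); rewrite mul1r => Hh.
  have := le_trans (coord_le_norm _ i) Hh; rewrite !mxE => H1.
  have -> : q (x + z) 0 i - q x 0 i = (q (x + z) 0 i - q x 0 i - dq x z 0 i) + dq x z 0 i.
    by ring.
  apply: le_lt_trans (ler_normD _ _) _.
  apply: (@le_lt_trans _ _ ((C + 1) * `|z|)).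
    by rewrite mulrDl mul1r addrC lerD.
  by rewrite mulrC -ltr_pdivlMr.
split=> // v; split=> [x|]; first exact: (@ex_derive _ _ _ _ _ _ _ (D x v)).
split=> //.
have -> : 'D_v (fun x => q x 0 i) = (fun x => (dq x v) 0 i).
  by apply/funext => x; exact: (@derive_val _ _ _ _ _ _ _ (D x v)).
apply/continuous_epsdelta => x eps e0.
pose M := (`|K| + 1) * (`|v| + 1).
have M0 : 0 < M by rewrite mulr_gt0// ltr_wpDl.
have e2 : 0 < eps / M / 2 by rewrite !divr_gt0.
have [d d0 Hd'] := powR_small a0 e2.
exists d => // z zd.
have -> : dq (x + z) v 0 i - dq x v 0 i = (dq (x + z) v - dq x v) 0 i by rewrite !mxE.
apply: le_lt_trans (coord_le_norm _ i) _.
apply: le_lt_trans (HK _ _ I I v) _.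
have -> : x + z - x = z by rewrite addrC addKr.
have := Hd' `|z|; rewrite normr_ge0 (ltW zd) => /(_ isT) Hz.
apply: (@le_lt_trans _ _ (M * (`|z| `^ alpha))).
  have k1 : K * `|z| `^ alpha <= (`|K| + 1) * `|z| `^ alpha.
    by rewrite ler_wpM2r ?powR_ge0// (le_trans (ler_norm _))// lerDl.
  apply: le_trans (ler_wpM2r (normr_ge0 v) k1) _.
  rewrite /M [leRHS]mulrAC; apply: ler_wpM2l; last by rewrite lerDl.
  by rewrite mulr_ge0 ?powR_ge0// addr_ge0.
rewrite mulrC -ltr_pdivlMr//; apply: le_lt_trans Hz _.
by rewrite ltr_pdivrMr// ltr_pMr ?divr_gt0// ltr1n.
Qed.

Lemma drift_coord_lipschitz i : exists2 C : R, 0 < C & forall x z : space, `|z| <= 1 ->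
  `|q (x + z) 0 i - q x 0 i| <= C * `|z|.
Proof.
have [dq [Hd [K HK]]] := q_C1; have [B B0 HB] := cell_bounded.
have [||C C0 HC] := @linear_rV_bound _ _ (fun z => (dq 0 z) 0 i).
- by move=> v w; rewrite linearD mxE.
- by move=> t v; rewrite linearZ mxE.
have P0 : 0 <= (`|K| + 1) * (B + 1) `^ alpha by rewrite mulr_ge0 ?powR_ge0// addr_ge0.
exists (C + (`|K| + 1) * (B + 1) `^ alpha + 1); first by rewrite ltr_wpDl// addr_ge0.
move=> x z z1; have [k ck] := to_cell L0 x.
have -> : q x = q (x + lattice_vec L k) by rewrite (q_per k x).
have -> : q (x + z) = q (x + lattice_vec L k + z) by rewrite addrAC (q_per k (x + z)).
move: (x + _) ck => y cy.
have [| | |t /andP[t0 t1] ->] := @segment_mvt R _ setT (fun x => q x 0 i) (fun p w => dq p w 0 i) y z.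
- by move=> p t w; rewrite linearZ mxE.
- move=> p _ eps e0; have := Hd p I _ e0; rewrite !near_withinE; apply: filterS => w Hw _.
  by have := le_trans (coord_le_norm _ i) (Hw I); rewrite !mxE.
- by [].
set p := y + t *: z.
have -> : dq p z 0 i = dq 0 z 0 i + (dq p z - dq 0 z) 0 i by rewrite !mxE; ring.
apply: le_trans (ler_normD _ _) _; rewrite -addrA mulrDl lerD// mulrDl mul1r.
apply: (@le_trans _ _ ((`|K| + 1) * (B + 1) `^ alpha * `|z|)); last by rewrite lerDl.
apply: le_trans (coord_le_norm _ i) _.
apply: le_trans (HK _ _ I I z) _; rewrite ler_wpM2r// subr0.
have pB : `|p| <= B + 1.
  apply: le_trans (ler_normD _ _) _; rewrite lerD// ?HB// normrZ gtr0_norm//.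
  by rewrite mulr_ile1// ltW.
apply: (@le_trans _ _ ((`|K| + 1) * `|p| `^ alpha)).
  by rewrite ler_wpM2r ?powR_ge0// (le_trans (ler_norm _))// lerDl.
rewrite ler_wpM2l ?addr_ge0//; apply: (ge0_ler_powR (ltW a0)) pB; rewrite ?nnegrE//.
by rewrite addr_ge0// ltW.
Qed.

Lemma drift_lipschitz : exists2 C : R, 0 < C & forall x z i, `|z| <= 1 ->
  `|q (x + z) 0 i - q x 0 i| <= C * `|z|.
Proof.
have [C HC] := choice (fun i => let: ex_intro2 c c0 H := drift_coord_lipschitz i in
  ex_intro (fun c => 0 < c /\ forall x z : space, `|z| <= 1 ->
    `|q (x + z) 0 i - q x 0 i| <= c * `|z|) c (conj c0 H)).
have Cge0 j : 0 <= C j by case: (HC j) => /ltW.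
exists (1 + \sum_i C i); first by rewrite ltr_pwDl// sumr_ge0.
move=> x z i z1; apply: le_trans ((HC i).2 x z z1) _; rewrite ler_wpM2r//.
by rewrite (bigD1 i)//= addrCA lerDl addr_ge0// sumr_ge0.
Qed.
End drift.
End coefficients.

(** * Iterated integrals of compactly supported functions *)

Section box_functions.
Context {R : realType}.

(** All norms at hand are maximum norms, so the ball of radius [B] is a box. *)
Definition box_fun {V : normedModType R} (B : R) (g : V -> R) :=
  continuous g /\ forall x, B < `|x| -> g x = 0.

Section one_space.
Context {V : normedModType R}.
Implicit Types (g h : V -> R).

Lemma box_fun_lin B g h (a : R) : box_fun B g -> box_fun B h ->
  box_fun B (fun x => g x + a * h x).
Proof.
move=> [cg g0] [ch h0]; split=> [x|x xB]; last by rewrite g0// h0// mulr0 addr0.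
apply: cvgD; first exact: cg.
by apply: cvgM; [exact: cvg_cst|exact: ch].
Qed.

Lemma box_funM B g h : box_fun B g -> continuous h -> box_fun B (fun x => h x * g x).
Proof.
move=> [cg g0] ch; split=> [x|x xB]; last by rewrite g0// mulr0.
by apply: cvgM; [exact: ch|exact: cg].
Qed.

Lemma box_funW B B' g : B <= B' -> box_fun B g -> box_fun B' g.
Proof. by move=> BB [cg g0]; split=> // x /(le_lt_trans BB); exact: g0. Qed.

Lemma box_fun_shift B g w : box_fun B g -> box_fun (B + `|w|) (fun x => g (x + w)).
Proof.
move=> [cg g0]; split=> [x|x xB].
  apply: (@cvg_comp _ _ _ (fun x => x + w) g _ (nbhs (x + w))); last exact: cg.
  by apply: cvgD; [exact: cvg_id|exact: cvg_cst].
apply: g0; have := ler_normB (x + w) w; rewrite addrK => H.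
by move: (lt_le_trans xB H); rewrite ltrD2r.
Qed.

Lemma box_fun_cst0 B : box_fun B (fun _ : V => 0).
Proof. by split=> // x; exact: cvg_cst. Qed.
End one_space.

Lemma box_fun_unif_cont {V : normedModType R} B (g : V -> R) (eps : R) : 
  compact [set x : V | `|x| <= B + 1] -> box_fun B g -> 0 < eps ->
  exists2 d : R, 0 < d & forall p z, `|z| < d -> `|g (p + z) - g p| < eps.
Proof.
move=> cK [cg g0] e0; have [d d0 H] := unif_cont_compact cK cg e0.
exists (Num.min d 1); first by rewrite lt_min d0 ltr01.
move=> p z; rewrite lt_min => /andP[zd z1].
have [pB|pB] := leP `|p| (B + 1); first exact: H.
rewrite (g0 p); last by apply: lt_trans pB; rewrite ltrDl.
rewrite g0 ?subrr ?normr0//.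
have := ler_normB (p + z) z; rewrite addrK => H'.
have := lt_le_trans pB H'; move: z1; move: `|_| `|_| => a b; lra.
Qed.

End box_functions.

Section lebesgue_line.
Context {R : realType}.
Local Notation mu := (@lebesgue_measure R).
Local Notation "\J h" := (\int[mu]_t h t) (at level 10).
Implicit Types (h : R -> R) (a b B : R).

Lemma box_integrable h a b : continuous h -> mu.-integrable `[a, b] (EFin \o h).
Proof.
move=> ch; apply: continuous_compact_integrable; first exact: segment_compact.
exact: continuous_subspaceT.
Qed.

(** Outside the interval the integrand vanishes, so the integral over the line is an
    integral over a segment, where continuous functions are integrable. *)
Lemma line_integralE B h a b : box_fun B h -> a <= - B -> B <= b ->
  \J h = \int[mu]_(t in `[a, b]) h t.
Proof.
move=> [ch h0] aB Bb; rewrite [RHS]Rintegral_mkcond; congr (Rintegral mu setT _).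
apply/funext => t; rewrite patchE; case: ifPn => // /negP tab.
rewrite h0//; rewrite ltNge; apply/negP => tB; apply: tab; rewrite inE /= in_itv /=.
move: tB; rewrite ler_norml => /andP[t1 t2].
by rewrite (le_trans aB t1) (le_trans t2 Bb).
Qed.

Lemma line_integral_lin B h k a : 0 <= B -> box_fun B h -> box_fun B k ->
  \J (fun t => h t + a * k t) = \J h + a * \J k.
Proof.
move=> B0 Hh Hk; have Hl := box_fun_lin a Hh Hk.
rewrite !(line_integralE (a := - B) (b := B) Hl)//.
rewrite (line_integralE (a := - B) (b := B) Hh)// (line_integralE (a := - B) (b := B) Hk)//.
have ck : continuous (fun t => a * k t).
  by move=> t; apply: cvgM; [exact: cvg_cst|exact: (Hk.1 t)].
rewrite RintegralD//=; [|exact: (box_integrable _ _ Hh.1)|exact: (box_integrable _ _ ck)].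
by rewrite RintegralZl//; exact: (box_integrable _ _ Hk.1).
Qed.

Lemma interval_measure a b : a <= b -> fine (mu `[a, b]) = b - a.
Proof.
move=> ab; rewrite lebesgue_measure_itv /= lte_fin.
case: ltP => // ba; have -> : a = b by apply/eqP; rewrite eq_le ab.
by rewrite subrr.
Qed.

Lemma line_integral_bound B h C : 0 <= B -> box_fun B h -> (forall t, `|h t| <= C) ->
  `|\J h| <= (2 * B) * C.
Proof.
move=> B0 Hh hC; rewrite (line_integralE (a := - B) (b := B) Hh)//.
have ch := Hh.1.
have cnh : continuous (fun t => `|h t|).
  by move=> t; apply: cvg_norm; exact: ch.
have cC : continuous (fun _ : R => C) by move=> t; exact: cvg_cst.
apply: le_trans (le_normr_Rintegral _ (box_integrable _ _ ch)) _ => //.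
apply: le_trans (le_Rintegral _ (box_integrable _ _ cnh) (box_integrable _ _ cC) _) _ => //.
have BB : - B <= B by lra.
by rewrite Rintegral_cst//= interval_measure// mulrC opprK mulr_natl mulr2n.
Qed.

Lemma line_integral_lower B h b c : box_fun B h -> (forall t, 0 <= h t) -> 0 <= b ->
  (forall t, `|t| <= b -> c <= h t) -> 2 * b * c <= \J h.
Proof.
move=> Hh h0 b0 hc; have ch := Hh.1.
pose M := Num.max B b.
have bM : b <= M by rewrite le_max lexx orbT.
have BM : B <= M by rewrite le_max lexx.
rewrite (line_integralE (a := - M) (b := M) Hh)//; last by rewrite lerN2.
have bb : - b <= b by lra.
apply: (@le_trans _ _ (\int[mu]_(t in `[- b, b]) h t)).
  have cc : continuous (fun _ : R => c) by move=> t; exact: cvg_cst.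
  apply: le_trans (_ : \int[mu]_(t in `[- b, b]) c <= _).
    by rewrite Rintegral_cst//= interval_measure// mulrC opprK mulr_natl mulr2n.
  apply: le_Rintegral => //; [exact: box_integrable|exact: box_integrable|].
  by move=> t /=; rewrite in_itv /= -ler_norml; exact: hc.
rewrite /Rintegral fine_le//.
- by apply: integrable_fin_num => //; exact: box_integrable.
- by apply: integrable_fin_num => //; exact: box_integrable.
apply: ge0_subset_integral => //.
- by case/integrableP: (box_integrable (- M) M ch).
- by move=> x _; rewrite lee_fin.
- move=> t /=; rewrite !in_itv /= => /andP[t1 t2].
  by rewrite (le_trans _ t1) ?lerN2// (le_trans t2).
Qed.

Lemma line_integral_shift B h a : 0 <= B -> box_fun B h -> \J (fun t => h (t + a)) = \J h.
Proof.
move=> B0 Hh; pose M := B + `|a|.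
have M0 : 0 <= M by rewrite addr_ge0.
have aa := ler_norm a; have na := ler_norm (- a); rewrite normrN in na.
rewrite (line_integralE (a := - M) (b := M) (box_fun_shift a Hh))//.
rewrite (line_integralE (a := - M + a) (b := M + a) Hh)//; [|by rewrite /M; lra..].
have D (t : R) : is_derive t (1 : R) (fun s => s + a) 1.
  apply/is_derive_epsdelta => eps e0; exists 1 => // u u0 _.
  have -> : u^-1 * (t + u *: (1 : R) + a - (t + a)) - 1 = 0.
    by rewrite [u *: 1]mulr1; field.
  by rewrite normr0.
have D1 : derive1 (fun s : R => s + a) = (fun _ => 1).
  by apply/funext => t; rewrite derive1E; exact: (@derive_val _ _ _ _ _ _ _ (D t)).
have cD : continuous (fun s : R => s + a).
  by move=> t; apply: cvgD; [exact: cvg_id|exact: cvg_cst].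
rewrite /Rintegral (@integration_by_substitution_increasing R (fun s => s + a) h (- M) M).
- congr (fine _); apply: eq_integral => t _ /=.
  by rewrite D1; congr (_%:E); apply/esym; exact: mulr1.
- by lra.
- by move=> x y _ _; rewrite ltrD2r.
- by rewrite D1 => x _; exact: cvg_cst.
- by rewrite D1; apply: is_cvg_cst.
- by rewrite D1; apply: is_cvg_cst.
- split.
  + by move=> x _; exact: (@ex_derive _ _ _ _ _ _ _ (D x)).
  + by apply: cvg_at_right_filter; exact: cD.
  + by apply: cvg_at_left_filter; exact: cD.
- exact: continuous_subspaceT (Hh.1).
Qed.
End lebesgue_line.

Section iterated_integrals.
Context {R : realType}.

(** What is used of [d]-dimensional Lebesgue measure: a linear, translation invariant
    functional on continuous functions with support in a box, bounded above by the
    volume of the box and below by the volume of a box on which the integrand is large.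
    Compactness of balls is included because the induction on the dimension uses
    uniform continuity of the integrand. *)
Record box_integral {V : normedModType R} (d : nat) (I : (V -> R) -> R) : Prop := {
  boxi_compact : forall B : R, compact [set x : V | `|x| <= B];
  boxi_lin : forall B g h (a : R), 0 <= B -> box_fun B g -> box_fun B h ->
    I (fun x => g x + a * h x) = I g + a * I h;
  boxi_bound : forall B g C, 0 <= B -> box_fun B g -> (forall x, `|g x| <= C) ->
    `|I g| <= (2 * B) ^+ d * C;
  boxi_lower : forall B g b c, 0 <= B -> box_fun B g -> (forall x, 0 <= g x) ->
    0 <= b -> 0 <= c -> (forall x, `|x| <= b -> c <= g x) -> (2 * b) ^+ d * c <= I g;
  boxi_shift : forall B g w, 0 <= B -> box_fun B g -> I (fun x => g (x + w)) = I g
}.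

Lemma pair_normE {V W : normedModType R} (p : V * W) : `|p| = Num.max `|p.1| `|p.2|.
Proof. exact: prod_normE. Qed.

Lemma slice_continuous {W : normedModType R} (g : R * W -> R) t :
  continuous g -> continuous (fun y => g (t, y)).
Proof.
move=> cg; apply/continuous_epsdelta => y eps e0.
have [del d0 H] := (continuous_epsdelta _).1 cg (t, y) _ e0.
exists del => // z zd; have := H (0, z).
rewrite (_ : (t, y) + (0, z) = (t + 0, y + z))// addr0; apply.
by rewrite pair_normE /= normr0 gt_max zd andbT.
Qed.

Section prepend_line.
Context {W : normedModType R} (d : nat) (I : (W -> R) -> R).
Hypothesis HI : box_integral d I.
Local Notation mu := (@lebesgue_measure R).

Let J (g : R * W -> R) : R := \int[mu]_t I (fun y => g (t, y)).

Lemma slice_box B (g : R * W -> R) t : box_fun B g -> box_fun B (fun y => g (t, y)).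
Proof.
move=> [cg g0]; split=> [|y yB]; first exact: slice_continuous.
by apply: (g0 (t, y)); rewrite pair_normE lt_max yB orbT.
Qed.

Lemma prod_ball_compact (B : R) : compact [set x : R * W | `|x| <= B].
Proof.
have := compact_setX (@segment_compact R (- B) B) (@boxi_compact _ _ _ HI B).
congr compact; apply/seteqP; split => -[t y] /=.
  by move=> [] /=; rewrite in_itv /= -ler_norml pair_normE ge_max => -> ->.
by rewrite pair_normE ge_max => /andP[t1 t2]; split=> //=; rewrite in_itv /= -ler_norml.
Qed.

Lemma boxi_sub B g h : 0 <= B -> box_fun B g -> box_fun B h ->
  I (fun x => g x - h x) = I g - I h.
Proof.
move=> B0 Hg Hh; have := boxi_lin HI (-1) B0 Hg Hh.
rewrite mulN1r => <-; congr (I _); apply/funext => x; by rewrite mulN1r.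
Qed.

(** The inner integral depends continuously on [t] because a compactly supported
    continuous function is uniformly continuous, and because the functional is bounded
    by the volume of the box. *)
Lemma slice_integral_box B (g : R * W -> R) : 0 <= B -> box_fun B g ->
  box_fun B (fun t => I (fun y => g (t, y))).
Proof.
move=> B0 Hg; split; last first.
  move=> t tB; apply/eqP; rewrite -normr_le0.
  rewrite -[leRHS](mulr0 ((2 * B) ^+ d)); apply: (boxi_bound HI B0 (slice_box t Hg)) => y.
  by rewrite (Hg.2 (t, y)) ?normr0// pair_normE lt_max tB.
apply/continuous_epsdelta => t eps e0.
have M0 : 0 <= (2 * B) ^+ d by rewrite exprn_ge0// mulr_ge0.
have e1 : 0 < eps / ((2 * B) ^+ d + 1) by rewrite divr_gt0// ltr_wpDl.
have [del d0 H] := box_fun_unif_cont (@prod_ball_compact (B + 1)) Hg e1.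
exists del => // z zd; rewrite -(boxi_sub B0 (slice_box _ Hg) (slice_box _ Hg)).
have Hs : box_fun B (fun y => g (t + z, y) - g (t, y)).
  have := box_fun_lin (-1) (slice_box (t + z) Hg) (slice_box t Hg).
  by congr box_fun; apply/funext => y; rewrite mulN1r.
apply: (@le_lt_trans _ _ ((2 * B) ^+ d * (eps / ((2 * B) ^+ d + 1)))).
  apply: (boxi_bound HI B0 Hs) => y; apply/ltW.
  have := H (t, y) (z, 0); rewrite (_ : (t, y) + (z, 0) = (t + z, y + 0))// addr0; apply.
  by rewrite pair_normE /= normr0 gt_max zd.
rewrite mulrCA gtr_pMr// ltr_pdivrMr ?mul1r ?ltrDl//.
by rewrite ltr_wpDl.
Qed.

Lemma box_integral_prepend : box_integral d.+1 J.
Proof.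
split.
- exact: prod_ball_compact.
- move=> B g h a B0 Hg Hh; rewrite /J.
  rewrite -(line_integral_lin a B0 (slice_integral_box B0 Hg) (slice_integral_box B0 Hh)).
  congr (Rintegral mu setT _); apply/funext => t.
  exact: (boxi_lin HI a B0 (slice_box t Hg) (slice_box t Hh)).
- move=> B g C B0 Hg HC; rewrite exprS -mulrA.
  apply: (line_integral_bound B0 (slice_integral_box B0 Hg)) => t.
  exact: (boxi_bound HI B0 (slice_box t Hg)).
- move=> B g b c B0 Hg g0 b0 c0 Hc; rewrite exprS -mulrA.
  apply: (line_integral_lower (slice_integral_box B0 Hg)) => // t.
    have H0 y : 0 <= g (t, y) by exact: g0.
    have := boxi_lower HI B0 (slice_box t Hg) H0 (lexx 0) (lexx 0) (fun y _ => H0 y).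
    by rewrite mulr0.
  move=> tb; apply: (boxi_lower HI B0 (slice_box t Hg)) => // y yb.
  by apply: Hc; rewrite pair_normE ge_max tb.
- move=> B g [a w] B0 Hg; rewrite /J.
  rewrite -(line_integral_shift a B0 (slice_integral_box B0 Hg)).
  congr (Rintegral mu setT _); apply/funext => t.
  rewrite -(boxi_shift HI w B0 (slice_box (t + a) Hg)).
  by congr I; apply/funext => y.
Qed.
End prepend_line.

Section transfer.
Context {V W : normedModType R} (iota : W -> V).
Hypothesis iota_norm : forall y, `|iota y| = `|y|.
Hypothesis iota_add : forall y z, iota (y + z) = iota y + iota z.
Hypothesis iota_sur : forall x, exists y, iota y = x.

(** An additive isometry carries the integral over; it is used for the identification
    of row vectors of length [n + 1] with pairs. *)
Lemma box_integral_transfer d (I : (W -> R) -> R) : box_integral d I ->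
  box_integral d (fun g : V -> R => I (g \o iota)).
Proof.
move=> HI.
have iota_opp y : iota (- y) = - iota y.
  by apply/eqP; rewrite -addr_eq0 -iota_add addNr -normr_eq0 iota_norm normr0.
have ci : continuous iota.
  move=> y; apply/cvgrPdist_lt => eps e0; apply/nbhs_normP; exists eps => //= z /=.
  by rewrite -iota_opp -iota_add iota_norm.
have tr B g : box_fun B g -> box_fun B (g \o iota).
  move=> [cg g0]; split=> [y|y yB]; last by rewrite /= g0// iota_norm.
  by apply: (@cvg_comp _ _ _ iota g _ (nbhs (iota y))); [exact: ci|exact: cg].
split.
- move=> B; have -> : [set x : V | `|x| <= B] = iota @` [set y | `|y| <= B].
    apply/seteqP; split=> [x /= xB|x [y /= yB <-] /=]; last by rewrite iota_norm.
    by have [y yx] := iota_sur x; exists y => //; rewrite /= -iota_norm yx.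
  apply: continuous_compact; first exact: continuous_subspaceT.
  exact: (boxi_compact HI).
- by move=> B g h a B0 /tr Hg /tr Hh; exact: (boxi_lin HI a B0 Hg Hh).
- by move=> B g C B0 /tr Hg HC; apply: (boxi_bound HI B0 Hg) => y; exact: HC.
- move=> B g b c B0 /tr Hg g0 b0 c0 Hc; apply: (boxi_lower HI B0 Hg) => // [y|y yb].
    exact: g0.
  by apply: Hc; rewrite iota_norm.
- move=> B g w B0 /tr Hg; have [z <-] := iota_sur w.
  rewrite -(boxi_shift HI z B0 Hg); congr I; apply/funext => y /=.
  by rewrite iota_add.
Qed.
End transfer.

Lemma integral_rV_box n : box_integral n (@integral_rV R n).
Proof.
elim: n => [|n IH].
  split=> /=.
  - move=> B; have -> : [set x : 'rV[R]_0 | `|x| <= B] =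
        [set x : 'rV[R]_0 | `|x| <= B /\ x = 0].
      apply/seteqP; split=> x /=; last by case.
      by move=> ?; split=> //; apply/rowP => -[].
    have [B0|B0] := leP 0 B.
      have -> : [set x : 'rV[R]_0 | `|x| <= B /\ x = 0] = [set 0].
        by apply/seteqP; split=> x /=; [case|move=> ->; rewrite normr0].
      exact: compact_set1.
    have -> : [set x : 'rV[R]_0 | `|x| <= B /\ x = 0] = set0.
      by apply/seteqP; split=> x //= -[xB _]; have := le_trans (normr_ge0 x) xB; rewrite leNgt B0.
    exact: compact0.
  - by [].
  - by move=> B g C _ _ HC; rewrite expr0 mul1r.
  - by move=> B g b c _ _ _ b0 _; rewrite expr0 mul1r; apply; rewrite normr0.
  - by move=> B g w _ _; rewrite add0r; congr g; apply/rowP => -[].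
pose iota (p : R * 'rV[R]_n) : 'rV[R]_n.+1 := row_mx (\row_(_ < 1) p.1) p.2 : 'rV[R]_(1 + n).
have iE p (i : 'I_n.+1) : iota p 0 i = match fintype.split (i : 'I_(1 + n)) with inl _ => p.1 | inr j => p.2 0 j end.
  by rewrite /iota mxE; case: (fintype.split _) => j; rewrite ?mxE.
apply: (@box_integral_transfer _ _ iota _ _ _ n.+1 _ (box_integral_prepend IH)).
- move=> p; apply/eqP; rewrite eq_le; apply/andP; split.
    apply: norm_le_coord => // i; rewrite (iE p i) pair_normE.
    case: (fintype.split _) => j; rewrite le_max ?lexx// coord_le_norm orbT//.
  rewrite pair_normE ge_max; apply/andP; split.
    have := coord_le_norm (iota p) (lshift n ord0 : 'I_(1 + n)).
    by rewrite (iE p (lshift n ord0 : 'I_(1 + n))); case: splitP => // j.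
  apply: norm_le_coord => // j.
  have := coord_le_norm (iota p) (rshift 1 j : 'I_(1 + n)).
  by rewrite (iE p (rshift 1 j : 'I_(1 + n))) -[rshift _ _]/(unsplit (inr j)) unsplitK.
- move=> p z; apply/rowP => i.
  have A (u v : 'rV[R]_n.+1) : (u + v) 0 i = u 0 i + v 0 i by rewrite mxE.
  apply: etrans (iE (p + z) i) (etrans _ (esym (A (iota p) (iota z)))).
  rewrite (iE p i) (iE z i); case: (fintype.split _) => j //.
  by rewrite mxE.
- move=> x; exists (x 0 (lshift n ord0 : 'I_(1 + n)), \row_j x 0 (rshift 1 j : 'I_(1 + n))).
  apply/rowP => i; rewrite (iE _ i); case: splitP => j ij /=.
    by congr (x 0 _); apply/val_inj; rewrite /= ij (ord1 j).
  by rewrite mxE; congr (x 0 _); apply/val_inj; rewrite /= ij.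
Qed.

Lemma integral_phase_box N : box_integral N.+1 (@integral_phase R N).
Proof. exact: (box_integral_prepend (integral_rV_box N)). Qed.

End iterated_integrals.

(** * A smooth bump *)

Section bump.
Context {R : realType}.

(** The functions [t^-k exp(-1/t)], extended by [0]: their span is closed under
    differentiation, which gives smoothness of all of them at once. *)
Definition flat (k : nat) (t : R) : R :=
  if 0 < t then t^-1 ^+ k * expR (- t^-1) else 0.

Lemma flat_ge0 k t : 0 <= flat k t.
Proof.
rewrite /flat; case: ifPn => // t0.
by rewrite mulr_ge0 ?expR_ge0// exprn_ge0// invr_ge0 ltW.
Qed.

(** From [u^(k+2) <= (k+2)! exp(u)] with [u = 1/t].  The quadratic bound gives
    continuity and a vanishing derivative at [0]. *)
Lemma flat_quadratic k : exists2 C : R, 0 < C & forall t, flat k t <= C * t ^+ 2.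
Proof.
exists (k.+2)`!%:R; first by rewrite ltr0n fact_gt0.
move=> t; rewrite /flat; case: ifPn => t0; last by rewrite mulr_ge0// sqr_ge0.
have u0 : 0 < t^-1 by rewrite invr_gt0.
have F0 : 0 < (k.+2)`!%:R :> R by rewrite ltr0n fact_gt0.
have := expR_ge1Dxn k.+1 (ltW u0); set u := t^-1 in u0 *.
rewrite expRN; have E0 := expR_gt0 u => H.
have H1 : u ^+ k.+2 <= expR u * (k.+2)`!%:R.
  by rewrite -ler_pdivrMr//; apply: le_trans H; rewrite lerDr.
have -> : t = u^-1 by rewrite /u invrK.
clearbody u.
rewrite ler_pdivrMr//; rewrite exprVn mulrAC ler_pdivlMr ?exprn_gt0//.
by rewrite -exprD addn2 mulrC.
Qed.

Lemma flat_derive k t : is_derive t (1 : R) (flat k) (flat k.+2 t - k%:R * flat k.+1 t).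
Proof.
have [t0|t0|->] := ltgtP t 0.
- have ft j (s : R) : s <= 0 -> flat j s = 0 by rewrite /flat ltNge => ->.
  rewrite !ft ?(ltW t0)// mulr0 subr0.
  apply/is_derive_epsdelta => eps e0; exists (- t); first by rewrite oppr_gt0.
  move=> h h0 ht; rewrite [h *: 1]mulr1.
  have th : t + h < 0 by have := le_lt_trans (ler_norm h) ht; lra.
  by rewrite !ft ?(ltW t0) ?(ltW th)// subrr mulr0 subrr normr0.
- pose G (u : R) := u ^+ k * expR (- u).
  have tn0 : t != 0 by rewrite gt_eqF.
  have dV : is_derive t (1 : R) (fun s : R => s^-1) (- (t ^- 2)).
    have dt : derivable (@id R) t 1 by exact: derivable_id.
    have := @deriveV R R (@id R) t 1 tn0 dt.
    rewrite derive_id => E; apply: DeriveDef.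
      exact: (@derivableV R R (@id R) t 1 tn0 dt).
    by apply: etrans E _; rewrite /GRing.scale /= mulr1.
  have dG (u : R) : is_derive u (1 : R) G (k%:R * u ^+ k.-1 * expR (- u) - u ^+ k * expR (- u)).
    have d1 : is_derive u (1 : R) (fun u : R => u ^+ k) (k%:R * u ^+ k.-1).
      apply: DeriveDef; first exact: exprn_derivable.
      by rewrite exp_derive /GRing.scale /= mulr1.
    have d2 : is_derive u (1 : R) (fun u : R => expR (- u)) (- expR (- u)).
      have -> : (fun u : R => expR (- u)) = (fun s => expR (- 1 * s)).
        by apply/funext => s; rewrite mulN1r.
      by have := is_derive_expM (-1) 1 u; rewrite mul1r mulN1r mulN1r.
    apply: (is_derive_eq (is_deriveM d1 d2)).
    by rewrite /GRing.scale /=; ring.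
  have dc : is_derive t (1 : R) (fun s : R => G s^-1)
      ((k%:R * t^-1 ^+ k.-1 * expR (- t^-1) - t^-1 ^+ k * expR (- t^-1)) * - (t ^- 2)).
    exact: (is_derive1_comp (f := G) (dG t^-1) dV).
  have dk : is_derive t (1 : R) (flat k)
      ((k%:R * t^-1 ^+ k.-1 * expR (- t^-1) - t^-1 ^+ k * expR (- t^-1)) * - (t ^- 2)).
    move/is_derive_epsdelta : dc => H; apply/is_derive_epsdelta => eps /H[d d0 Hd].
    exists (Num.min d t); first by rewrite lt_min d0.
    move=> h h0; rewrite lt_min => /andP[hd ht]; have := Hd h h0 hd.
    have th : 0 < t + h *: (1 : R).
      by rewrite [h *: 1]mulr1; have := ler_norm (- h); rewrite normrN; lra.
    by rewrite /G /flat t0 th.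
  apply: (is_derive_eq dk); rewrite /flat t0 -exprVn.
  case: (k) => [|j] /=; first by rewrite !mul0r; ring.
  by rewrite !exprS expr0; ring.
- have ft j : flat j 0 = 0 by rewrite /flat ltxx.
  rewrite !ft mulr0 subrr; have [C C0 HC] := flat_quadratic k.
  apply/is_derive_epsdelta => eps e0; exists (eps / C); first by rewrite divr_gt0.
  move=> h h0 hC; rewrite add0r [h *: 1]mulr1 ft !subr0.
  rewrite normrM normfV (ger0_norm (flat_ge0 k h)) ltr_pdivrMl ?normr_gt0//.
  apply: le_lt_trans (HC h) _; rewrite -[h ^+ 2]ger0_norm ?sqr_ge0// normrX.
  by rewrite expr2 mulrCA ltr_pM2l ?normr_gt0// mulrC -ltr_pdivlMr.
Qed.

Lemma Ck_flat n k : Ck n (flat k).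
Proof.
have c j : continuous (flat j).
  move=> t; apply: differentiable_continuous; apply/derivable1_diffP.
  exact: (@ex_derive _ _ _ _ _ _ _ (flat_derive j t)).
elim: n k => [|n IH] k; first by split.
split=> // v.
have D t : is_derive t v (flat k) (v * (flat k.+2 t - k%:R * flat k.+1 t)).
  have := derive_scale_dir v (@ex_derive _ _ _ _ _ _ _ (flat_derive k t)).
  by rewrite (@derive_val _ _ _ _ _ _ _ (flat_derive k t)) [v *: 1]mulr1.
split=> [t|]; first exact: (@ex_derive _ _ _ _ _ _ _ (D t)).
apply: (Ck_eq _ (CkZ v (CkD (IH k.+2) (CkZ (- k%:R) (IH k.+1))))) => t.
by rewrite (@derive_val _ _ _ _ _ _ _ (D t)) mulNr.
Qed.

Definition bump1 (t : R) := flat 0 (1 + t) * flat 0 (1 - t).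

Lemma Ck_bump1 n : Ck n bump1.
Proof.
apply: CkM.
  apply: (@Ck_comp_affine R R R (fun t => 1 + t) id) (Ck_flat n 0) => [t v s|t].
    by rewrite addrA.
  by apply: cvgD; [exact: cvg_cst|exact: cvg_id].
apply: (@Ck_comp_affine R R R (fun t => 1 - t) -%R) (Ck_flat n 0) => [t v s|t].
  by rewrite opprD addrA scalerN.
by apply: cvgB; [exact: cvg_cst|exact: cvg_id].
Qed.

Lemma bump1_ge0 t : 0 <= bump1 t.
Proof. by rewrite mulr_ge0// flat_ge0. Qed.

Lemma bump1_support t : 1 < `|t| -> bump1 t = 0.
Proof.
rewrite /bump1 /flat ltr_normr => /orP[t1|t1].
  by rewrite (ltNge 0 (1 - t)) (_ : 1 - t <= 0) ?mulr0//; lra.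
by rewrite (ltNge 0 (1 + t)) (_ : 1 + t <= 0) ?mul0r//; lra.
Qed.

(** A quantitative lower bound, since the mass of the rescaled bump is later compared
    with the volume of its support. *)
Lemma bump1_lower t : `|t| <= 2^-1 -> expR (-2) ^+ 2 <= bump1 t.
Proof.
move=> ht; have F s : 2^-1 <= s -> expR (-2) <= flat 0 s.
  move=> hs; have s0 : 0 < s by apply: lt_le_trans hs; rewrite invr_gt0.
  rewrite /flat s0 expr0 mul1r ler_expR lerN2.
  by rewrite -[leRHS]invrK lef_pV2 ?posrE ?invr_gt0.
move: ht; rewrite ler_norml => /andP[h1 h2].
rewrite expr2; apply: ler_pM; rewrite ?expR_ge0//; apply: F; lra.
Qed.

End bump.

Section phase_bump.
Context {R : realType} {N : nat}.
Local Notation phase := (R * 'rV[R]_N)%type.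

Definition bump (p : phase) : R := bump1 p.1 * \prod_i bump1 (p.2 0 i).

Lemma Ck_bump n : Ck n bump.
Proof.
apply: CkM.
  by apply: (@Ck_comp_affine _ _ _ fst fst) (Ck_bump1 n) => // p; exact: cvg_fst.
apply: Ck_prod => i.
apply: (@Ck_comp_affine R phase R (fun p => p.2 0 i) (fun p => p.2 0 i)) (Ck_bump1 n).
  by move=> p v t; rewrite !mxE.
move=> p; apply: (@cvg_comp _ _ _ snd (fun x : 'rV[R]_N => x 0 i) _ (nbhs p.2)).
  exact: cvg_snd.
exact: coord_continuous.
Qed.

Lemma bump_ge0 p : 0 <= bump p.
Proof. by rewrite mulr_ge0 ?bump1_ge0// prodr_ge0// => i _; exact: bump1_ge0. Qed.

Lemma bump_box : box_fun 1 bump.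
Proof.
split; first exact: (Ck_continuous (Ck_bump 0)).
move=> p; rewrite pair_normE lt_max => /orP[p1|p1].
  by rewrite /bump bump1_support// mul0r.
have [i hi] : exists i, 1 < `|p.2 0 i|.
  apply: contrapT => /forallNP H; move: p1; rewrite ltNge => /negP; apply.
  by apply: norm_le_coord => // i; rewrite leNgt; apply/negP; exact: H.
by rewrite /bump (bigD1 i)//= (bump1_support hi) mul0r mulr0.
Qed.

Lemma bump_lower : exists2 c : R, 0 < c & forall p, `|p| <= 2^-1 -> c <= bump p.
Proof.
have c0 : 0 < expR (-2) ^+ 2 :> R by rewrite exprn_gt0 ?expR_gt0.
exists (expR (-2) ^+ 2 * \prod_(i < N) expR (-2) ^+ 2).
  by rewrite mulr_gt0// prodr_gt0.
move=> p; rewrite pair_normE ge_max => /andP[p1 p2].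
apply: ler_pM; rewrite ?(ltW c0)//; first by apply: prodr_ge0 => i _; exact: ltW.
  exact: bump1_lower.
apply: ler_prod => i _; rewrite (ltW c0) bump1_lower//.
by apply: le_trans p2; exact: coord_le_norm.
Qed.
End phase_bump.

(** * Mollification and touching functions *)

Lemma ler_sub_exchange {R : realDomainType} (a b a' b' : R) : a - a' <= b - b' -> a - b <= a' - b'.
Proof. by move=> H; lra. Qed.

Lemma ler_second_diff {R : realDomainType} (a b c a' b' c' : R) :
  a - a' <= c - c' -> b - b' <= c - c' -> a + b - 2 * c <= b' - c' - (c' - a').
Proof. by move=> H1 H2; lra. Qed.

Section convolution.
Context {R : realType} {E : normedModType R} (d : nat) (I : (E -> R) -> R).
Hypothesis HI : box_integral d I.
Implicit Types (g h k : E -> R) (B C : R).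

Lemma boxi0 : I (fun _ => 0) = 0.
Proof.
have H0 (x : E) : `|0 : R| <= 0 by rewrite normr0.
have := boxi_bound HI (lexx 0) (box_fun_cst0 0) H0.
by rewrite mulr0 normr_le0 => /eqP.
Qed.

Lemma boxiZ B g (a : R) : 0 <= B -> box_fun B g -> I (fun x => a * g x) = a * I g.
Proof.
move=> B0 Hg; have := boxi_lin HI a B0 (box_fun_cst0 B) Hg.
by rewrite boxi0 add0r => <-; congr I; apply/funext => x; rewrite add0r.
Qed.

Lemma box_funZ B g (a : R) : box_fun B g -> box_fun B (fun x => a * g x).
Proof. by move=> Hg; apply: box_funM => // x; exact: cvg_cst. Qed.

Lemma box_funD B g h : box_fun B g -> box_fun B h -> box_fun B (fun x => g x + h x).
Proof.
move=> Hg Hh; have := box_fun_lin 1 Hg Hh.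
by congr box_fun; apply/funext => x; rewrite mul1r.
Qed.

Lemma box_funB B g h : box_fun B g -> box_fun B h -> box_fun B (fun x => g x - h x).
Proof.
move=> Hg Hh; have := box_fun_lin (-1) Hg Hh.
by congr box_fun; apply/funext => x; rewrite mulN1r.
Qed.

Lemma boxiD B g h : 0 <= B -> box_fun B g -> box_fun B h ->
  I (fun x => g x + h x) = I g + I h.
Proof.
move=> B0 Hg Hh; have := boxi_lin HI 1 B0 Hg Hh.
by rewrite mul1r => <-; congr I; apply/funext => x; rewrite mul1r.
Qed.

Lemma boxiB B g h : 0 <= B -> box_fun B g -> box_fun B h ->
  I (fun x => g x - h x) = I g - I h.
Proof. by move=> B0 Hg Hh; exact: (boxi_sub HI B0 Hg Hh). Qed.

Lemma boxi_sum B n (F : 'I_n -> E -> R) : 0 <= B -> (forall i, box_fun B (F i)) ->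
  box_fun B (fun x => \sum_i F i x) /\ I (fun x => \sum_i F i x) = \sum_i I (F i).
Proof.
move=> B0; elim: n F => [|n IH] F HF.
  have E0 : (fun x => \sum_(i < 0) F i x) = (fun _ => 0).
    by apply/funext => x; rewrite big_ord0.
  by rewrite E0 big_ord0 boxi0; split=> //; exact: box_fun_cst0.
have [b1 e1] := IH (fun i => F (lift ord0 i)) (fun i => HF _).
have E0 : (fun x => \sum_(i < n.+1) F i x) =
    (fun x => F ord0 x + \sum_i F (lift ord0 i) x).
  by apply/funext => x; rewrite big_ord_recl.
rewrite E0; split; first exact: box_funD.
by rewrite (boxiD B0 (HF _) b1) e1 big_ord_recl.
Qed.

Lemma boxi_ge0 B g : 0 <= B -> box_fun B g -> (forall x, 0 <= g x) -> 0 <= I g.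
Proof.
move=> B0 Hg g0; have := boxi_lower HI B0 Hg g0 (lexx 0) (lexx 0) (fun x _ => g0 x).
by rewrite mulr0.
Qed.

Lemma boxi_close B g h C : 0 <= B -> box_fun B g -> box_fun B h ->
  (forall x, `|g x - h x| <= C) -> `|I g - I h| <= (2 * B) ^+ d * C.
Proof.
move=> B0 Hg Hh HC; rewrite -(boxiB B0 Hg Hh).
exact: (boxi_bound HI B0 (box_funB Hg Hh)).
Qed.

(** Outside the closed box [g] vanishes on a neighbourhood of each point. *)
Lemma box_derive B g v : box_fun B g -> Ck 1 g -> box_fun B ('D_v g).
Proof.
move=> [cg g0] g1; split; first exact: (Ck_continuous (Ck_derive v g1)).
move=> p pB; suff H : is_derive p v g 0 by exact: (@derive_val _ _ _ _ _ _ _ H).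
apply/is_derive_epsdelta => eps e0.
have pB' : 0 < `|p| - B by rewrite subr_gt0.
have [del d0 H] := small_scale v pB'.
exists del => // h h0 /H hd; rewrite (g0 p)// g0; last first.
  have := ler_normB (p + h *: v) (h *: v); rewrite addrK => H'.
  by move: hd H' => /=; move: `|p| `|h *: v| `|_| => a b c; lra.
by rewrite subrr mulr0 subrr normr0.
Qed.

Lemma box_fun_small_shift B g v (h : R) : box_fun B g -> `|h| <= 1 ->
  box_fun (B + `|v|) (fun z => g (z + h *: v)).
Proof.
move=> Hg h1; apply: box_funW (box_fun_shift (h *: v) Hg).
by rewrite lerD2l normrZ ler_piMl.
Qed.

(** The quotients converge uniformly, by the mean value theorem and uniform continuity
    of ['D_v g], and all integrands live in one common box. *)
Lemma diff_quotient_limit B g k v : 0 <= B -> box_fun B g -> Ck 1 g ->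
  continuous k -> (forall z, `|k z| <= 1) ->
  forall eps : R, 0 < eps -> exists2 del : R, 0 < del & forall h : R, h != 0 ->
    `|h| < del ->
    `|I (fun z => k z * (h^-1 * (g (z + h *: v) - g z))) - I (fun z => k z * 'D_v g z)| <= eps.
Proof.
move=> B0 Hg g1 ck k1 eps e0.
have B0' : 0 <= B + `|v| by rewrite addr_ge0.
have BB : B <= B + `|v| by rewrite lerDl.
have M0 : 0 <= (2 * (B + `|v|)) ^+ d by rewrite exprn_ge0// mulr_ge0.
have M1 : 0 < (2 * (B + `|v|)) ^+ d + 1 by rewrite ltr_wpDl.
have e1 : 0 < eps / ((2 * (B + `|v|)) ^+ d + 1) by rewrite divr_gt0.
have HD := box_derive v Hg g1.
have [d1 d10 H1] := box_fun_unif_cont (@boxi_compact _ _ _ _ HI (B + 1)) HD e1.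
have [d2 d20 H2] := small_scale v d10.
exists (Num.min d2 1); first by rewrite lt_min d20 ltr01.
move=> h h0; rewrite lt_min => /andP[hd /ltW h1].
apply: le_trans (boxi_close B0' _ _ _) _.
- apply: box_funM => //; apply: box_funZ; apply: box_funB.
    exact: box_fun_small_shift.
  exact: box_funW Hg.
- by apply: box_funM => //; exact: box_funW HD.
- move=> z; rewrite -mulrBr normrM; apply: le_trans (ler_piMl _ (k1 z)) _ => //.
  have [t /andP[/ltW t0 /ltW t1] ->] := line_mvt z h (fun q => Ck_derivable g1 (v := v) (p := q)).
  rewrite mulKf//; apply/ltW/H1/H2; apply: le_lt_trans hd.
  by rewrite normrM ler_piMl// ger0_norm.
rewrite mulrCA ger_pMr// ler_pdivrMr// mul1r lerDl//.
Qed.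

Definition second_diff g z v (h : R) : R := g (z + h *: v) - g z - (g z - g (z - h *: v)).

Lemma second_diff_mvt g z v (h : R) : Ck 2 g ->
  exists2 t : R, `|t| <= `|h| & second_diff g z v h = h * (h * 'D_v ('D_v g) (z + t *: v)).
Proof.
move=> g2.
have [s [t [/andP[s0 s1] /andP[t0 t1] H]]] := mixed_difference (z - h *: v) h
  (fun q => Ck_derivable g2 (v := v) (p := q)) (fun q => Ck_derivable (Ck_derive v g2) (v := v) (p := q)).
exists ((s + t - 1) * h).
  by rewrite normrM ler_piMl// ler_norml; apply/andP; split; lra.
move: H; rewrite subrK /second_diff => ->; congr (_ * (_ * 'D_v ('D_v g) _)).
rewrite -addrA; congr (_ + _); rewrite -scaleNr -[X in _ + X]scalerDl -[LHS]scalerDl.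
have -> : - h + (s * h + t * h) = (s + t - 1) * h by ring.
by [].
Qed.

Lemma second_diff_limit B g k v : 0 <= B -> box_fun B g -> Ck 2 g ->
  continuous k -> (forall z, `|k z| <= 1) ->
  forall eps : R, 0 < eps -> exists2 del : R, 0 < del & forall h : R, h != 0 ->
    `|h| < del ->
    `|I (fun z => k z * (h^-1 * (h^-1 * second_diff g z v h)))
      - I (fun z => k z * 'D_v ('D_v g) z)| <= eps.
Proof.
move=> B0 Hg g2 ck k1 eps e0.
have B0' : 0 <= B + `|v| by rewrite addr_ge0.
have BB : B <= B + `|v| by rewrite lerDl.
have M0 : 0 <= (2 * (B + `|v|)) ^+ d by rewrite exprn_ge0// mulr_ge0.
have M1 : 0 < (2 * (B + `|v|)) ^+ d + 1 by rewrite ltr_wpDl.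
have e1 : 0 < eps / ((2 * (B + `|v|)) ^+ d + 1) by rewrite divr_gt0.
have HD := box_derive v (box_derive v Hg (CkW g2)) (Ck_derive v g2).
have [d1 d10 H1] := box_fun_unif_cont (@boxi_compact _ _ _ _ HI (B + 1)) HD e1.
have [d2 d20 H2] := small_scale v d10.
exists (Num.min d2 1); first by rewrite lt_min d20 ltr01.
move=> h h0; rewrite lt_min => /andP[hd /ltW h1].
have Hg' := box_funW BB Hg.
apply: le_trans (boxi_close B0' _ _ _) _.
- apply: box_funM => //; do 2 apply: box_funZ; apply: box_funB.
    by apply: box_funB => //; exact: box_fun_small_shift.
  apply: box_funB => //.
  rewrite (_ : (fun x => g (x - h *: v)) = (fun x => g (x + (- h) *: v))).
    by apply: box_fun_small_shift => //; rewrite normrN.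
  by apply/funext => x; rewrite scaleNr.
- by apply: box_funM => //; exact: box_funW HD.
- move=> z; rewrite -mulrBr normrM; apply: le_trans (ler_piMl _ (k1 z)) _ => //.
  have [t th ->] := second_diff_mvt z v h g2.
  by rewrite mulKf// mulKf//; apply/ltW/H1/H2; apply: le_lt_trans hd.
rewrite mulrCA ger_pMr// ler_pdivrMr// mul1r lerDl//.
Qed.

Lemma le_of_limits (X Y : R -> R) (a b : R) :
  (forall eps : R, 0 < eps -> exists2 del : R, 0 < del & forall h : R, h != 0 ->
    `|h| < del -> `|X h - a| <= eps) ->
  (forall eps : R, 0 < eps -> exists2 del : R, 0 < del & forall h : R, h != 0 ->
    `|h| < del -> `|Y h - b| <= eps) ->
  (exists2 del : R, 0 < del & forall h : R, 0 < h -> h < del -> X h <= Y h) -> a <= b.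
Proof.
move=> HX HY [d3 d30 H3]; apply/ler_addgt0Pr => eps e0.
have e2 : 0 < eps / 2 by rewrite divr_gt0.
have [d1 d10 H1] := HX _ e2; have [d2 d20 H2] := HY _ e2.
pose h := Num.min d1 (Num.min d2 d3) / 2.
have m0 : 0 < Num.min d1 (Num.min d2 d3) by rewrite !lt_min d10 d20.
have h0 : 0 < h by rewrite divr_gt0.
have : h < Num.min d1 (Num.min d2 d3) by rewrite ltr_pdivrMr// ltr_pMr// ltr1n.
rewrite !lt_min => /and3P[h1 h2 h3].
have := H3 h h0 h3; have := H1 h (lt0r_neq0 h0); rewrite gtr0_norm// => /(_ h1).
have := H2 h (lt0r_neq0 h0); rewrite gtr0_norm// => /(_ h2).
move: (X h) (Y h) => x y; rewrite !ler_norml => /andP[i1 i2] /andP[i3 i4] i5; clear -i1 i2 i3 i4 i5; lra.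
Qed.

(** By translation invariance the integral of every difference quotient is [0]. *)
Lemma integral_derive0 B g v : 0 <= B -> box_fun B g -> Ck 1 g -> I ('D_v g) = 0.
Proof.
move=> B0 Hg g1.
have c1 : continuous (fun _ : E => 1 : R) by move=> x; exact: cvg_cst.
have n1 (z : E) : `|1 : R| <= 1 by rewrite normr1.
apply/eqP; rewrite -normr_le0; apply/ler_addgt0Pr => eps e0; rewrite add0r.
have [del d0 H] := diff_quotient_limit v B0 Hg g1 c1 n1 e0.
pose h := Num.min del 1 / 2.
have m0 : 0 < Num.min del 1 by rewrite lt_min d0 ltr01.
have h0 : 0 < h by rewrite divr_gt0.
have : h < Num.min del 1 by rewrite ltr_pdivrMr// ltr_pMr// ltr1n.
rewrite lt_min => /andP[hd /ltW h1].
have := H h (lt0r_neq0 h0); rewrite gtr0_norm// => /(_ hd).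
have -> : (fun z => 1 * 'D_v g z) = 'D_v g by apply/funext => z; rewrite mul1r.
have BB : B <= B + `|v| by rewrite lerDl.
have B0' : 0 <= B + `|v| by rewrite addr_ge0.
have nh : `|h| <= 1 by rewrite gtr0_norm.
have Hs := box_fun_small_shift v Hg nh.
have Hg' := box_funW BB Hg.
have -> : I (fun z => 1 * (h^-1 * (g (z + h *: v) - g z))) = 0.
  transitivity (I (fun z => h^-1 * (g (z + h *: v) - g z))).
    by congr I; apply/funext => z; rewrite mul1r.
  rewrite (boxiZ _ B0' (box_funB Hs Hg')) (boxiB B0' Hs Hg').
  by rewrite (boxi_shift HI (h *: v) B0 Hg) subrr mulr0.
by rewrite sub0r normrN.
Qed.

(** The convolution [mollify] is never differentiated.  A function [Phi] that touches
    it from above at [p] dominates its finite differences at [p], and translation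
    invariance moves those onto the kernel [rho], where the limit can be taken under
    the integral. *)
Section touching.
Variables (B : R) (rho k Phi : E -> R) (p : E).
Hypothesis B0 : 0 <= B.
Hypothesis Hrho : box_fun B rho.
Hypothesis rho2 : Ck 2 rho.
Hypothesis ck : continuous k.
Hypothesis k1 : forall z, `|k z| <= 1.
Hypothesis Irho0 : 0 < I rho.
Hypothesis Phi2 : Ck 2 Phi.

Definition mollify (p : E) : R := I (fun z => k (p + z) * rho z) / I rho.

Hypothesis touch : local_max (fun p => mollify p - Phi p) p.

Lemma continuous_translate (q : E) : continuous (fun z => k (q + z)).
Proof.
move=> z; apply: (@cvg_comp _ _ _ (fun z => q + z) k _ (nbhs (q + z))); last exact: ck.
by apply: cvgD; [exact: cvg_cst|exact: cvg_id].
Qed.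

Lemma mollify_shift w : mollify (p + w) * I rho = I (fun z => k (p + z) * rho (z - w)).
Proof.
rewrite /mollify divfK ?gt_eqF//.
have Hb : box_fun (B + `|w|) (fun z => k (p + z) * rho (z - w)).
  apply: (box_funM (B := B + `|w|)); last exact: continuous_translate.
  by rewrite -(normrN w); exact: box_fun_shift.
rewrite -(boxi_shift HI w _ Hb) ?addr_ge0//.
by congr I; apply/funext => z; rewrite addrK addrA addrAC.
Qed.

Let kp z := k (p + z).
Let ckp : continuous kp. Proof. exact: continuous_translate. Qed.
Let kp1 z : `|kp z| <= 1. Proof. exact: k1. Qed.

Lemma touch_derive_le v : I (fun z => kp z * 'D_v rho z) <= I rho * 'D_(- v) Phi p.
Proof.
have dPhi := Ck_derivable (CkW Phi2) (v := - v) (p := p).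
pose X (h : R) := I (fun z => kp z * (h^-1 * (rho (z + h *: v) - rho z))).
pose Y (h : R) := I rho * (h^-1 * (Phi (p + h *: (- v)) - Phi p)).
apply: (@le_of_limits X Y (I (fun z => kp z * 'D_v rho z)) (I rho * 'D_(- v) Phi p)).
- exact: (diff_quotient_limit v B0 Hrho (CkW rho2) ckp kp1).
- move=> eps e0; have e1 : 0 < eps / I rho by rewrite divr_gt0.
  have [del d0 H] := (is_derive_epsdelta _ _ _ _).1 (derivableP dPhi) _ e1.
  exists del => // h h0 hd; rewrite -mulrBr normrM gtr0_norm// mulrC.
  by rewrite -ler_pdivlMr//; apply/ltW; exact: H.
- have [d1 d10 H1] := touch; have [d2 d20 H2] := small_scale (- v) d10.
  exists (Num.min d2 1); first by rewrite lt_min d20 ltr01.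
  move=> h h0; rewrite lt_min => /andP[hd /ltW h1].
  have nh : `|h| <= 1 by rewrite gtr0_norm.
  have BB : B <= B + `|v| by rewrite lerDl.
  have B0' : 0 <= B + `|v| by rewrite addr_ge0.
  have Hs := box_fun_small_shift v Hrho nh.
  have Hr' := box_funW BB Hrho.
  have -> : X h =
      h^-1 * (mollify (p + h *: (- v)) * I rho - mollify p * I rho).
    rewrite -{2}(addr0 p) !mollify_shift scalerN.
    rewrite -(boxiB B0'); last 2 first.
    - by apply: box_funM => //; rewrite opprK.
    - by apply: box_funM => //; rewrite oppr0; under eq_fun do rewrite addr0.
    rewrite -(boxiZ _ B0'); last first.
      apply: box_funB; apply: box_funM => //.
        by rewrite opprK.
      by rewrite oppr0; under eq_fun do rewrite addr0.
    congr I; apply/funext => z; rewrite opprK oppr0 addr0 -/(kp z); ring.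
  rewrite -mulrBl mulrA [leRHS]mulrC ler_wpM2r ?(ltW Irho0)//.
  rewrite ler_wpM2l ?invr_ge0 ?(ltW h0)//.
  have := H1 (h *: (- v)); rewrite H2 ?gtr0_norm// => /(_ isT).
  exact: ler_sub_exchange.
Qed.

(** The one-sided inequality for both [v] and [- v] is an equality. *)
Lemma touch_derive v : I (fun z => kp z * 'D_v rho z) = - (I rho * 'D_v Phi p).
Proof.
have dPhi u := Ck_derivable (CkW Phi2) (v := u) (p := p).
have DN := @derive_val _ _ _ _ _ _ _ (derive_opp_dir (dPhi v)).
have H1 := touch_derive_le v.
have H2 := touch_derive_le (- v).
have E1 : I (fun z => kp z * 'D_(- v) rho z) = - I (fun z => kp z * 'D_v rho z).
  rewrite -mulN1r -(boxiZ _ B0); last first.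
    by apply: box_funM => //; exact: box_derive (CkW rho2).
  congr I; apply/funext => z.
  rewrite (@derive_val _ _ _ _ _ _ _ (derive_opp_dir (Ck_derivable (CkW rho2) (v := v) (p := z)))).
  by rewrite mulN1r mulrN.
rewrite opprK in H2; rewrite E1 in H2; rewrite DN in H1.
apply/eqP; rewrite eq_le -mulrN H1 /=.
by rewrite mulrN lerNl.
Qed.

Lemma touch_derive2_le v : I (fun z => kp z * 'D_v ('D_v rho) z) <= I rho * 'D_v ('D_v Phi) p.
Proof.
pose X (h : R) := I (fun z => kp z * (h^-1 * (h^-1 * second_diff rho z v h))).
pose Y (h : R) := I rho * (h^-1 * (h^-1 * second_diff Phi p v h)).
apply: (@le_of_limits X Y (I (fun z => kp z * 'D_v ('D_v rho) z)) (I rho * 'D_v ('D_v Phi) p)).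
- exact: (second_diff_limit v B0 Hrho rho2 ckp kp1).
- move=> eps e0; have e1 : 0 < eps / I rho by rewrite divr_gt0.
  have cD := Ck_continuous (Ck_derive v (Ck_derive v Phi2)).
  have [d1 d10 H1] := (continuous_epsdelta _).1 cD p _ e1.
  have [d2 d20 H2] := small_scale v d10.
  exists d2 => // h h0 hd; rewrite -mulrBr normrM gtr0_norm// mulrC.
  rewrite -ler_pdivlMr//; have [t th ->] := second_diff_mvt p v h Phi2.
  by rewrite mulKf// mulKf//; apply/ltW/H1/H2; apply: le_lt_trans hd.
- have [d1 d10 H1] := touch; have [d2 d20 H2] := small_scale v d10.
  exists (Num.min d2 1); first by rewrite lt_min d20 ltr01.
  move=> h h0; rewrite lt_min => /andP[hd /ltW h1].
  have nh : `|h| <= 1 by rewrite gtr0_norm.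
  have nh' : `|- h| <= 1 by rewrite normrN gtr0_norm.
  have BB : B <= B + `|v| by rewrite lerDl.
  have B0' : 0 <= B + `|v| by rewrite addr_ge0.
  have Hs := box_fun_small_shift v Hrho nh.
  have Hs' := box_fun_small_shift v Hrho nh'.
  have Hr' := box_funW BB Hrho.
  have M1 : mollify (p - h *: v) * I rho = I (fun z => kp z * rho (z + h *: v)).
    by rewrite mollify_shift; congr I; apply/funext => z; rewrite opprK.
  have M2 : mollify (p + h *: v) * I rho = I (fun z => kp z * rho (z + (- h) *: v)).
    by rewrite mollify_shift; congr I; apply/funext => z; rewrite scaleNr.
  have M3 : mollify p * I rho = I (fun z => kp z * rho z).
    by rewrite -{1}(addr0 p) mollify_shift; congr I; apply/funext => z; rewrite subr0.
  have b1 : box_fun (B + `|v|) (fun z => kp z * rho (z + h *: v)) by exact: box_funM.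
  have b2 : box_fun (B + `|v|) (fun z => kp z * rho (z + (- h) *: v)) by exact: box_funM.
  have b3 : box_fun (B + `|v|) (fun z => kp z * rho z) by exact: box_funM.
  have -> : X h =
      h^-1 * (h^-1 * (mollify (p - h *: v) * I rho - mollify p * I rho
        - (mollify p * I rho - mollify (p + h *: v) * I rho))).
    rewrite M1 M2 M3 -(boxiB B0' b1 b3) -(boxiB B0' b3 b2).
    rewrite -(boxiB B0' (box_funB b1 b3) (box_funB b3 b2)).
    rewrite -(boxiZ _ B0' (box_funB (box_funB b1 b3) (box_funB b3 b2))).
    rewrite -(boxiZ _ B0' (box_funZ _ (box_funB (box_funB b1 b3) (box_funB b3 b2)))).
    congr I; apply/funext => z; rewrite /second_diff scaleNr; ring.
  have hi : 0 <= h^-1 by rewrite invr_ge0 ltW.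
  rewrite [leRHS]mulrCA [_ * (h^-1 * second_diff _ _ _ _)]mulrCA.
  do 2 rewrite ler_wpM2l//.
  have h2 := H2 h; rewrite gtr0_norm// in h2.
  have := H1 _ (h2 hd); have := H1 (- (h *: v)); rewrite normrN => /(_ (h2 hd)).
  rewrite /second_diff.
  move: (mollify (p - h *: v)) (mollify (p + h *: v)) (mollify p) => a b c.
  move: (Phi (p - h *: v)) (Phi (p + h *: v)) (Phi p) (I rho) Irho0 => a' b' c' m m0 i1 i2.
  have -> : a * m - c * m - (c * m - b * m) = m * (a + b - 2 * c) by ring.
  by rewrite ler_pM2l//; exact: ler_second_diff.
Qed.

End touching.
End convolution.

(** * Distributional subsolutions *)

Section mollified_subsolution.
Context {R : realType} {N : nat}.
Local Notation space := 'rV[R]_N.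
Local Notation phase := (R * 'rV[R]_N)%type.
Variables (q : space -> space) (e : space) (c : R).
Hypothesis he : dot e e = 1.
Hypothesis q1 : forall i, Ck 1 (fun x => q x 0 i).
Hypothesis q_div : forall x, divergence q x = 0.

Lemma dotNl (x y : space) : dot (- x) y = - dot x y.
Proof. by rewrite /dot -sumrN; apply: eq_bigr => i _; rewrite mxE mulNr. Qed.

Lemma divergence_sum x : \sum_i ('D_(basis_vec i) (fun y => q y 0 i) x : R) = 0.
Proof. exact: q_div. Qed.

(** Moving the drift onto the test function only changes its sign, because [q] is
    divergence free. *)
Lemma Lop_adjE (zeta : phase -> R) (p : phase) : Ck 1 zeta ->
  Lop_adj q e c zeta p = Lop (fun x => - q x) e (- c) zeta p.
Proof.
move=> Hz.
have D i : 'D_(x_dir i) (fun r : phase => (zeta r *: q r.2) 0 i) p =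
    q p.2 0 i * grad_x zeta p 0 i + zeta p * 'D_(basis_vec i) (fun y => q y 0 i) p.2.
  have -> : (fun r : phase => (zeta r *: q r.2) 0 i) = (fun r => zeta r * q r.2 0 i).
    by apply/funext => r; rewrite mxE.
  have d1 : derivable zeta p (x_dir i) by exact: (Ck_derivable Hz).
  have d2 : derivable ((fun y => q y 0 i) \o snd : phase -> R) p (x_dir i).
    by apply: (@derivable_comp_affine R phase space snd snd) => //; exact: (Ck_derivable (q1 i)).
  have := deriveM d1 d2.
  rewrite (@derive_comp_affine R phase space snd snd) // x_dirE => H.
  by apply: etrans H _; rewrite addrC grad_xE x_dirE.
have Dv : divergence_x (fun r : phase => zeta r *: q r.2) p = dot (q p.2) (grad_x zeta p).
  rewrite /divergence_x /dot (eq_bigr _ (fun i _ => D i)) big_split /=.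
  by rewrite -mulr_sumr divergence_sum mulr0 addr0.
by rewrite /Lop_adj /Lop Dv !dotNl; ring.
Qed.

Lemma translate_test_function (B : R) (rho : phase -> R) (p : phase) :
  box_fun B rho -> (forall n, Ck n rho) -> test_function (fun z => rho (z - p)).
Proof.
move=> Hb Hrho; split.
  move=> n; apply: (@Ck_comp_affine R phase phase (fun z => z - p) id) (Hrho n) => [z v t|z].
    by rewrite addrAC.
  by apply: cvgB; [exact: cvg_id|exact: cvg_cst].
have cK := @boxi_compact _ _ _ _ (integral_phase_box N) (B + `|p|).
apply: (subclosed_compact _ cK); first exact: closed_closure.
have clK : closed [set x : phase | `|x| <= B + `|p|].
  exact: (compact_closed (@norm_hausdorff _ _) cK).
rewrite [X in _ `<=` X](closure_id _).1//; apply: closure_subset => z /= z0.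
rewrite leNgt; apply/negP => zB; move/eqP: z0; apply; apply: Hb.2.
have := ler_normD (z - p) p; rewrite subrK => H.
by have := lt_le_trans zB H; rewrite ltrD2r.
Qed.

Section fixed_scale.
Variables (B : R) (rho V F : phase -> R) (f : space -> R -> R).
Hypothesis B0 : 0 <= B.
Hypothesis Hrho : box_fun B rho.
Hypothesis rhoC : forall n, Ck n rho.
Hypothesis rho_ge0 : forall z, 0 <= rho z.
Hypothesis Irho : 0 < integral_phase rho.
Hypothesis cV : continuous V.
Hypothesis V1 : forall p, `|V p| <= 1.
Hypothesis FE : F = (fun p => f p.2 (V p)).
Hypothesis cF : continuous F.
Hypothesis hV : distr_subsolution q f e c V.
Variables (Phi : phase -> R) (p : phase).
Hypothesis Phi2 : Ck 2 Phi.
Local Notation I := (@integral_phase R N).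
Let HI := @integral_phase_box R N.
Hypothesis touch : local_max (fun p => mollify I rho V p - Phi p) p.

Let w i := front_dir e i.
Definition drift_increment i (z : phase) : R := q (p.2 + z.2) 0 i - q p.2 0 i.

Lemma Ck_drift_increment i : Ck 1 (drift_increment i).
Proof.
apply: CkD; last exact: Ck_cst.
apply: (@Ck_comp_affine R phase space (fun z => p.2 + z.2) snd) (q1 i) => [z v t|z].
  by rewrite addrA.
by apply: cvgD; [exact: cvg_cst|exact: cvg_snd].
Qed.

Lemma derive_drift_increment i z :
  'D_(w i) (drift_increment i) z = 'D_(basis_vec i) (fun y => q y 0 i) (p.2 + z.2).
Proof.
have E1 := @derive_comp_affine R phase space (fun z => p.2 + z.2) snd
  (fun z v t => addrA _ _ _) (fun y => q y 0 i) z (w i).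
have d1 : derivable ((fun y => q y 0 i) \o (fun z : phase => p.2 + z.2)) z (w i).
  apply: (@derivable_comp_affine R phase space (fun z => p.2 + z.2) snd) => [z' v t|].
    by rewrite addrA.
  exact: (Ck_derivable (q1 i)).
have := deriveB d1 (derivable_cst (q p.2 0 i) z (w i)).
rewrite derive_cst subr0 E1 front_dir2; exact.
Qed.

(** Integrating by parts puts the derivatives on the increments of [q], where they sum
    up to the divergence. *)
Lemma drift_increment_integral :
  \sum_i I (fun z => drift_increment i z * 'D_(w i) rho z) = 0.
Proof.
have rho1 : Ck 1 rho := rhoC 1.
have Hd i : box_fun B (fun z => drift_increment i z * rho z).
  by apply: box_funM => //; exact: (Ck_continuous (Ck_drift_increment i)).
have Hd1 i : Ck 1 (fun z => drift_increment i z * rho z).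
  by apply: CkM => //; exact: Ck_drift_increment.
have H2 i : box_fun B (fun z => drift_increment i z * 'D_(w i) rho z).
  apply: box_funM; last exact: (Ck_continuous (Ck_drift_increment i)).
  exact: box_derive.
pose dq i (z : phase) : R := 'D_(basis_vec i) (fun y => q y 0 i) (p.2 + z.2).
have cdq i : continuous (dq i).
  move=> z; apply: (@cvg_comp _ _ _ (fun z : phase => p.2 + z.2)
    ('D_(basis_vec i) (fun y => q y 0 i)) _ (nbhs (p.2 + z.2))).
    by apply: cvgD; [exact: cvg_cst|exact: cvg_snd].
  exact: (Ck_continuous (Ck_derive _ (q1 i))).
have H3 i : box_fun B (fun z => dq i z * rho z) by exact: box_funM.
have E i : I (fun z => drift_increment i z * 'D_(w i) rho z) = - I (fun z => dq i z * rho z).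
  have := integral_derive0 HI (w i) B0 (Hd i) (Hd1 i).
  have -> : 'D_(w i) (fun z => drift_increment i z * rho z) =
      (fun z => drift_increment i z * 'D_(w i) rho z + dq i z * rho z).
    apply/funext => z.
    apply: etrans (deriveM (Ck_derivable (Ck_drift_increment i)) (Ck_derivable rho1)) _.
    by rewrite derive_drift_increment; congr (_ + _); exact: mulrC.
  by rewrite (boxiD HI B0 (H2 i) (H3 i)) => /eqP; rewrite addr_eq0 => /eqP.
rewrite (eq_bigr _ (fun i _ => E i)) sumrN -(boxi_sum HI B0 H3).2.
have -> : (fun z => \sum_i dq i z * rho z) = (fun _ => 0).
  by apply/funext => z; rewrite -mulr_suml [X in X * _]divergence_sum mul0r.
by rewrite (boxi0 HI) oppr0.
Qed.

(** The error made when the drift is frozen at [p] under the convolution. *)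
Definition commutator : R :=
  \sum_i I (fun z => V (p + z) * (drift_increment i z * 'D_(w i) rho z)).

(** The preceding identity allows [V(p + z)] to be replaced by [V(p + z) - V(p)].
    This is what makes the commutator small: the factor [C], a product of an increment
    of [q] and a derivative of the kernel, is of order [1] at every scale. *)
Lemma commutator_bound (C omega : R) : 0 <= C -> 0 <= omega ->
  (forall z, `|z| <= B -> `|V (p + z) - V p| <= omega) ->
  (forall i z, `|z| <= B -> `|drift_increment i z * 'D_(w i) rho z| <= C) ->
  `|commutator| <= N%:R * ((2 * B) ^+ N.+1 * (omega * C)).
Proof.
move=> C0 o0 HV HC.
have rho1 : Ck 1 rho := rhoC 1.
have ckp : continuous (fun z => V (p + z)) by exact: (continuous_translate (k := V) cV).
have H2 i : box_fun B (fun z => drift_increment i z * 'D_(w i) rho z).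
  apply: box_funM; last exact: (Ck_continuous (Ck_drift_increment i)).
  exact: box_derive.
have H3 i := box_funM (H2 i) ckp.
have H4 i := box_funZ (V p) (H2 i).
have -> : commutator = \sum_i I (fun z => V (p + z) * (drift_increment i z * 'D_(w i) rho z)
    - V p * (drift_increment i z * 'D_(w i) rho z)).
  have E0 : V p * (\sum_i I (fun z => drift_increment i z * 'D_(w i) rho z)) = 0.
    by rewrite drift_increment_integral mulr0.
  have E1 i : I (fun z => V (p + z) * (drift_increment i z * 'D_(w i) rho z)
      - V p * (drift_increment i z * 'D_(w i) rho z)) =
      I (fun z => V (p + z) * (drift_increment i z * 'D_(w i) rho z))
      - V p * I (fun z => drift_increment i z * 'D_(w i) rho z).
    by rewrite (boxiB HI B0 (H3 i) (H4 i)) (boxiZ HI _ B0 (H2 i)).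
  by rewrite (eq_bigr _ (fun i _ => E1 i)) sumrB -mulr_sumr E0 subr0.
apply: le_trans (ler_norm_sum _ _ _) _.
rewrite mulr_natl -[X in _ *+ X](card_ord N) -sumr_const; apply: ler_sum => i _.
apply: (boxi_bound HI B0 (box_funB (H3 i) (H4 i))) => z.
rewrite -mulrBl normrM.
have [zB|zB] := leP `|z| B; first by apply: ler_pM => //; [exact: HV|exact: HC].
by rewrite ((H2 i).2 z zB) normr0 mulr0 mulr_ge0.
Qed.

(** The distributional inequality is tested with the translate [rho(. - p)].  Its second
    order and first order terms with coefficients frozen at [p] are estimated by those
    of the touching function [Phi]. *)
Lemma touch_inequality :
  0 <= I rho * Lop q e c Phi p - commutator + I (fun z => F (p + z) * rho z).
Proof.
have rho1 : Ck 1 rho := rhoC 1.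
have rho2 : Ck 2 rho := rhoC 2.
pose kp z := V (p + z).
have ckp : continuous kp by exact: (continuous_translate (k := V) cV).
have cFp : continuous (fun z => F (p + z)) by exact: (continuous_translate (k := F) cF).
pose zeta z := rho (z - p).
have tz : test_function zeta by exact: (translate_test_function p Hrho).
have affine_shift (z v : phase) (t : R) : z + t *: v - p = z - p + t *: v by rewrite addrAC.
have Dz v z : 'D_v zeta z = 'D_v rho (z - p).
  exact: (@derive_comp_affine R phase phase (fun z => z - p) id affine_shift).
have DDz v v' z : 'D_v' ('D_v zeta) z = 'D_v' ('D_v rho) (z - p).
  have -> : 'D_v zeta = ('D_v rho) \o (fun z => z - p) by apply/funext => y; exact: Dz.
  exact: (@derive_comp_affine R phase phase (fun z => z - p) id affine_shift).
pose A i z := kp z * 'D_(w i) ('D_(w i) rho) z.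
pose D i z := kp z * 'D_(w i) rho z.
pose S z := kp z * 'D_s_dir rho z.
pose C i z := kp z * (drift_increment i z * 'D_(w i) rho z).
pose H z := F (p + z) * rho z.
have bD v : box_fun B ('D_v rho) := box_derive v Hrho rho1.
have bA i : box_fun B (A i).
  exact: (box_funM (box_derive (w i) (bD (w i)) (Ck_derive (w i) rho2)) ckp).
have bDi i : box_fun B (D i) := box_funM (bD (w i)) ckp.
have bS : box_fun B S := box_funM (bD s_dir) ckp.
have bC i : box_fun B (C i).
  exact: (box_funM (box_funM (bD (w i)) (Ck_continuous (Ck_drift_increment i))) ckp).
have bH : box_fun B H := box_funM Hrho cFp.
have [bsA eA] := boxi_sum HI B0 bA.
have bqD i : box_fun B (fun z => q p.2 0 i * D i z) := box_funZ (q p.2 0 i) (bDi i).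
have [bsD eD] := boxi_sum HI B0 bqD.
have [bsC eC] := boxi_sum HI B0 bC.
have bcS : box_fun B (fun z => c * S z) := box_funZ c bS.
pose G z := \sum_i A i z + c * S z - (\sum_i q p.2 0 i * D i z) - (\sum_i C i z) + H z.
have b1 := box_funD bsA bcS.
have b2 := box_funB b1 bsD.
have b3 := box_funB b2 bsC.
have bG : box_fun B G by exact: (box_funD b3 bH).
have eqD : \sum_i I (fun z => q p.2 0 i * D i z) = \sum_i q p.2 0 i * I (D i).
  by apply: eq_bigr => i _; exact: (boxiZ HI (q p.2 0 i) B0 (bDi i)).
have IG : I G = \sum_i I (A i) + c * I S - (\sum_i q p.2 0 i * I (D i)) - commutator + I H.
  apply: etrans (boxiD HI B0 b3 bH) _; congr (_ + _).
  apply: etrans (boxiB HI B0 b2 bsC) _; congr (_ - _); last exact: eC.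
  apply: etrans (boxiB HI B0 b1 bsD) _; congr (_ - _); last exact: etrans eD eqD.
  apply: etrans (boxiD HI B0 bsA bcS) _; congr (_ + _); first exact: eA.
  exact: (boxiZ HI c B0 bS).
have ringid (a b b' x g v r : R) : v * (a - b + c * x) + g * r =
    v * a + c * (v * x) - v * b' - v * (b - b') + g * r by ring.
have IG0 : 0 <= I G.
  have Hz := hV tz (fun z => rho_ge0 (z - p)).
  apply: le_trans Hz _; rewrite -(boxi_shift HI (- p) B0 bG) le_eqVlt; apply/orP; left.
  apply/eqP; congr I; apply/funext => z.
  have zp : p + (z - p) = z by rewrite addrC subrK.
  have zp2 : p.2 + (z - p).2 = z.2 by rewrite -[in RHS]zp.
  pose a := \sum_i ('D_(w i) ('D_(w i) rho) (z - p) : R).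
  pose b := \sum_i q z.2 0 i * 'D_(w i) rho (z - p).
  pose b' := \sum_i q p.2 0 i * 'D_(w i) rho (z - p).
  have LA : Lop_adj q e c zeta z = a - b + c * 'D_s_dir rho (z - p).
    apply: etrans (Lop_adjE z (tz.1 1)) _.
    apply: etrans (LopE (fun x => - q x) (- c) z he (tz.1 2)) _.
    have comb (x x' y y' t t' : R) : x = x' -> y = - y' -> t = t' ->
        x + y - - c * t = x' - y' + c * t' by move=> -> -> ->; ring.
    apply: comb; last exact: Dz.
      by apply: eq_bigr => i _; exact: DDz.
    rewrite -sumrN; apply: eq_bigr => i _.
    have comb (x x' y y' : R) : x = - x' -> y = y' -> x * y = - (x' * y').
      by move=> -> ->; rewrite mulNr.
    by apply: comb; [rewrite mxE|exact: Dz].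
  have EA : \sum_i A i (z - p) = V z * a.
    by rewrite mulr_sumr; apply: eq_bigr => i _; rewrite /A /kp zp.
  have ED : \sum_i q p.2 0 i * D i (z - p) = V z * b'.
    by rewrite mulr_sumr; apply: eq_bigr => i _; rewrite /D /kp zp mulrCA.
  have EC : \sum_i C i (z - p) = V z * (b - b').
    rewrite -sumrB mulr_sumr; apply: eq_bigr => i _.
    by rewrite /C /kp zp /drift_increment zp2 mulrBl.
  rewrite LA /G EA ED EC /S /H /kp zp FE /zeta.
  exact: ringid.
apply: le_trans IG0 _; rewrite IG lerD2r lerD2r.
have Ds := touch_derive HI B0 Hrho rho2 cV V1 Irho Phi2 touch.
have DDs := touch_derive2_le HI B0 Hrho rho2 cV V1 Irho Phi2 touch.
have LE := LopE q c p he Phi2.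
have ES : I S = - (I rho * 'D_s_dir Phi p) by exact: Ds.
have ED : \sum_i q p.2 0 i * I (D i) =
    - (I rho * \sum_i q p.2 0 i * 'D_(front_dir e i) Phi p).
  rewrite mulr_sumr -sumrN; apply: eq_bigr => i _.
  have -> : I (D i) = - (I rho * 'D_(front_dir e i) Phi p) by exact: Ds.
  by rewrite mulrN mulrCA.
have EA : \sum_i I (A i) <= I rho * \sum_i ('D_(front_dir e i) ('D_(front_dir e i) Phi) p : R).
  by rewrite mulr_sumr; apply: ler_sum => i _; exact: DDs.
rewrite LE ES ED; move: EA.
move: (\sum_i I (A i)) (\sum_i ('D_(front_dir e i) ('D_(front_dir e i) Phi) p : R)).
move: (\sum_i q p.2 0 i * 'D_(front_dir e i) Phi p) ('D_s_dir Phi p) (I rho).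
move=> x y m a a' H1.
have -> : m * (a' + x - c * y) = m * a' + m * x - c * (m * y) by ring.
by rewrite mulrN opprK addrAC lerD2r lerD2r.
Qed.
End fixed_scale.
End mollified_subsolution.

Section weighted.
Context {R : realType} {E : normedModType R} (d : nat) (I : (E -> R) -> R).
Hypothesis HI : box_integral d I.

Lemma boxi_weighted_bound B (rho u : E -> R) (omega : R) : 0 <= B -> box_fun B rho ->
  (forall z, 0 <= rho z) -> continuous u -> (forall z, `|z| <= B -> `|u z| <= omega) ->
  `|I (fun z => u z * rho z)| <= omega * I rho.
Proof.
move=> B0 Hr r0 cu Hu.
have b1 : box_fun B (fun z => u z * rho z) := box_funM Hr cu.
have b2 : box_fun B (fun z => omega * rho z) := box_funZ omega Hr.
have pt z : - (omega * rho z) <= u z * rho z <= omega * rho z.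
  have [zB|zB] := leP `|z| B; last by rewrite (Hr.2 z zB) !mulr0 oppr0 lexx.
  have := Hu z zB; rewrite ler_norml => /andP[u1 u2].
  by rewrite -mulNr !ler_wpM2r.
have p1 := boxi_ge0 HI B0 (box_funB b2 b1) (fun z => _).
have p2 := boxi_ge0 HI B0 (box_funD b1 b2) (fun z => _).
rewrite -(boxiZ HI omega B0 Hr) ler_norml; apply/andP; split.
  rewrite -subr_ge0 opprK -(boxiD HI B0 b1 b2); apply: p2 => z.
  by have /andP[+ _] := pt z; rewrite -subr_ge0 opprK.
rewrite -subr_ge0 -(boxiB HI B0 b2 b1); apply: p1 => z.
by have /andP[_] := pt z; rewrite -subr_ge0.
Qed.

Lemma box_bounded B (g : E -> R) : box_fun B g -> exists2 C : R, 0 <= C & forall x, `|g x| <= C.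
Proof.
move=> Hg; have [B0|B0] := leP 0 B; last first.
  exists 0 => // x; rewrite (Hg.2 x) ?normr0//; exact: lt_le_trans B0 _.
have [||c _ H] := @compact_EVT_max _ R (fun x => `|g x|) _ _ (@boxi_compact _ _ _ _ HI B).
- by exists 0; rewrite /= normr0.
- apply: continuous_subspaceT => x; apply: cvg_norm; exact: Hg.1.
exists `|g c| => // x; have [xB|xB] := leP `|x| B; first by apply: H; exact/mem_set.
by rewrite (Hg.2 x xB) normr0.
Qed.

Lemma mollify_diff B (rho u v : E -> R) (omega : R) : 0 <= B -> box_fun B rho ->
  (forall z, 0 <= rho z) -> 0 < I rho -> continuous u -> continuous v ->
  (forall z, `|z| <= B -> `|u z - v z| <= omega) ->
  `|I (fun z => u z * rho z) / I rho - I (fun z => v z * rho z) / I rho| <= omega.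
Proof.
move=> B0 Hr r0 Ir cu cv Huv.
rewrite -mulrBl normrM normfV (gtr0_norm Ir) ler_pdivrMr//.
rewrite -(boxiB HI B0 (box_funM Hr cu) (box_funM Hr cv)).
have -> : (fun z => u z * rho z - v z * rho z) = (fun z => (u z - v z) * rho z).
  by apply/funext => z; rewrite mulrBl.
apply: (boxi_weighted_bound B0 Hr r0) => // z.
by apply: cvgB; [exact: cu|exact: cv].
Qed.
End weighted.

Section viscosity.
Context {R : realType} {N : nat} (L : 'I_N -> R).
Local Notation space := 'rV[R]_N.
Local Notation phase := (R * 'rV[R]_N)%type.
Hypothesis L0 : forall i, 0 < L i.
Variables (q : space -> space) (e : space) (c : R) (Cq : R).
Hypothesis he : dot e e = 1.
Hypothesis q1 : forall i, Ck 1 (fun x => q x 0 i).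
Hypothesis q_div : forall x, divergence q x = 0.
Hypothesis Cq0 : 0 < Cq.
Hypothesis q_lip : forall x z i, `|z| <= 1 -> `|q (x + z) 0 i - q x 0 i| <= Cq * `|z|.
Variables (V F : phase -> R) (f : space -> R -> R).
Hypothesis cV : continuous V.
Hypothesis V1 : forall p, `|V p| <= 1.
Hypothesis perV : periodic_x L V.
Hypothesis FE : F = (fun p => f p.2 (V p)).
Hypothesis cF : continuous F.
Hypothesis perF : periodic_x L F.
Hypothesis hV : distr_subsolution q f e c V.
Local Notation I := (@integral_phase R N).
Let HI := @integral_phase_box R N.

Definition scaled_bump (eps : R) (z : phase) : R := bump (eps^-1 *: z).

Let scale_affine (a : R) (z v : phase) (t : R) : a *: (z + t *: v) = a *: z + t *: (a *: v).
Proof. by rewrite scalerDr !scalerA mulrC. Qed.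

Lemma Ck_scaled_bump eps n : Ck n (scaled_bump eps).
Proof.
apply: (@Ck_comp_affine R phase phase (fun z => eps^-1 *: z) (fun z => eps^-1 *: z)) (Ck_bump n).
  exact: scale_affine.
exact: scaler_continuous.
Qed.

Lemma derive_scaled_bump eps v z : 'D_v (scaled_bump eps) z = eps^-1 * 'D_v bump (eps^-1 *: z).
Proof.
apply: etrans (@derive_comp_affine R phase phase (fun z => eps^-1 *: z) _ (scale_affine eps^-1) bump z v) _.
exact: (@derive_val _ _ _ _ _ _ _ (derive_scale_dir eps^-1 (Ck_derivable (Ck_bump 1)))).
Qed.

Lemma scaled_bump_box eps : 0 < eps -> box_fun eps (scaled_bump eps).
Proof.
move=> e0; split; first exact: (Ck_continuous (Ck_scaled_bump eps 0)).
move=> z ze; apply: bump_box.2; rewrite normrZ normfV (gtr0_norm e0).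
by rewrite ltr_pdivlMl// mulr1.
Qed.

Lemma scaled_bump_integral : exists2 cb : R, 0 < cb & forall eps : R, 0 < eps ->
  eps ^+ N.+1 * cb <= I (scaled_bump eps).
Proof.
have [cb cb0 H] := @bump_lower R N; exists cb => // eps e0.
have e2 : 0 <= eps / 2 by rewrite divr_ge0// ltW.
have := boxi_lower HI (ltW e0) (scaled_bump_box e0) (fun z => bump_ge0 _) e2 (ltW cb0).
have -> : 2 * (eps / 2) = eps by field.
apply => z zb; apply: H; rewrite normrZ normfV (gtr0_norm e0) ler_pdivrMl//.
Qed.

(** The mollifications of a distributional subsolution are approximate viscosity
    subsolutions, with an error that is uniform on [|s| <= S]. *)
Lemma viscosity_approximation (S err : R) : 0 < err -> exists M : phase -> R,
  [/\ continuous M, periodic_x L M,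
      forall p, `|p.1| <= S -> `|M p - V p| <= err
    & forall Phi p, Ck 2 Phi -> `|p.1| <= S -> local_max (fun z => M z - Phi z) p ->
        - err <= Lop q e c Phi p + F p].
Proof.
move=> err0.
have [Crho Crho0 HCrho] : exists2 C : R, 0 <= C &
    forall i z, `|'D_(front_dir e i) (@bump R N) z| <= C.
  have Hi i : exists C : R, 0 <= C /\ forall z, `|'D_(front_dir e i) (@bump R N) z| <= C.
    have [C C0 HC] := box_bounded HI (box_derive (front_dir e i) (@bump_box R N) (Ck_bump 1)).
    by exists C.
  have [C HC] := choice Hi; have C0 i : 0 <= C i by case: (HC i).
  exists (\sum_i C i); first by rewrite sumr_ge0.
  move=> i z; apply: le_trans ((HC i).2 z) _.
  by rewrite (bigD1 i)//= lerDl sumr_ge0.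
have [cb cb0 Hcb] := scaled_bump_integral.
(* [K] is the scale invariant constant of the commutator bound relative to the mass
   of the kernel: the volume of the support is (2 eps)^(N+1), the mass is at least
   cb eps^(N+1). *)
pose K := N%:R * (2 ^+ N.+1 * (Cq * Crho)) / cb.
have K0 : 0 <= K by rewrite divr_ge0 ?(ltW cb0)// !mulr_ge0 ?(ltW Cq0)// exprn_ge0.
have K1 : 0 < K + 1 by rewrite ltr_wpDl.
pose omega := Num.min (err / 2 / (K + 1)) err.
have o0 : 0 < omega by rewrite lt_min err0 !divr_gt0.
have err2 : 0 < err / 2 by rewrite divr_gt0.
have [d1 d10 HV] := periodic_unif_cont L0 S cV perV o0.
have [d2 d20 HF] := periodic_unif_cont L0 S cF perF err2.
pose m := Num.min 1 (Num.min d1 d2).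
have m0 : 0 < m by rewrite !lt_min ltr01 d10.
pose eps := m / 2.
have e0 : 0 < eps by rewrite divr_gt0.
have em : eps < m by rewrite ltr_pdivrMr// ltr_pMr// ltr1n.
have [e1 ed1 ed2] : [/\ eps < 1, eps < d1 & eps < d2].
  by move: em; rewrite !lt_min => /and3P[].
have eB0 := ltW e0.
pose rho := scaled_bump eps.
have Hrho : box_fun eps rho := scaled_bump_box e0.
have rho_ge0 z : 0 <= rho z by exact: bump_ge0.
have Ilow : eps ^+ N.+1 * cb <= I rho := Hcb eps e0.
have Irho : 0 < I rho by apply: lt_le_trans Ilow; rewrite mulr_gt0// exprn_gt0.
have cVp (p : phase) : continuous (fun z => V (p + z)).
  exact: (continuous_translate (k := V) cV).
have cFp (p : phase) : continuous (fun z => F (p + z)).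
  exact: (continuous_translate (k := F) cF).
exists (mollify I rho V); split.
- apply/continuous_epsdelta => p a a0.
  have a2 : 0 < a / 2 by rewrite divr_gt0.
  have [d0 d00 HVp] := periodic_unif_cont L0 (`|p.1| + 1) cV perV a2.
  exists d0 => // h hd; apply: (@le_lt_trans _ _ (a / 2)); last first.
    by rewrite ltr_pdivrMr// ltr_pMr// ltr1n.
  apply: (mollify_diff HI eB0 Hrho) => // z ze.
  have -> : p + h + z = (p + z) + h by rewrite addrAC.
  apply/ltW/HVp => //; apply: le_trans (ler_normD _ _) _; rewrite lerD2l.
  apply: le_trans (_ : `|z| <= 1); first by rewrite pair_normE le_max lexx.
  exact: le_trans ze (ltW e1).
- move=> s k x; apply: (congr1 (fun g => I g / I rho)); apply/funext => z; congr (_ * _).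
  have -> : (s, x + \row_i ((k i)%:~R * L i)) + z =
      (s + z.1, x + z.2 + \row_i ((k i)%:~R * L i)).
    transitivity (s + z.1, x + \row_i ((k i)%:~R * L i) + z.2); first by case: z.
    by rewrite addrAC.
  by rewrite (perV (s + z.1) k (x + z.2)); congr V; case: z.
- move=> p pS; apply: (@le_trans _ _ omega); last by rewrite ge_min lexx orbT.
  have -> : V p = I (fun z => V p * rho z) / I rho.
    by rewrite (boxiZ HI (V p) eB0 Hrho) mulfK// gt_eqF.
  apply: (mollify_diff HI eB0 Hrho) => //; first by move=> z; exact: cvg_cst.
  by move=> z ze; apply/ltW/HV => //; exact: le_lt_trans ze ed1.
move=> Phi p Phi2 pS touch.
have main := touch_inequality he q1 q_div eB0 Hrho (Ck_scaled_bump eps) rho_ge0 Irho cV V1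
  FE cF hV Phi2 touch.
have Hcomm := commutator_bound (q := q) (e := e) q1 q_div (B := eps) (rho := rho) (V := V) eB0 Hrho
  (Ck_scaled_bump eps) cV (p := p) (C := Cq * Crho) (omega := omega).
have {Hcomm} : `|commutator q e rho V p| <= N%:R * ((2 * eps) ^+ N.+1 * (omega * (Cq * Crho))).
  apply: Hcomm; [exact: mulr_ge0 (ltW Cq0) Crho0|exact: ltW| |].
    by move=> z ze; apply/ltW/HV => //; exact: le_lt_trans ze ed1.
  move=> i z ze; rewrite normrM derive_scaled_bump normrM normfV (gtr0_norm e0).
  have z2 : `|z.2| <= eps by apply: le_trans ze; rewrite pair_normE le_max lexx orbT.
  have h1 : `|drift_increment q p i z| <= Cq * eps.
    apply: le_trans (q_lip _ _ _) _; first exact: le_trans z2 (ltW e1).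
    by rewrite ler_wpM2l// ltW.
  have -> : Cq * Crho = (Cq * eps) * (eps^-1 * Crho) by field; rewrite gt_eqF.
  apply: ler_pM => //; first by rewrite mulr_ge0// invr_ge0.
  by rewrite ler_wpM2l// invr_ge0.
have -> : N%:R * ((2 * eps) ^+ N.+1 * (omega * (Cq * Crho))) = omega * K * (eps ^+ N.+1 * cb).
  by rewrite /K exprMn; field; rewrite gt_eqF.
have oK : 0 <= omega * K by rewrite mulr_ge0// ltW.
have oK2 : omega * K <= err / 2.
  apply: le_trans (_ : err / 2 / (K + 1) * K <= _).
    by rewrite ler_wpM2r// ge_min lexx.
  by rewrite mulrAC ler_pdivrMr// ler_pM2l// lerDl.
move=> Hcomm.
have {}Hcomm : `|commutator q e rho V p| <= err / 2 * I rho.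
  apply: le_trans Hcomm _; apply: ler_pM => //.
  by rewrite mulr_ge0 ?exprn_ge0// ltW.
have HIF : I (fun z => F (p + z) * rho z) <= (F p + err / 2) * I rho.
  have b1 := box_funM Hrho (cFp p); have b2 := box_funZ (F p) Hrho.
  have : `|I (fun z => (F (p + z) - F p) * rho z)| <= err / 2 * I rho.
    apply: (boxi_weighted_bound HI eB0 Hrho rho_ge0).
      by move=> z; apply: cvgB; [exact: cFp|exact: cvg_cst].
    by move=> z ze; apply/ltW/HF => //; exact: le_lt_trans ze ed2.
  have -> : (fun z => (F (p + z) - F p) * rho z) = (fun z => F (p + z) * rho z - F p * rho z).
    by apply/funext => z; rewrite mulrBl.
  rewrite (boxiB HI eB0 b1 b2) (boxiZ HI (F p) eB0 Hrho) ler_norml => /andP[_].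
  by rewrite lerBlDr mulrDl addrC.
have /ler_normlP[Hc1 _] := Hcomm.
rewrite -subr_ge0 -(pmulr_rge0 _ Irho); apply: le_trans main _.
have -> : I rho * (Lop q e c Phi p + F p - - err) =
    I rho * Lop q e c Phi p + err / 2 * I rho + (F p + err / 2) * I rho by field.
by rewrite lerD// lerD2l.
Qed.
End viscosity.

(** * Convexity of the principal eigenvalue *)

Section logarithm.
Context {R : realType} {V : normedModType R}.

Lemma CkV n (g : V -> R) : (forall p, 0 < g p) -> Ck n g -> Ck n (fun p => (g p)^-1).
Proof.
move=> g0; elim: n => [|n IH] Hg.
  by split=> // p; apply: cvgV; [rewrite gt_eqF|exact: (Ck_continuous Hg)].
split; first by move=> p; apply: cvgV; [rewrite gt_eqF|exact: (Ck_continuous Hg)].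
move=> v; split=> [p|].
  by apply: derivableV; [rewrite gt_eqF|exact: (Ck_derivable Hg)].
have Hi := IH (CkW Hg).
apply: (Ck_eq _ (CkZ (-1) (CkM (CkM Hi Hi) (Ck_derive v Hg)))) => p.
apply/esym; apply: etrans (deriveV _ (Ck_derivable Hg)) _; first by rewrite gt_eqF.
by rewrite /GRing.scale /= expr2 invfM mulN1r mulNr.
Qed.

Lemma is_derive_ln_comp (g : V -> R) p v : 0 < g p -> derivable g p v ->
  is_derive p v (fun p => ln (g p)) ('D_v g p / g p).
Proof.
move=> g0 dg; have := @is_derive_line R V g p v 0.
rewrite scale0r addr0 => /(_ dg) H.
have H1 : is_derive (g (p + (0 : R) *: v)) (1 : R) (@ln R) (g p)^-1.
  by rewrite scale0r addr0; exact: is_derive1_ln.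
have /is_derive_epsdelta H2 := is_derive1_comp (f := @ln R) H1 H.
apply/is_derive_epsdelta => eps /H2[d d0 Hd]; exists d => // h h0 hd.
have := Hd h h0 hd; rewrite /= add0r [h *: 1]mulr1 !scale0r !addr0.
by rewrite (mulrC (g p)^-1).
Qed.

Lemma Ck_ln n (g : V -> R) : (forall p, 0 < g p) -> Ck n.+1 g -> Ck n.+1 (fun p => ln (g p)).
Proof.
move=> g0 Hg; have D p v := is_derive_ln_comp (g0 p) (Ck_derivable Hg (v := v)).
split.
  move=> p; apply: (@cvg_comp _ _ _ g (@ln R) _ (nbhs (g p))).
    exact: (Ck_continuous Hg).
  exact: (continuous_ln (g0 p)).
move=> v; split=> [p|]; first exact: (@ex_derive _ _ _ _ _ _ _ (D p v)).
apply: (Ck_eq _ (CkM (Ck_derive v Hg) (CkV g0 (CkW Hg)))) => p.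
by rewrite (@derive_val _ _ _ _ _ _ _ (D p v)).
Qed.

Lemma derive_ln (g : V -> R) p v : (forall p, 0 < g p) -> Ck 1 g ->
  'D_v (fun p => ln (g p)) p = 'D_v g p / g p.
Proof.
move=> g0 Hg; exact: (@derive_val _ _ _ _ _ _ _ (is_derive_ln_comp (g0 p) (Ck_derivable Hg (v := v)))).
Qed.

Lemma derive2_ln (g : V -> R) p v : (forall p, 0 < g p) -> Ck 2 g ->
  'D_v ('D_v (fun p => ln (g p))) p = 'D_v ('D_v g) p / g p - ('D_v g p / g p) ^+ 2.
Proof.
move=> g0 Hg.
have -> : 'D_v (fun p => ln (g p)) = (fun p => 'D_v g p * (g p)^-1).
  by apply/funext => z; exact: derive_ln (CkW Hg).
have d1 := Ck_derivable (Ck_derive v Hg) (v := v) (p := p).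
have gn0 : g p != 0 by rewrite gt_eqF.
have dV := derivableV gn0 (Ck_derivable (CkW Hg) (v := v) (p := p)).
apply: etrans (deriveM d1 dV) _.
rewrite (deriveV gn0 (Ck_derivable (CkW Hg) (v := v) (p := p))).
move: ('D_v g p) ('D_v ('D_v g) p) (g p) gn0 => a b y y0.
rewrite /GRing.scale /=; field; exact: y0.
Qed.
End logarithm.

Section eigenvalues.
Context {R : realType} {N : nat} (L : 'I_N -> R).
Local Notation space := 'rV[R]_N.
Local Notation phase := (R * 'rV[R]_N)%type.
Hypothesis L0 : forall i, 0 < L i.
Variables (q : space -> space) (f : space -> R -> R) (e : space).
Hypothesis he : dot e e = 1.

Lemma eigenfunction_bounds lam k Psi : principal_eigenfunction L q f e lam k Psi ->
  exists2 m : R, 0 < m & exists M : R, forall x, m <= Psi x <= M.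
Proof.
move=> [P2 Pper Ppos _]; have cP := Ck_continuous P2.
have [x1 H1] := periodic_fun_min L0 cP Pper; have [x2 H2] := periodic_fun_max L0 cP Pper.
by exists (Psi x1) => //; exists (Psi x2) => x; rewrite H1 H2.
Qed.

(** With [A = h - g^2] and [v = g + l a], each bracket equals [A + v^2]; both the
    inequality between the [A] and convexity of the square go in the same direction. *)
Lemma convex_square_combination (t l1 l2 l3 g1 g2 g3 h1 h2 h3 a : R) : 0 <= t <= 1 ->
  l2 = t * l1 + (1 - t) * l3 -> g2 - t * g1 - (1 - t) * g3 = 0 ->
  h2 - g2 ^+ 2 - t * (h1 - g1 ^+ 2) - (1 - t) * (h3 - g3 ^+ 2) <= 0 ->
  h2 + 2 * l2 * (a * g2) + l2 ^+ 2 * a ^+ 2 <=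
  t * (h1 + 2 * l1 * (a * g1) + l1 ^+ 2 * a ^+ 2)
  + (1 - t) * (h3 + 2 * l3 * (a * g3) + l3 ^+ 2 * a ^+ 2).
Proof.
move=> /andP[t0 t1] -> E H.
have -> : g2 = t * g1 + (1 - t) * g3 by lra.
have H0 : 0 <= t * (1 - t) * (g1 + l1 * a - (g3 + l3 * a)) ^+ 2.
  by rewrite mulr_ge0 ?sqr_ge0// mulr_ge0// subr_ge0.
have E2 : g2 = t * g1 + (1 - t) * g3 by lra.
rewrite E2 in H; rewrite -subr_ge0.
set r := (X in 0 <= X).
have -> : r = t * (1 - t) * (g1 + l1 * a - (g3 + l3 * a)) ^+ 2 -
  (h2 - (t * g1 + (1 - t) * g3) ^+ 2 - t * (h1 - g1 ^+ 2) - (1 - t) * (h3 - g3 ^+ 2)).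
  by rewrite /r; ring.
by rewrite subr_ge0; apply: le_trans H H0.
Qed.

(** For [psi = ln Psi] the eigenvalue equation reads
    [laplacian psi + |grad psi + lambda e|^2 + q . (grad psi + lambda e) + eta = k],
    whose left-hand side is convex in [(psi, lambda)].  It is evaluated at a maximum
    point of [ln P2 - t ln P1 - (1 - t) ln P3]. *)
Lemma eigenvalue_convex (t l1 l2 l3 k1 k2 k3 : R) (P1 P2 P3 : space -> R) :
  0 <= t <= 1 -> l2 = t * l1 + (1 - t) * l3 ->
  principal_eigenfunction L q f e l1 k1 P1 ->
  principal_eigenfunction L q f e l2 k2 P2 ->
  principal_eigenfunction L q f e l3 k3 P3 -> k2 <= t * k1 + (1 - t) * k3.
Proof.
move=> t01 El [C1 per1 pos1 eq1] [C2 per2 pos2 eq2] [C3 per3 pos3 eq3].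
pose a x := ln (P2 x) + (- t) * ln (P1 x) + (- (1 - t)) * ln (P3 x).
have ln1 := Ck_ln pos1 C1; have ln2 := Ck_ln pos2 C2; have ln3 := Ck_ln pos3 C3.
have ab : Ck 2 (fun x => ln (P2 x) + (- t) * ln (P1 x)) := CkD ln2 (CkZ (- t) ln1).
have aC : Ck 2 a := CkD ab (CkZ (- (1 - t)) ln3).
have aper : Defs.periodic L a by move=> k x; rewrite /a per1 per2 per3.
have [x Hx] := periodic_fun_max L0 (Ck_continuous aC) aper.
have mx : local_max a x by exists 1 => // z _; exact: Hx.
have [D1 D2] := Ck2_local_max aC mx.
have lin (u v : space -> R) (s : R) w y : Ck 1 u -> Ck 1 v ->
    'D_w (fun z => u z + s * v z) y = 'D_w u y + s * 'D_w v y.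
  move=> Hu Hv; rewrite (_ : (fun z => _) = u + s \*: v)//.
  rewrite deriveD; [|exact: (Ck_derivable Hu)|]; last first.
    by apply: derivableZ; exact: (Ck_derivable Hv).
  by rewrite deriveZ//; exact: (Ck_derivable Hv).
have Da w y : 'D_w a y = 'D_w P2 y / P2 y + (- t) * ('D_w P1 y / P1 y)
    + (- (1 - t)) * ('D_w P3 y / P3 y).
  rewrite (lin _ _ _ w y (CkW ab) (CkW ln3)) (lin _ _ _ w y (CkW ln2) (CkW ln1)).
  by rewrite (derive_ln _ _ pos1 (CkW C1)) (derive_ln _ _ pos2 (CkW C2)) (derive_ln _ _ pos3 (CkW C3)).
have DDa w : 'D_w ('D_w a) x = ('D_w ('D_w P2) x / P2 x - ('D_w P2 x / P2 x) ^+ 2)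
    + (- t) * ('D_w ('D_w P1) x / P1 x - ('D_w P1 x / P1 x) ^+ 2)
    + (- (1 - t)) * ('D_w ('D_w P3) x / P3 x - ('D_w P3 x / P3 x) ^+ 2).
  have -> : 'D_w a = (fun y => ('D_w (fun z => ln (P2 z)) y + (- t) * 'D_w (fun z => ln (P1 z)) y)
      + (- (1 - t)) * 'D_w (fun z => ln (P3 z)) y).
    apply/funext => y.
    by rewrite (lin _ _ _ w y (CkW ab) (CkW ln3)) (lin _ _ _ w y (CkW ln2) (CkW ln1)).
  have d1 := Ck_derive w ln1; have d2 := Ck_derive w ln2; have d3 := Ck_derive w ln3.
  rewrite (lin _ _ _ w x (CkD d2 (CkZ (- t) d1)) d3) (lin _ _ _ w x d2 d1).
  have comb (u1 u2 u3 v1 v2 v3 r s : R) : u1 = v1 -> u2 = v2 -> u3 = v3 ->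
    u2 + r * u1 + s * u3 = v2 + r * v1 + s * v3 by move=> -> -> ->.
  by apply: comb; [exact: derive2_ln pos1 C1|exact: derive2_ln pos2 C2|exact: derive2_ln pos3 C3].
pose g (P : space -> R) i : R := 'D_(basis_vec i) P x / P x.
pose h (P : space -> R) i : R := 'D_(basis_vec i) ('D_(basis_vec i) P) x / P x.
have key (P : space -> R) lam k : 0 < P x -> eigen_op q f e lam P x = k * P x ->
    k = \sum_i (h P i + 2 * lam * (e 0 i * g P i) + lam ^+ 2 * e 0 i ^+ 2)
      + \sum_i q x 0 i * g P i + lam * dot (q x) e + Defs.eta f x.
  move=> P0 E.
  have -> : k = eigen_op q f e lam P x / P x by rewrite E mulfK// gt_eqF.
  have S1 : \sum_i (h P i + 2 * lam * (e 0 i * g P i) + lam ^+ 2 * e 0 i ^+ 2) =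
      laplacian P x / P x + 2 * lam * (dot e (grad P x) / P x) + lam ^+ 2.
    rewrite !big_split /= -!mulr_sumr.
    have -> : \sum_i e 0 i ^+ 2 = 1.
      by rewrite -he; apply: eq_bigr => i _; rewrite expr2.
    rewrite mulr1; congr (_ + _ * _ + _); first by rewrite /laplacian mulr_suml.
    by rewrite /dot mulr_suml; apply: eq_bigr => i _; rewrite mxE mulrA.
  have S2 : \sum_i q x 0 i * g P i = dot (q x) (grad P x) / P x.
    by rewrite /dot mulr_suml; apply: eq_bigr => i _; rewrite mxE mulrA.
  rewrite S1 S2 /eigen_op.
  move: (laplacian P x) (dot e (grad P x)) (dot (q x) (grad P x)) (dot (q x) e) (P x) P0.
  by move=> A B C D y y0; field; rewrite gt_eqF.
rewrite (key P1 l1 k1 (pos1 x) (eq1 x)) (key P2 l2 k2 (pos2 x) (eq2 x)) (key P3 l3 k3 (pos3 x) (eq3 x)).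
have Gi i : g P2 i - t * g P1 i - (1 - t) * g P3 i = 0.
  by rewrite -[RHS](D1 (basis_vec i)) Da !mulNr.
have I1 : \sum_i (h P2 i + 2 * l2 * (e 0 i * g P2 i) + l2 ^+ 2 * e 0 i ^+ 2) <=
    t * \sum_i (h P1 i + 2 * l1 * (e 0 i * g P1 i) + l1 ^+ 2 * e 0 i ^+ 2)
    + (1 - t) * \sum_i (h P3 i + 2 * l3 * (e 0 i * g P3 i) + l3 ^+ 2 * e 0 i ^+ 2).
  rewrite !mulr_sumr -big_split; apply: ler_sum => i _ /=.
  apply: convex_square_combination => //.
  by have := D2 (basis_vec i); rewrite DDa !mulNr.
have I2 : \sum_i q x 0 i * g P2 i =
    t * \sum_i q x 0 i * g P1 i + (1 - t) * \sum_i q x 0 i * g P3 i.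
  rewrite !mulr_sumr -big_split; apply: eq_bigr => i _ /=.
  have -> : g P2 i = t * g P1 i + (1 - t) * g P3 i by have := Gi i; lra.
  by ring.
rewrite I2; move: I1.
move: (\sum_i (h P2 i + _ + _)) (\sum_i (h P1 i + _ + _)) (\sum_i (h P3 i + _ + _)).
move: (\sum_i _ * g P1 i) (\sum_i _ * g P3 i) (dot (q x) e) (Defs.eta f x).
move=> A B C D X Y Z I1.
rewrite -subr_ge0.
have -> : t * (Y + A + l1 * C + D) + (1 - t) * (Z + B + l3 * C + D)
    - (X + (t * A + (1 - t) * B) + l2 * C + D) = t * Y + (1 - t) * Z - X.
  by rewrite El; ring.
by rewrite subr_ge0.
Qed.
End eigenvalues.

(** * Decay of fronts *)

Section lower_bound.
Context {R : realType} {N : nat} (L : 'I_N -> R).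
Local Notation space := 'rV[R]_N.
Local Notation phase := (R * 'rV[R]_N)%type.
Hypothesis L0 : forall i, 0 < L i.
Variables (q : space -> space) (f : space -> R -> R) (e : space).
Hypothesis he : dot e e = 1.

Lemma near_ninfty (P : R -> Prop) : (\forall s \near (-oo : set_system R), P s) ->
  exists S : R, forall s, s <= - S -> P s.
Proof.
move=> [M [_ HM]]; exists (1 - M) => s sM; apply: HM => /=; lra.
Qed.

Lemma near_pinfty (P : R -> Prop) : (\forall s \near (+oo : set_system R), P s) ->
  exists S : R, forall s, S <= s -> P s.
Proof.
move=> [M [_ HM]]; exists (M + 1) => s sM; apply: HM => /=; lra.
Qed.

Lemma expR_decay (a eps : R) : 0 < a -> 0 < eps ->
  exists S : R, forall s, s <= - S -> expR (a * s) <= eps.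
Proof.
move=> a0 e0; exists (a^-1 * eps^-1) => s sS.
have h1 : eps^-1 <= - (a * s).
  rewrite -mulrN -ler_pdivrMl// lerNr; exact: sS.
have h2 : eps^-1 <= expR (- (a * s)).
  by apply: le_trans h1 _; apply: le_trans (expR_ge1Dx _); rewrite lerDr.
rewrite -(opprK (a * s)) expRN -[leRHS]invrK lef_pV2 ?posrE ?invr_gt0//.
exact: expR_gt0.
Qed.

Lemma Lop_local_min c U p : Ck 2 U -> local_max (fun z => - U z) p -> 0 <= Lop q e c U p.
Proof.
move=> HU [d d0 Hm].
have H1 : Ck 2 (fun z => U z + (-2) * U z) := CkD HU (CkZ (-2) HU).
have : Lop q e c (fun z => U z + (-2) * U z) p <= 0.
  apply: (Lop_local_max _ _ he H1); exists d => // z /Hm.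
  by move: (U _) (U p) => a b; lra.
rewrite (Lop_lin_comb q c (-2) p he HU HU); move: (Lop _ _ _ _ _) => X; lra.
Qed.

(** So [Psi(x) exp(lam s)] is a sub- or supersolution of the linearized problem of speed
    [c] according to the sign of [k - c lam]. *)
Lemma Lop_exponential c lam k (Psi : space -> R) p :
  principal_eigenfunction L q f e lam k Psi ->
  Lop q e c (fun z => Psi z.2 * expR (lam * z.1)) p =
  (k - c * lam - Defs.eta f p.2) * (Psi p.2 * expR (lam * p.1)).
Proof.
move=> [P2 _ _ /(_ p.2)]; rewrite /eigen_op => E.
rewrite (Lop_separated _ _ _ _ _ P2).
move: E; move: (laplacian Psi p.2) (dot e _) (dot (q p.2) (grad Psi p.2)) (dot (q p.2) e).
move: (Defs.eta f p.2) (Psi p.2) (expR _) => et P E A B C D H.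
have -> : (k - c * lam - et) * (P * E) = (k * P - (c * lam + et) * P) * E by ring.
by rewrite -H; ring.
Qed.

(** The quotient of [phi - delta Psi exp(mu s)] by [Theta exp(nu s)] is nonnegative on
    the line [s = - S], and its negative part vanishes as [s] tends to [-oo] because
    [nu < mu].  If it had a negative infimum [- a], the function
    [phi - delta Psi exp(mu s) + a Theta exp(nu s)] would have an interior zero minimum,
    where the operator gives the wrong sign.  Dividing by [Theta exp(nu s)] is what
    makes a maximum principle available although the zero order coefficient [eta] is
    nonnegative. *)
Lemma front_lower_bound c phi mu kmu Psi nu knu Theta :
  (forall eps : R, 0 < eps -> exists2 u0 : R, 0 < u0 <= 1 &
     forall x u, 0 <= u <= u0 -> (Defs.eta f x - eps) * u <= f x u) ->
  pulsating_front L q f e c phi -> increasing_s phi ->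
  principal_eigenfunction L q f e mu kmu Psi -> c * mu < kmu ->
  principal_eigenfunction L q f e nu knu Theta -> knu <= c * nu -> nu < mu ->
  exists2 delta : R, 0 < delta & exists S : R, forall p : phase, p.1 <= - S ->
    delta * (Psi p.2 * expR (mu * p.1)) <= phi p.
Proof.
move=> Hlin Hphi inc HPsi cmu HTh cnu numu.
have [phi2 phi01 phiper phieq phi0 _] := Hphi.
have cphi := Ck_continuous phi2.
(* the margin by which the exponential is a strict subsolution pays for replacing
   [f(x, u)] by its linearization *)
pose eps := kmu - c * mu; have e0 : 0 < eps by rewrite subr_gt0.
have [u0 /andP[u00 u01] Hf] := Hlin _ e0.
have [S HS] := near_ninfty (phi0 _ u00).
have smallphi p : p.1 <= - S -> 0 <= phi p <= u0.
  move=> pS; have := HS p.1 pS p.2; rewrite subr0 -surjective_pairing => /ltW.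
  by have /andP[p0 _] := phi01 p; rewrite ger0_norm// p0.
have [Pm Pm0 [PM HP]] := eigenfunction_bounds L0 HPsi.
have [Tm Tm0 [TM HT]] := eigenfunction_bounds L0 HTh.
have PM0 : 0 < PM by have /andP[a b] := HP 0; apply: lt_le_trans Pm0 (le_trans a b).
have [x0 Hx0] : exists x0, forall x, phi (- S, x0) <= phi (- S, x).
  apply: (periodic_fun_min L0); last exact: phiper.
  exact: slice_continuous.
pose m0 := phi (- S, x0).
have m00 : 0 < m0.
  have := inc x0 (- S - 1) (- S); rewrite ltrBlDr ltrDl ltr01 => /(_ isT).
  by apply: le_lt_trans; have /andP[] := phi01 (- S - 1, x0).
pose delta := m0 / (PM * expR (mu * - S)).
have ES0 := expR_gt0 (mu * - S).
have delta0 : 0 < delta by rewrite divr_gt0// mulr_gt0.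
exists delta => //; exists S; apply: contrapT => /existsNP[p1 /not_implyP[p1S]].
move=> /negP; rewrite -ltNge => bad.
pose w (p : phase) := Psi p.2 * expR (mu * p.1).
pose th (p : phase) := Theta p.2 * expR (nu * p.1).
have [Psi2 Psiper Psi0 _] := HPsi; have [Th2 Thper Th0 _] := HTh.
have w2 : Ck 2 w := Ck_separated Psi2 (Ck_expM 2 mu).
have th2 : Ck 2 th := Ck_separated Th2 (Ck_expM 2 nu).
have th0 p : 0 < th p by rewrite mulr_gt0// expR_gt0.
have w0 p : 0 < w p by rewrite mulr_gt0// expR_gt0.
have G2 : Ck 2 (fun p => phi p + (- delta) * w p) := CkD phi2 (CkZ (- delta) w2).
pose z p := (phi p + (- delta) * w p) * (th p)^-1.
have cz : continuous z := Ck_continuous (CkM G2 (CkV th0 th2)).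
have z1 : z p1 < 0.
  by rewrite /z pmulr_llt0 ?invr_gt0// mulNr subr_lt0.
have zper s : Defs.periodic L (fun x => z (s, x)).
  by move=> k x; rewrite /z /w /th (phiper s k x) /= Psiper Thper.
have munu : 0 < mu - nu by rewrite subr_gt0.
(* bound for the quotient of the two exponential functions, up to the factor
   exp((mu - nu) s) *)
pose C := delta * (PM / Tm).
have C0 : 0 < C by rewrite mulr_gt0// divr_gt0.
have [S1 HS1] : exists S1 : R, forall s, s <= - S1 -> expR ((mu - nu) * s) <= - z p1 / 2 / C.
  by apply: expR_decay => //; rewrite !divr_gt0// oppr_gt0.
have far p : p.1 <= - S1 -> z p1 < z p.
  move=> pS1; have := HS1 _ pS1; rewrite ler_pdivlMr// => H.
  have zlow : - (expR ((mu - nu) * p.1) * C) <= z p.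
    have -> : z p = phi p / th p - delta * (w p / th p) by rewrite /z; ring.
    have h1 : 0 <= phi p / th p.
      by have /andP[+ _] := phi01 p => h; rewrite divr_ge0// ltW.
    have h2 : delta * (w p / th p) <= expR ((mu - nu) * p.1) * C.
      have -> : w p / th p = Psi p.2 / Theta p.2 * expR ((mu - nu) * p.1).
        have E1 := expR_gt0 (nu * p.1).
        rewrite /w /th mulrBl expRB; field.
        by rewrite !gt_eqF.
      rewrite /C [leRHS]mulrCA [X in _ <= _ * X]mulrC ler_pM2l// ler_pM2r ?expR_gt0//.
      have /andP[_ a] := HP p.2; have /andP[b _] := HT p.2.
      by apply: ler_pM => //; rewrite ?invr_ge0 ?(ltW (Psi0 _)) ?(ltW (Th0 _)) ?lef_pV2 ?posrE.
    by move: h1 h2; move: (phi p / th p) (delta * _) (expR _ * C) => a b d; lra.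
  by move: z1 H zlow; move: (z p1) (z p) (expR _ * C) => a b d; lra.
pose T := Num.max S1 (Num.max S (- p1.1)).
have [TS1 TS Tp1] : [/\ S1 <= T, S <= T & - p1.1 <= T].
  by rewrite !le_max !lexx !orbT.
have cpt : compact (`[- T, - S]%classic : set R) by exact: segment_compact.
have ne : (`[- T, - S]%classic : set R) !=set0.
  by exists p1.1; rewrite /= in_itv /= p1S andbT lerNl.
have cnz : continuous (fun p => - z p) by move=> p; apply: cvgN; exact: cz.
have pernz (s : R) : Defs.periodic L (fun x => - z (s, x)) by move=> k x; rewrite zper.
have [s [x [/= sT Hmin]]] := periodic_max L0 ne cpt cnz pernz.
move: sT; rewrite in_itv /= => /andP[sT sS].
have zmin s' x' : - T <= s' -> s' <= - S -> z (s, x) <= z (s', x').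
  by move=> a b; rewrite -lerN2; apply: Hmin; rewrite /= in_itv /= a b.
have zs1 : z (s, x) <= z p1.
  by rewrite [p1]surjective_pairing; apply: zmin => //; rewrite lerNl.
have sT' : - T < s.
  rewrite lt_neqAle sT andbT; apply/negP => /eqP sE.
  have : (s, x).1 <= - S1 by rewrite /= -sE lerN2.
  by move/far; rewrite ltNge zs1.
have sS' : s < - S.
  rewrite lt_neqAle sS andbT; apply/negP => /eqP sE.
  have : 0 <= z (s, x).
    rewrite /z mulr_ge0 ?invr_ge0 ?(ltW (th0 _))// mulNr subr_ge0 /w /= sE.
    apply: le_trans (Hx0 x); rewrite -/m0 /delta.
    rewrite mulrAC ler_pdivrMr ?mulr_gt0// ler_pM2l// ler_pM2r//.
    by have /andP[] := HP x.
  by rewrite leNgt (le_lt_trans zs1 z1).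
pose p := (s, x) : phase.
pose a := - z p.
have a0 : 0 < a by rewrite oppr_gt0 (le_lt_trans zs1 z1).
pose U y := (phi y + (- delta) * w y) + a * th y.
have U2 : Ck 2 U := CkD G2 (CkZ a th2).
have UE y : U y = th y * (z y - z p).
  have zt : th y * z y = phi y + (- delta) * w y.
    by rewrite /z mulrC divfK// gt_eqF ?th0.
  by rewrite mulrBr zt /U /a; ring.
have Up : U p = 0 by rewrite UE subrr mulr0.
have mU : local_max (fun y => - U y) p.
  exists (Num.min (s + T) (- S - s)); first by rewrite lt_min -ltrBlDr sub0r sT' subr_gt0.
  move=> y; rewrite pair_normE gt_max lt_min => /andP[/andP[y1 y2] _].
  rewrite Up oppr0 oppr_le0 UE mulr_ge0 ?(ltW (th0 _))// subr_ge0.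
  rewrite [p + y]surjective_pairing; apply: zmin => /=.
    by have := ler_norm (- y.1); rewrite normrN; lra.
  by have := ler_norm y.1; lra.
have LU := Lop_local_min c U2 mU.
have Leq : Lop q e c U p = - f x (phi p)
    + (- delta) * ((kmu - c * mu - Defs.eta f x) * w p)
    + a * ((knu - c * nu - Defs.eta f x) * th p).
  rewrite /U (Lop_lin_comb q c a p he G2 th2) (Lop_lin_comb q c (- delta) p he phi2 w2).
  rewrite (Lop_exponential c p HPsi) (Lop_exponential c p HTh).
  by have /eqP := phieq p; rewrite addr_eq0 => /eqP ->.
have Hfp := Hf x (phi p) (smallphi p sS).
have phiE : phi p = delta * w p - a * th p by move: Up; rewrite /U; lra.
move: LU; rewrite Leq leNgt => /negP; apply.
apply: (@le_lt_trans _ _ (a * th p * (knu - c * nu - eps))).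
  rewrite -subr_ge0.
  have -> : a * th p * (knu - c * nu - eps) - (- f x (phi p)
    + - delta * ((kmu - c * mu - Defs.eta f x) * w p)
    + a * ((knu - c * nu - Defs.eta f x) * th p)) =
    f x (phi p) - (Defs.eta f x - eps) * (delta * w p - a * th p).
    by rewrite /eps; ring.
  by rewrite subr_ge0 -phiE.
have ath : 0 < a * th p by apply: mulr_gt0.
by rewrite (pmulr_rlt0 _ ath) subr_lt0 (le_lt_trans _ e0)// subr_le0.
Qed.

End lower_bound.

(** * Sliding *)

Section sliding.
Context {R : realType} {N : nat} (L : 'I_N -> R).
Local Notation space := 'rV[R]_N.
Local Notation phase := (R * 'rV[R]_N)%type.
Hypothesis L0 : forall i, 0 < L i.
Variables (q : space -> space) (f : space -> R -> R) (e : space).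
Variables (V : phase -> R).
Hypothesis cV : continuous V.
Hypothesis perV : periodic_x L V.
Hypothesis V01 : forall p, 0 < V p < 1.
Variable d : R.
Hypothesis d1 : d < 1.
Hypothesis Vsup : exists S : R, forall p, S <= p.1 -> V p <= d.
Variables (c : R) (phi : phase -> R).
Hypothesis Hphi : pulsating_front L q f e c phi.

Lemma front_at_ninfty (eps : R) : 0 < eps ->
  exists S : R, forall p : phase, p.1 <= - S -> phi p < eps.
Proof.
move=> e0; have [_ _ _ _ H _] := Hphi.
have [S HS] := near_ninfty (H _ e0); exists S => p pS.
by have := HS _ pS p.2; rewrite subr0 -surjective_pairing; apply: le_lt_trans (ler_norm _).
Qed.

Lemma front_at_pinfty (l : R) : l < 1 ->
  exists S : R, forall p : phase, S <= p.1 -> l <= phi p.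
Proof.
move=> l1; have [_ _ _ _ _ H] := Hphi.
have l0 : 0 < 1 - l by rewrite subr_gt0.
have [S HS] := near_pinfty (H _ l0); exists S => p pS.
have := HS _ pS p.2; rewrite -surjective_pairing distrC => /(le_lt_trans (ler_norm _)).
by move: (phi p) => a; lra.
Qed.

Lemma V_bounded_away (S : R) : exists2 D : R, D < 1 & forall p, - S <= p.1 -> V p <= D.
Proof.
have [S4 HS4] := Vsup.
have cpt : compact (`[- S, Num.max S4 (- S)]%classic : set R) by exact: segment_compact.
have ne : (`[- S, Num.max S4 (- S)]%classic : set R) !=set0.
  by exists (- S); rewrite /= in_itv /= lexx le_max lexx orbT.
have [s [x [_ H]]] := periodic_max L0 ne cpt cV perV.
exists (Num.max d (V (s, x))); first by rewrite gt_max d1; have /andP[] := V01 (s, x).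
move=> p pS; rewrite le_max; have [p4|p4] := leP S4 p.1; first by rewrite HS4.
apply/orP; right; rewrite [p]surjective_pairing; apply: H.
by rewrite /= in_itv /= pS le_max (ltW p4).
Qed.

(** Three regions: far to the left, where both functions are compared with
    [Psi exp(mu s)] and the translation gains a factor [exp(mu r1)]; the part of the
    left half where [phi] is bounded below by a positive constant and [V] is small; and
    the right half, where [V] stays away from [1] and [phi] is close to [1]. *)
Lemma initial_order mu (Psi : space -> R) (Pm PM delta S0 : R) :
  increasing_s phi -> 0 < mu -> 0 < Pm -> (forall x, Pm <= Psi x <= PM) ->
  (exists S : R, forall p, p.1 <= - S -> V p <= 2 * (Psi p.2 * expR (mu * p.1))) ->
  0 < delta ->
  (forall p : phase, p.1 <= - S0 -> delta * (Psi p.2 * expR (mu * p.1)) <= phi p) ->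
  exists r1, forall p, V p <= phi (p + r1 *: s_dir).
Proof.
move=> inc mu0 Pm0 HP [S2 HS2] delta0 Hlow.
have [phi2 phi01 phiper _ _ _] := Hphi.
have incle x s s' : s <= s' -> phi (s, x) <= phi (s', x).
  by rewrite le_eqVlt => /predU1P[->//|/inc/ltW].
have PM0 : 0 < PM by have /andP[a b] := HP 0; apply: lt_le_trans Pm0 (le_trans a b).
have [x0 Hx0] : exists x0, forall x, phi (- S0, x0) <= phi (- S0, x).
  apply: (periodic_fun_min L0); last exact: phiper.
  exact: slice_continuous (Ck_continuous phi2).
pose m0 := phi (- S0, x0).
have m00 : 0 < m0.
  have := inc x0 (- S0 - 1) (- S0); rewrite ltrBlDr ltrDl ltr01 => /(_ isT).
  by apply: le_lt_trans; have /andP[] := phi01 (- S0 - 1, x0).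
have [S3' HS3'] : exists S : R, forall s, s <= - S -> expR (mu * s) <= m0 / (2 * PM).
  by apply: expR_decay => //; rewrite divr_gt0// mulr_gt0.
pose S3 := Num.max S2 S3'.
have HS3 p : p.1 <= - S3 -> V p <= m0.
  rewrite lerNr ge_max => /andP[p2 p3].
  apply: le_trans (HS2 p _) _; first by rewrite lerNr.
  have := HS3' p.1; rewrite lerNr => /(_ p3); rewrite ler_pdivlMr ?mulr_gt0// => H.
  apply: le_trans H; have -> : 2 * (Psi p.2 * expR (mu * p.1)) = expR (mu * p.1) * (2 * Psi p.2).
    by ring.
  rewrite ler_wpM2l ?expR_ge0// ler_wpM2l//.
  by have /andP[] := HP p.2.
have [D D1 HD] := V_bounded_away S3.
have [S5 HS5] := front_at_pinfty D1.
pose r1 := Num.max (2 / delta / mu) (Num.max (S2 - S0) (S3 + S5)).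
have [ra rb rc] : [/\ 2 / delta / mu <= r1, S2 - S0 <= r1 & S3 + S5 <= r1].
  by rewrite !le_max !lexx !orbT.
exists r1 => p.
have p1E : (p + r1 *: s_dir).1 = p.1 + r1 by exact: shift_s1.
have p2E : (p + r1 *: s_dir).2 = p.2 by exact: shift_s2.
have [c1|c1] := leP (p.1 + r1) (- S0).
  apply: le_trans (HS2 p _) _; first by move: c1 rb; lra.
  apply: le_trans (Hlow _ _); last by rewrite p1E.
  rewrite p1E p2E mulrDr expRD.
  have Er : 2 / delta <= expR (mu * r1).
    apply: le_trans (expR_ge1Dx _); apply: (@le_trans _ _ (mu * r1)); last by rewrite lerDr.
    by rewrite [leRHS]mulrC -ler_pdivrMr.
  have P0 : 0 <= Psi p.2 by have /andP[a _] := HP p.2; exact: le_trans (ltW Pm0) a.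
  have -> : delta * (Psi p.2 * (expR (mu * p.1) * expR (mu * r1))) =
    (delta * expR (mu * r1)) * (Psi p.2 * expR (mu * p.1)) by ring.
  rewrite ler_wpM2r ?mulr_ge0 ?expR_ge0//.
  by rewrite [leRHS]mulrC -ler_pdivrMr.
have [p3|p3] := leP p.1 (- S3).
  apply: le_trans (HS3 p p3) _; apply: le_trans (Hx0 p.2) _.
  by rewrite shift_sE; apply: incle; exact: ltW.
apply: le_trans (HD p (ltW p3)) _; apply: HS5; rewrite p1E; move: p3 rc; lra.
Qed.

Lemma continuous_comp_bounded {W W' : normedModType R} (g : W' -> R) (l : W -> W') :
  (forall p z, l (p + z) = l p + l z) -> (forall z, `|l z| <= 2 * `|z|) ->
  continuous g -> continuous (g \o l).
Proof.
move=> lD lb cg; apply/continuous_epsdelta => p eps e0.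
have [del d0 H] := (continuous_epsdelta _).1 cg (l p) _ e0.
exists (del / 2); first by rewrite divr_gt0.
move=> z zd; rewrite /= lD; apply: H; apply: le_lt_trans (lb z) _.
by rewrite mulrC -ltr_pdivlMr.
Qed.

Lemma one_sided_max_derive (j : R -> R) (r r1 j' : R) : r < r1 ->
  (forall r', r <= r' <= r1 -> j r' <= j r) -> is_derive r (1 : R) j j' -> j' <= 0.
Proof.
move=> rr H /is_derive_epsdelta D; apply/ler_addgt0Pr => eps e0; rewrite add0r.
have [del d0 Hd] := D _ e0.
pose h := Num.min del (r1 - r) / 2.
have m0 : 0 < Num.min del (r1 - r) by rewrite lt_min d0 subr_gt0.
have h0 : 0 < h by rewrite divr_gt0.
have : h < Num.min del (r1 - r) by rewrite ltr_pdivrMr// ltr_pMr// ltr1n.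
rewrite lt_min => /andP[hd hr].
have := Hd h (lt0r_neq0 h0); rewrite gtr0_norm// => /(_ hd).
rewrite [h *: 1]mulr1.
have jr : j (r + h) <= j r by apply: H; rewrite lerDl (ltW h0) -lerBrDl (ltW hr).
have : h^-1 * (j (r + h) - j r) <= 0 by rewrite pmulr_rle0 ?invr_gt0// subr_le0.
move: (h^-1 * _) => X; rewrite ltr_norml => X0 /andP[X1 _]; move: X0 X1; lra.
Qed.

(** The parabolic comparison principle in disguise: the translation [r] decreases from
    [r1] at speed [c1 - c] as time passes, and the weight [exp(kap r)] is the usual
    exponential in time that absorbs the Lipschitz constant of [f]. *)
Lemma sliding_contradiction (c1 Lip r1 : R) :
  c < c1 -> 0 < Lip ->
  (forall x s s', 0 <= s <= 1 -> 0 <= s' <= 1 -> `|f x s - f x s'| <= Lip * `|s - s'|) ->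
  (forall eps : R, 0 < eps -> exists S : R, forall p, p.1 <= - S -> V p <= eps) ->
  (forall (S err : R), 0 < err -> exists M : phase -> R,
  [/\ continuous M, periodic_x L M,
      forall p, `|p.1| <= S -> `|M p - V p| <= err
    & forall Phi p, Ck 2 Phi -> `|p.1| <= S -> local_max (fun z => M z - Phi z) p ->
        - err <= Lop q e c1 Phi p + f p.2 (V p)]) ->
  (forall p, V p <= phi (p + r1 *: s_dir)) -> False.
Proof.
move=> cc Lip0 HLip Vninf visc init.
have [phi2 phi01 phiper phieq _ _] := Hphi.
have gam0 : 0 < c1 - c by rewrite subr_gt0.
pose kap := (Lip + 1) / (c1 - c).
have kap0 : 0 < kap by rewrite divr_gt0// addr_gt0.
have V00 : 0 < V (0, 0) by have /andP[] := V01 (0, 0).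
have [S0 HS0] := front_at_ninfty V00.
(* at [r0] the translate has dropped below [V] at the origin, so the weighted
   maximum is positive *)
pose r0 := Num.min (- S0) (r1 - 1).
have r01 : r0 < r1 by rewrite /r0 gt_min; apply/orP; right; rewrite ltrBlDr ltrDl.
have start : phi (r0, 0) < V (0, 0) by apply: HS0; rewrite /= /r0 ge_min lexx.
pose a := expR (kap * r0) * (V (0, 0) - phi (r0, 0)).
have a0 : 0 < a by rewrite mulr_gt0 ?expR_gt0// subr_gt0.
pose E1 := expR (kap * r1).
have E10 : 0 < E1 by exact: expR_gt0.
have Ele r : r <= r1 -> expR (kap * r) <= E1 by move=> h; rewrite ler_expR ler_pM2l.
(* the mollification error is small against the value [a] of the weighted gap, even
   after multiplication by the weight [E1] and by [1 + Lip] *)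
pose err := a / (8 * E1 * (1 + Lip)).
have L1 : 0 < 1 + Lip by rewrite addr_gt0.
have err0 : 0 < err by rewrite divr_gt0// !mulr_gt0.
have errE : (1 + Lip) * err = a / (8 * E1).
  by rewrite /err; field; rewrite !gt_eqF.
have err_small : err <= a / (8 * E1).
  by rewrite -errE ler_peMl ?(ltW err0)// lerDl ltW.
have aE0 : 0 < a / (2 * E1) by rewrite divr_gt0// mulr_gt0.
have [Sa HSa] := Vninf _ aE0.
have [S4 HS4] := Vsup.
have [S5 HS5] := front_at_pinfty d1.
pose S := Num.max (Num.max Sa S4) (Num.max (S5 - r0) 0).
have [SSa SS4 SS5 SS0] : [/\ Sa <= S, S4 <= S, S5 - r0 <= S & 0 <= S].
  by rewrite !le_max !lexx !orbT.
have [M [cM perM closeM viscM]] := visc S err err0.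
(* a maximum point can therefore lie neither on [|s| = S] nor on [r = r1] *)
have gap_small r p : r0 <= r -> r <= r1 -> S <= `|p.1| \/ r = r1 ->
    V p - phi (p + r *: s_dir) <= a / (2 * E1).
  move=> ra rb [|->]; last first.
    by apply: le_trans (ltW aE0); rewrite subr_le0.
  have /andP[ph0 _] := phi01 (p + r *: s_dir).
  rewrite ler_normr => /orP[pS|pS].
    apply: le_trans (ltW aE0); rewrite subr_le0.
    apply: le_trans (HS4 p (le_trans SS4 pS)) _; apply: HS5; rewrite shift_s1.
    by move: SS5; rewrite lerBlDr => h; apply: le_trans h _; exact: lerD.
  apply: le_trans (HSa p _); first by rewrite gerBl.
  by rewrite lerNr (le_trans SSa).
pose G (w : (R * R) * space) := expR (kap * w.1.1) *
  (M (w.1.2, w.2) - phi (w.1.2 + w.1.1, w.2)).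
have GE r p : G ((r, p.1), p.2) = expR (kap * r) * (M p - phi (p + r *: s_dir)).
  by rewrite /G /= -surjective_pairing shift_sE.
have cG : continuous G.
  have n11 (w : (R * R) * space) : `|w.1.1| <= `|w|.
    by rewrite pair_normE le_max (pair_normE w.1) le_max lexx.
  have n12 (w : (R * R) * space) : `|w.1.2| <= `|w|.
    by rewrite pair_normE le_max (pair_normE w.1) le_max lexx orbT.
  have n2 (w : (R * R) * space) : `|w.2| <= `|w| by rewrite pair_normE le_max lexx orbT.
  have c1' : continuous (fun w : (R * R) * space => expR (kap * w.1.1)).
    apply: (@continuous_comp_bounded _ _ (fun t => expR (kap * t)) (fun w => w.1.1)) => // [w|].
      by apply: le_trans (n11 w) _; rewrite ler_peMl// ler1n.
    exact: (Ck_continuous (Ck_expM 0 kap)).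
  have c2' : continuous (fun w : (R * R) * space => M (w.1.2, w.2)).
    apply: (@continuous_comp_bounded _ _ M (fun w => (w.1.2, w.2))) => // w.
    rewrite pair_normE ge_max /=; apply/andP; split.
      by apply: le_trans (n12 w) _; rewrite ler_peMl// ler1n.
    by apply: le_trans (n2 w) _; rewrite ler_peMl// ler1n.
  have c3' : continuous (fun w : (R * R) * space => phi (w.1.2 + w.1.1, w.2)).
    apply: (@continuous_comp_bounded _ _ phi (fun w => (w.1.2 + w.1.1, w.2))) => [w z|w|].
    - by rewrite /= addrACA.
    - rewrite pair_normE ge_max /=; apply/andP; split.
        by apply: le_trans (ler_normD _ _) _; rewrite mulr_natl mulr2n lerD.
      by apply: le_trans (n2 w) _; rewrite ler_peMl// ler1n.
    - exact: (Ck_continuous phi2).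
  move=> w; apply: cvgM; first exact: c1'.
  by apply: cvgB; [exact: c2'|exact: c3'].
have perG t : Defs.periodic L (fun x => G (t, x)).
  by move=> k x; rewrite /G /= (perM _ k x) (phiper _ k x).
have cptA : compact ((`[r0, r1]%classic : set R) `*` (`[- S, S]%classic : set R)).
  by apply: compact_setX; exact: segment_compact.
have neA : ((`[r0, r1]%classic : set R) `*` (`[- S, S]%classic : set R)) !=set0.
  exists (r0, 0); split; rewrite /= in_itv /= ?lexx ?(ltW r01)//.
  by rewrite SS0 andbT oppr_le0.
have [[r s] [x [[/= Ar As] Gmax]]] := periodic_max L0 neA cptA cG perG.
move: Ar As; rewrite !in_itv /= => /andP[rr0 rr1]; rewrite -ler_norml => sS.
pose p : phase := (s, x).
have Hmax r' p' : r0 <= r' -> r' <= r1 -> `|p'.1| <= S ->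
    expR (kap * r') * (M p' - phi (p' + r' *: s_dir)) <=
    expR (kap * r) * (M p - phi (p + r *: s_dir)).
  move=> h1 h2 h3; rewrite -!GE; apply: Gmax; split; rewrite /= in_itv /= ?h1//.
  by rewrite -ler_norml.
pose z := M p - phi (p + r *: s_dir).
have aerr : E1 * err <= a / 8.
  have -> : a / 8 = E1 * (a / (8 * E1)) by field; rewrite gt_eqF.
  by rewrite ler_pM2l.
have Gbig : a * 7 / 8 <= expR (kap * r) * z.
  have := Hmax r0 (0, 0) (lexx _) (ltW r01); rewrite normr0 => /(_ SS0).
  apply: le_trans; rewrite (_ : (0, 0) + r0 *: s_dir = (r0, 0)); last first.
    by rewrite shift_sE /= add0r.
  have cl : `|M (0, 0) - V (0, 0)| <= err by apply: closeM; rewrite normr0.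
  move: cl; rewrite ler_norml => /andP[cl _].
  have h1 : expR (kap * r0) * err <= a / 8.
    by apply: le_trans aerr; rewrite ler_wpM2r ?(ltW err0)// Ele// ltW.
  have h2 : expR (kap * r0) * (V (0, 0) - phi (r0, 0) - err) <=
      expR (kap * r0) * (M (0, 0) - phi (r0, 0)).
    rewrite ler_pM2l ?expR_gt0//; move: cl; rewrite lerBrDr addrC => cl.
    by rewrite addrAC lerD2r.
  apply: le_trans h2; rewrite mulrBr -/a; move: h1; lra.
have notsmall : ~ (V p - phi (p + r *: s_dir) <= a / (2 * E1)).
  move=> h; have /ler_normlP[_ cl] := closeM p sS.
  have zs : z <= a * 5 / 8 / E1.
    have -> : a * 5 / 8 / E1 = a / (2 * E1) + a / (8 * E1) by field; rewrite gt_eqF.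
    have -> : z = (V p - phi (p + r *: s_dir)) + (M p - V p) by rewrite /z; ring.
    by rewrite lerD// (le_trans cl).
  have : expR (kap * r) * z <= a * 5 / 8.
    apply: le_trans (ler_wpM2l (expR_ge0 _) zs) _.
    apply: (@le_trans _ _ (E1 * (a * 5 / 8 / E1))).
      apply: ler_wpM2r; last exact: Ele.
      by apply: divr_ge0 (ltW E10); rewrite divr_ge0// mulr_ge0// ltW.
    by rewrite mulrC divfK// gt_eqF.
  by move: Gbig a0; move: (_ * z) => X; lra.
have rlt : r < r1.
  rewrite lt_neqAle rr1 andbT; apply/eqP => rE.
  by apply: notsmall; apply: gap_small => //; right.
have slt : `|s| < S.
  by rewrite ltNge; apply/negP => Ss; apply: notsmall; apply: gap_small => //; left.
have Er0 := expR_gt0 (kap * r).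
have z0 : a / (2 * E1) <= z.
  have : a * 7 / 8 / E1 <= z.
    rewrite ler_pdivrMr// [leRHS]mulrC; apply: (le_trans Gbig _).
    have zp : 0 <= z.
      rewrite -(pmulr_rge0 _ Er0); apply: le_trans Gbig; rewrite divr_ge0// mulr_ge0// ltW//.
    by rewrite ler_wpM2r// Ele.
  apply: le_trans; have -> : a / (2 * E1) = a * 4 / 8 / E1 by field; rewrite gt_eqF.
  by rewrite ler_pM2r ?invr_gt0// ler_pM2r ?invr_gt0// ler_pM2l// ler_nat.
have zpos : 0 < z by exact: lt_le_trans aE0 z0.
(* [r = r0] is not excluded, so only the derivative to the right of [r] is used *)
have Dr : kap * z <= 'D_s_dir phi (p + r *: s_dir).
  pose j r' := expR (kap * r') * (M p - phi (p + r' *: s_dir)).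
  have dj : is_derive r (1 : R) j
      (kap * expR (kap * r) * z - expR (kap * r) * 'D_s_dir phi (p + r *: s_dir)).
    have d1' := is_derive_expM kap 1 r.
    have d2' := is_derive_line (Ck_derivable (CkW phi2) (v := s_dir) (p := p + r *: s_dir)).
    have d3' := is_deriveB (is_derive_cst (M p) r 1) d2'.
    apply: (is_derive_eq (is_deriveM d1' d3')).
    transitivity (expR (kap * r) * (0 - 'D_s_dir phi (p + r *: s_dir))
        + z * (1 * (kap * expR (kap * r)))); first by [].
    move: ('D_s_dir phi _) (expR _) => D E; ring.
  have := one_sided_max_derive rlt _ dj.
  have -> : kap * expR (kap * r) * z - expR (kap * r) * 'D_s_dir phi (p + r *: s_dir) =
    expR (kap * r) * (kap * z - 'D_s_dir phi (p + r *: s_dir)) by ring.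
  rewrite pmulr_rle0// subr_le0; apply => r' /andP[h1 h2].
  by apply: Hmax => //; exact: le_trans rr0 h1.
have touch : local_max (fun y => M y - translate_s r phi y) p.
  exists (S - `|s|); first by rewrite subr_gt0.
  move=> y; rewrite pair_normE gt_max => /andP[y1 _].
  have := Hmax r (p + y) rr0 rr1; rewrite ler_pM2l//; apply.
  by apply: le_trans (ler_normD _ _) _; rewrite -lerBrDl ltW.
have := viscM _ p (Ck_translate_s r phi2) sS touch.
rewrite (Lop_speed q e c1 c) Lop_translate_s derive_translate_s.
have := phieq (p + r *: s_dir); rewrite shift_s2 => /eqP; rewrite addr_eq0 => /eqP ->.
have hV : 0 <= V p <= 1 by have /andP[/ltW-> /ltW->] := V01 p.
have := HLip p.2 (V p) (phi (p + r *: s_dir)) hV (phi01 _).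
move=> /(le_trans (ler_norm _)) hf.
have hVz : `|V p - phi (p + r *: s_dir)| <= z + err.
  have -> : V p - phi (p + r *: s_dir) = z + (V p - M p) by rewrite /z; ring.
  apply: le_trans (ler_normD _ _) _; rewrite (gtr0_norm zpos) lerD2l distrC.
  exact: closeM.
have hf2 : f p.2 (V p) - f p.2 (phi (p + r *: s_dir)) <= Lip * (z + err).
  by apply: le_trans hf _; rewrite ler_pM2l.
have hD : (Lip + 1) * z <= (c1 - c) * 'D_s_dir phi (p + r *: s_dir).
  have -> : (Lip + 1) * z = (c1 - c) * (kap * z) by rewrite /kap; field; rewrite gt_eqF.
  by rewrite ler_pM2l.
have zbig : (1 + Lip) * err < z.
  rewrite errE; apply: lt_le_trans z0; rewrite ltr_pM2l//.
  by rewrite ltf_pV2 ?posrE ?mulr_gt0// ltr_pM2r// ltr_nat.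
move: hf2 hD zbig; clearbody z.
move: (f p.2 (V p)) (f p.2 _) ('D_s_dir phi _) => A B D h1 h2 h3 h4.
have h5 : (c - c1) * D = - ((c1 - c) * D) by ring.
rewrite h5 in h4; clear -h1 h2 h3 h4; move: ((c1 - c) * D) h2 h4 => X h2 h4; lra.
Qed.
End sliding.

(** * Nonlinear selection *)

Section speeds.
Context {R : realType} {N : nat} (L : 'I_N -> R).
Hypothesis L0 : forall i, 0 < L i.
Variables (q : 'rV[R]_N -> 'rV[R]_N) (f : 'rV[R]_N -> R -> R) (e : 'rV[R]_N).
Hypothesis he : dot e e = 1.

(** A convex function that meets the line of slope [c1] at [mu1 < mu2] lies above it
    to the right of [mu2], but at [lam0] it lies strictly below. *)
Lemma minimizer_lt_second_root (k : R -> R) (c0 c1 mu1 mu2 lam0 : R) :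
  (forall lambda, principal_eigenvalue L q f e lambda (k lambda)) ->
  c0 < c1 -> 0 < mu1 -> mu1 < mu2 -> k mu1 = c1 * mu1 -> k mu2 = c1 * mu2 ->
  0 < lam0 -> k lam0 = c0 * lam0 -> lam0 < mu2.
Proof.
move=> hk c01 mu10 mu12 k1 k2 l0 kl; rewrite ltNge; apply/negP => l2.
have mu20 : 0 < mu2 by exact: lt_trans mu12.
have l2' : mu2 < lam0.
  rewrite lt_neqAle l2 andbT; apply/eqP => E.
  by move: kl; rewrite -E k2 => /(mulIf (lt0r_neq0 mu20)) E'; move: c01; rewrite E' ltxx.
have D0 : 0 < lam0 - mu1 by rewrite subr_gt0 (lt_trans mu12).
pose t := (lam0 - mu2) / (lam0 - mu1).
have t0 : 0 <= t by rewrite divr_ge0 ?(ltW D0)// subr_ge0.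
have t1 : 0 < 1 - t by rewrite subr_gt0 ltr_pdivrMr// mul1r ltrD2l ltrN2.
have El : mu2 = t * mu1 + (1 - t) * lam0.
  by rewrite /t; field; rewrite gt_eqF.
have [P1 H1] := hk mu1; have [P2 H2] := hk mu2; have [P3 H3] := hk lam0.
have t01 : 0 <= t <= 1 by rewrite t0 -subr_ge0 ltW.
have := eigenvalue_convex L0 he t01 El H1 H2 H3.
rewrite k1 k2 kl leNgt => /negP; apply; rewrite [X in _ < c1 * X]El -subr_gt0.
have -> : c1 * (t * mu1 + (1 - t) * lam0) - (t * (c1 * mu1) + (1 - t) * (c0 * lam0)) =
  (1 - t) * ((c1 - c0) * lam0) by ring.
by rewrite !mulr_gt0// subr_gt0.
Qed.
End speeds.

Theorem theorem2p3 (R : realType) (N : nat) (hN : (0 < N)%N)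
    (L : 'I_N -> R) (alpha : R) (q : 'rV[R]_N -> 'rV[R]_N)
    (f : 'rV[R]_N -> R -> R)
    (hqf : standing_assumptions L alpha q f)
    (e : 'rV[R]_N) (he : dot e e = 1)
    (k : R -> R) (hk : forall lambda, principal_eigenvalue L q f e lambda (k lambda))
    (hk0 : 0 < k 0)
    (c0 : R) (hc0 : is_linear_speed k c0)
    (cstar : R) (hcstar : is_minimal_speed L q f e cstar)
    (c1 : R) (hc1 : c0 < c1)
    (mu1 mu2 : R) (hmu : speed_roots k c1 mu1 mu2)
    (Psi : 'rV[R]_N -> R)
    (hPsi : principal_eigenfunction L q f e mu2 (k mu2) Psi)
    (V : R * 'rV[R]_N -> R)
    (hVc : continuous V)
    (hVper : periodic_x L V)
    (hV01 : forall p, 0 < V p < 1)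
    (hVsup : exists2 d : R, d < 1 &
       \forall s \near +oo, forall x, V (s, x) <= d)
    (hVinf : equivalent_at_ninfty V (fun p => Psi p.2 * expR (mu2 * p.1)))
    (hVsub : distr_subsolution q f e c1 V) :
  [/\ c1 <= cstar,
      forall c, c0 <= c < c1 -> ~ exists phi, pulsating_front L q f e c phi
    & c0 < cstar].
Proof.
have L0 := period_gt0 hqf; have a0 := alpha_gt0 hqf.
have [hmu12 hroots] := hmu; move/andP: hmu12 => [mu10 mu12].
have mu20 : 0 < mu2 := lt_trans mu10 mu12.
have k1 : k mu1 = c1 * mu1 by apply/esym/(hroots _ mu10); left.
have k2 : k mu2 = c1 * mu2 by apply/esym/(hroots _ mu20); right.
have [[lam0 /= lam00 clam] _] := hc0.
have klam : k lam0 = c0 * lam0 by rewrite -clam divfK// gt_eqF.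
have lammu := minimizer_lt_second_root L0 he hk hc1 mu10 mu12 k1 k2 lam00 klam.
have [cstar0 nofront fronts] := hcstar.
suff main : c1 <= cstar.
  split=> // [c /andP[_ cc1]|]; last exact: lt_le_trans hc1 main.
  by apply: nofront; exact: lt_le_trans cc1 main.
rewrite leNgt; apply/negP => lt_c1.
(* [c0 < c] makes the exponential of the minimizer a supersolution, [cstar <= c] gives
   a front, and [c < c1] makes it drift *)
pose c := (Num.max c0 cstar + c1) / 2.
have m1 : Num.max c0 cstar < c1 by rewrite gt_max hc1.
have mc : Num.max c0 cstar < c by rewrite ltr_pdivlMr// mulr_natr mulr2n ltrD2l.
have cc1 : c < c1 by rewrite ltr_pdivrMr// mulr_natr mulr2n ltrD2r.
have c0c : c0 < c by apply: le_lt_trans mc; rewrite le_max lexx.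
have csc : cstar <= c by apply/ltW; apply: le_lt_trans mc; rewrite le_max lexx orbT.
have [phi Hphi inc] := fronts c csc.
have [P0 HP0] := hk lam0.
have hlin := reaction_linearization a0 (f_C1a hqf) (f_at0 hqf).
have cmu : c * mu2 < k mu2 by rewrite k2 ltr_pM2r.
have knu : k lam0 <= c * lam0 by rewrite klam ler_pM2r// ltW.
have [delta delta0 [S0 Hlow]] := front_lower_bound L0 he hlin Hphi inc hPsi cmu HP0 knu lammu.
have [Pm Pm0 [PM HP]] := eigenfunction_bounds L0 hPsi.
have Psi0 x : 0 < Psi x by have /andP[h _] := HP x; exact: lt_le_trans h.
have Vdecay : exists S : R, forall p, p.1 <= - S -> V p <= 2 * (Psi p.2 * expR (mu2 * p.1)).
  have [S HS] := near_ninfty (hVinf _ ltr01); exists S => p pS.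
  have := HS p.1 pS p.2; rewrite -surjective_pairing.
  move=> /(le_lt_trans (ler_norm _)); rewrite ltrBlDr.
  have W0 : 0 < Psi p.2 * expR (mu2 * p.1) by rewrite mulr_gt0// expR_gt0.
  by rewrite /= ltr_pdivrMr// => /ltW.
have [d d1 hVd] := hVsup.
have Vsup : exists S : R, forall p, S <= p.1 -> V p <= d.
  have [S HS] := near_pinfty hVd; exists S => p pS.
  by have := HS p.1 pS p.2; rewrite -surjective_pairing.
have Vninf eps : 0 < eps -> exists S : R, forall p, p.1 <= - S -> V p <= eps.
  move=> eps0; have [S HS] := Vdecay.
  have PM0 : 0 < PM by have /andP[a b] := HP 0; apply: lt_le_trans Pm0 (le_trans a b).
  have e1 : 0 < eps / (2 * PM) by rewrite divr_gt0// mulr_gt0.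
  have [S' HS'] := expR_decay mu20 e1.
  exists (Num.max S S') => p; rewrite lerNr ge_max => /andP[p1 p2].
  apply: le_trans (HS p _) _; first by rewrite lerNr.
  have := HS' p.1; rewrite lerNr => /(_ p2); rewrite ler_pdivlMr ?mulr_gt0// => H.
  apply: le_trans H; have -> : 2 * (Psi p.2 * expR (mu2 * p.1)) =
    expR (mu2 * p.1) * (2 * Psi p.2) by ring.
  by rewrite ler_wpM2l ?expR_ge0// ler_wpM2l//; have /andP[] := HP p.2.
have [r1 Hr1] := initial_order L0 hVc hVper hV01 d1 Vsup Hphi inc mu20 Pm0 HP Vdecay delta0 Hlow.
have [Lip Lip0 HLip] := reaction_lipschitz L0 a0 (f_C1a hqf) (f_periodic hqf).
have [Cq Cq0 HCq] := drift_lipschitz L0 a0 (q_C1a hqf) (q_periodic hqf).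
have V1 p : `|V p| <= 1 by have /andP[h1 h2] := hV01 p; rewrite gtr0_norm// ltW.
have cF := reaction_continuous (f_C1a hqf) hVc hV01.
have perF : periodic_x L (fun p => f p.2 (V p)).
  move=> s kk x /=; have := hVper s kk x => /= ->.
  have hV : 0 <= V (s, x) <= 1 by have /andP[/ltW-> /ltW->] := hV01 (s, x).
  exact: (f_periodic hqf hV kk x).
have visc := viscosity_approximation L0 he (drift_C1 a0 (q_C1a hqf)) (q_div0 hqf) Cq0 HCq
  hVc V1 hVper (erefl _) cF perF hVsub.
exact: (sliding_contradiction L0 hV01 d1 Vsup Hphi cc1 Lip0 HLip Vninf visc Hr1).
Qed.
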